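(* Let $0<\alpha<2$, $d\ge1$ an integer with $\alpha<d$, and $0\le\delta\le d-\alpha$. Let $(\mathcal{E}^\delta,\mathcal{D}(\mathcal{E}^\delta))$ be the Dirichlet form on $L^2(\mathbb{R}^d;|x|^{-2\delta}dx)$ obtained as the closure of $$\mathcal{E}^{\delta}(u,u)=\frac12\,\mathcal{A}(d,\alpha)\iint_{\mathbb{R}^d\times\mathbb{R}^d\setminus\triangle}\frac{(u(x)-u(y))^2}{|x-y|^{d+\alpha}|x|^\delta|y|^\delta}\,dx\,dy,\qquad u\in C_0^\infty(\mathbb{R}^d\setminus\{0\}).$$ Then $(\mathcal{E}^\delta,\mathcal{D}(\mathcal{E}^\delta))$ is recurrent if and only if $\delta=(d-\alpha)/2$; for $\delta\ne(d-\alpha)/2$ it is transient.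
   Context: $\triangle=\{(x,x):x\in\mathbb{R}^d\}$ and $\mathcal{A}(d,\alpha)=\dfrac{\alpha2^{d-1}\Gamma(\frac{\alpha+d}{2})}{\pi^{d/2}\Gamma(1-\frac\alpha2)}$. For a Dirichlet form $(\mathcal{A},\mathcal{D}(\mathcal{A}))$ on $L^2(E;n)$: the extended Dirichlet space $\mathcal{D}_e(\mathcal{A})$ is the set of measurable $u$ with $|u|<\infty$ a.e. for which there is an $\mathcal{A}$-Cauchy sequence $u_k\in\mathcal{D}(\mathcal{A})$ with $u_k\to u$ a.e., and $\mathcal{A}(u,u)=\lim_k\mathcal{A}(u_k,u_k)$. The form is transient if there is a bounded $g\in L^1(E;n)$, $g>0$ a.e., with $\int_E|u|g\,dn\le\sqrt{\mathcal{A}(u,u)}$ for all $u\in\mathcal{D}(\mathcal{A})$; it is recurrent if $1\in\mathcal{D}_e(\mathcal{A})$ and $\mathcal{A}(1,1)=0$. *)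

(* Defs.v *)
From HB Require Import structures.
From mathcomp Require Import all_boot all_order all_algebra.
From mathcomp Require Import all_classical all_reals all_analysis.
From mathcomp Require Import measurable_realfun.

Set Implicit Arguments.
Unset Strict Implicit.
Unset Printing Implicit Defensive.

Import Order.TTheory GRing.Theory Num.Theory.
Import numFieldNormedType.Exports.

Local Open Scope classical_set_scope.
Local Open Scope ring_scope.

Section quadratic_forms.
Context (disp : measure_display) (T : measurableType disp) (R : realType).

(* A symmetric form given by its diagonal energy u = A(u, u), which determines
   it by polarization; only the values on the domain are meaningful. *)
Record form := Form {
  dom : set (T -> R) ;
  energy : (T -> R) -> \bar R
}.

Definition form_cauchy (A : form) (v : nat -> T -> R) :=
  forall e : R, 0 < e -> exists N : nat, forall k l : nat,
    (N <= k)%N -> (N <= l)%N -> (energy A (v k \- v l)%R < e%:E)%E.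

Variable n : {measure set T -> \bar R}.

Definition closure_approx (A : form) (u : T -> R) (v : nat -> T -> R) :=
  [/\ forall k, dom A (v k), form_cauchy A v
    & 'N[n]_(2%:E)[EFin \o (v k \- u)%R]%E @[k --> \oo] --> 0%E].

(* The smallest closed extension of a closable A in L^2(n).  Functions are not
   quotiented by a.e. equality; the domain is stable under it.  For closable A
   the limit of the energies does not depend on v, so that xget picks the only
   element; +oo is the default value off the domain. *)
Definition form_closure (A : form) : form := {|
  dom := [set u | u \in Lfun n 2%:E /\ exists v, closure_approx A u v] ;
  energy := fun u => xget +oo%E [set r : \bar R | exists2 v,
    closure_approx A u v & energy A (v k) @[k --> \oo] --> r]
|}.

Definition extended_approx (A : form) (u : T -> \bar R) (v : nat -> T -> R) :=
  [/\ forall k, dom A (v k), form_cauchy A v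
    & {ae n, forall x, (v k x)%:E @[k --> \oo] --> u x}].

Definition extended_dom (A : form) : set (T -> \bar R) :=
  [set u : T -> \bar R | [/\ measurable_fun setT u, {ae n, forall x, (u x \is a fin_num)}
             & exists v, extended_approx A u v]].

Definition extended_energy (A : form) (u : T -> \bar R) : \bar R :=
  xget +oo%E [set r : \bar R | exists2 v,
    extended_approx A u v & energy A (v k) @[k --> \oo] --> r].

Definition transient (A : form) := exists g : T -> R,
  [/\ exists M : R, forall x, `|g x| <= M,
      n.-integrable setT (EFin \o g),
      {ae n, forall x, 0 < g x}
    & forall u, dom A u ->
        (\int[n]_x (`|u x| * g x)%:E <= sqrte (energy A u))%E].

Definition recurrent (A : form) :=
  extended_dom A (cst 1%E) /\ extended_energy A (cst 1%E) = 0%E.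

End quadratic_forms.

Section measure_with_density.
Local Open Scope ereal_scope.
Context (disp : measure_display) (T : measurableType disp) (R : realType).
Variables (mu : {measure set T -> \bar R}) (f : T -> \bar R).
Hypothesis mf : measurable_fun setT f.
Hypothesis f0 : forall x, 0 <= f x.

Definition density_measure_fun (A : set T) := \int[mu]_(x in A) f x.

Let density_measure0 : density_measure_fun set0 = 0.
Proof. exact: integral_set0. Qed.

Let density_measure_ge0 A : 0 <= density_measure_fun A.
Proof. exact: integral_ge0. Qed.

Let density_measure_sigma_additive : semi_sigma_additive density_measure_fun.
Proof. exact: semi_sigma_additive_nng_induced. Qed.

HB.instance Definition _ := isMeasure.Build _ _ _ density_measure_fun
  density_measure0 density_measure_ge0 density_measure_sigma_additive.

Definition density_measure : {measure set T -> \bar R} := density_measure_fun.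

End measure_with_density.

(* R^d is 'rV[R]_d with its (product) Borel sigma-algebra, generated by the
   coordinates as for n.-tuple. *)
Definition rV_display : measure_display -> measure_display.
Proof. exact. Qed.

Section rV_measurable.
Context (R : realType) (d : nat).

Let coor (i : 'I_d) (x : 'rV[R]_d) : R := x ord0 i.

Let rV_set0 : g_sigma_preimage coor set0.
Proof. exact: sigma_algebra0. Qed.

Let rV_setC A : g_sigma_preimage coor A -> g_sigma_preimage coor (~` A).
Proof. exact: sigma_algebraC. Qed.

Let rV_bigcup (F : _^nat) : (forall i, g_sigma_preimage coor (F i)) ->
  g_sigma_preimage coor (\bigcup_i (F i)).
Proof. exact: sigma_algebra_bigcup. Qed.

HB.instance Definition _ := @isMeasurable.Build (rV_display default_measure_display)
  'rV[R]_d (g_sigma_preimage coor) rV_set0 rV_setC rV_bigcup.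

End rV_measurable.

Lemma measurable_coor (R : realType) (d : nat) (i : 'I_d) :
  measurable_fun setT (fun x : 'rV[R]_d => x ord0 i).
Proof.
move=> _ Y mY; rewrite setTI; apply: sub_sigma_algebra => /=.
rewrite -bigcup_seq/=; exists i => /=; first by rewrite mem_index_enum.
by exists Y => //; rewrite setTI.
Qed.

Lemma measurable_fun_rVP (disp : measure_display) (T : measurableType disp)
    (R : realType) (d : nat) (f : T -> 'rV[R]_d) :
  (forall i, measurable_fun setT (fun x => f x ord0 i)) ->
  measurable_fun setT f.
Proof.
move=> mf _ Y mY; rewrite setTI.
pose C : set (set 'rV[R]_d) := [set A | measurable (f @^-1` A)].
have : (@measurable _ 'rV[R]_d) `<=` C; last exact.
apply: smallest_sub.
  split; rewrite /C /=.
  - by rewrite preimage_set0.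
  - by move=> A mA; rewrite setTD preimage_setC; exact: measurableC.
  - by move=> F mF; rewrite preimage_bigcup; exact: bigcupT_measurable.
move=> A; rewrite -bigcup_seq => -[i _ [B mB <-]]; rewrite /C /= setTI.
by rewrite -[X in measurable X]setTI; exact: mf.
Qed.

Section rV_cons.
Context (R : realType) (d : nat).

Definition rV_cons (p : measurableTypeR R * 'rV[R]_d) : 'rV[R]_d.+1 :=
  row_mx (p.1 : R)%:M p.2.

Definition rV_uncons (x : 'rV[R]_d.+1) : measurableTypeR R * 'rV[R]_d :=
  (x ord0 ord0, rsubmx (x : 'rV_(1 + d))).

Lemma rV_consK : cancel rV_cons rV_uncons.
Proof.
move=> [t y]; rewrite /rV_cons /rV_uncons /=; congr pair; last exact: row_mxKr.
transitivity (row_mx (t : R)%:M y ord0 (lshift d ord0)).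
  by congr (row_mx _ _ _ _); apply/val_inj.
by rewrite row_mxEl mxE.
Qed.

Lemma rV_unconsK : cancel rV_uncons rV_cons.
Proof.
move=> x; rewrite /rV_cons /rV_uncons /=.
rewrite -[RHS](@hsubmxK R 1 1 d x).
suff -> : (x ord0 ord0)%:M = lsubmx (x : 'rV_(1 + d)) by [].
apply/matrixP => i j; rewrite !ord1 !mxE /= mulr1n.
by congr (x _ _); apply/val_inj.
Qed.

Lemma measurable_rV_cons : measurable_fun setT rV_cons.
Proof.
apply: measurable_fun_rVP => i.
rewrite -[i](@splitK 1 d); case: (@fintype.split 1 d i) => j /=.
  rewrite (_ : (fun _ => _) = fst); first exact: measurable_fst.
  by apply/funext => -[t y]; rewrite /rV_cons (@row_mxEl R 1 1 d) /= !ord1 mxE.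
rewrite (_ : (fun _ => _) = (fun x : 'rV[R]_d => x ord0 j) \o snd).
  by apply: (measurableT_comp (measurable_coor j)); exact: measurable_snd.
by apply/funext => -[t y]; rewrite /rV_cons (@row_mxEr R 1 1 d).
Qed.

Lemma measurable_rV_uncons : measurable_fun setT rV_uncons.
Proof.
apply/measurable_fun_pairP; split; first exact: measurable_coor.
apply: measurable_fun_rVP => i /=.
rewrite (_ : (fun _ => _) = (fun x : 'rV[R]_d.+1 => x ord0 (rshift 1 i))).
  exact: measurable_coor.
by apply/funext => x; rewrite mxE.
Qed.

End rV_cons.

Section leb_step.
Context (R : realType) (d : nat).
Variable m : {sigma_finite_measure set 'rV[R]_d -> \bar R}.
Local Open Scope ereal_scope.

Definition leb_step_fun : set 'rV[R]_d.+1 -> \bar R :=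
  pushforward (@lebesgue_measure R \x m) (@rV_cons R d).

Let leb_step0 : leb_step_fun set0 = 0.
Proof. by rewrite /leb_step_fun /pushforward preimage_set0 measure0. Qed.

Let leb_step_ge0 A : 0 <= leb_step_fun A.
Proof. by rewrite /leb_step_fun /pushforward measure_ge0. Qed.

Let leb_step_sigma_additive : semi_sigma_additive leb_step_fun.
Proof.
have mpre (A : set 'rV[R]_d.+1) : measurable A -> measurable (@rV_cons R d @^-1` A).
  by move=> mA; rewrite -[X in measurable X]setTI; exact: measurable_rV_cons.
move=> F mF tF mUF; rewrite /leb_step_fun /pushforward preimage_bigcup.
apply: measure_semi_sigma_additive.
- by move=> k; exact: mpre.
- apply/trivIsetP => /= i j _ _ ij; rewrite -preimage_setI.
  by move/trivIsetP : tF => /(_ _ _ _ _ ij) ->//; rewrite preimage_set0.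
- by rewrite -preimage_bigcup; exact: mpre.
Qed.

HB.instance Definition _ := isMeasure.Build _ _ _ leb_step_fun
  leb_step0 leb_step_ge0 leb_step_sigma_additive.

Let leb_step_sigma_finite : sigma_finite setT leb_step_fun.
Proof.
have /sigma_finiteP[F [TF ndF Foo]] := sigma_finiteT (@lebesgue_measure R).
have /sigma_finiteP[G [TG ndG Goo]] := sigma_finiteT m.
exists (fun k => @rV_uncons R d @^-1` (F k `*` G k)).
  rewrite -preimage_bigcup (_ : \bigcup_k _ = setT) ?preimage_setT//.
  apply/seteqP; split=> // -[x y] _.
  have [k _ Fx] : (\bigcup_k F k) x by rewrite -TF.
  have [l _ Gy] : (\bigcup_k G k) y by rewrite -TG.
  exists (maxn k l) => //; split => /=.
    by move: x Fx; exact/subsetPset/ndF/leq_maxl.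
  by move: y Gy; exact/subsetPset/ndG/leq_maxr.
move=> k; have [mFk Fk] := Foo k; have [mGk Gk] := Goo k; split.
  rewrite -[X in measurable X]setTI; apply: measurable_rV_uncons => //.
  exact: measurableX.
rewrite /leb_step_fun /pushforward -comp_preimage.
rewrite (_ : _ \o _ = id) ?preimage_id; last first.
  by apply/funext => p /=; rewrite rV_consK.
by rewrite product_measure1E// lte_mul_pinfty// ge0_fin_numE.
Qed.

HB.instance Definition _ := Measure_isSigmaFinite.Build _ _ _ leb_step_fun
  leb_step_sigma_finite.

Definition leb_step : {sigma_finite_measure set 'rV[R]_d.+1 -> \bar R} :=
  leb_step_fun.

End leb_step.

(* d-dimensional Lebesgue measure, as the d-fold product of the
   one-dimensional one. *)
Fixpoint leb (R : realType) (d : nat) :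
    {sigma_finite_measure set 'rV[R]_d -> \bar R} :=
  match d with
  | 0 => \d_(0 : 'rV[R]_0)
  | d'.+1 => leb_step (leb R d')
  end.

Section euclidean_space.
Context (R : realType) (d : nat).

(* The library norm on 'rV[R]_d is the sup norm. *)
Definition enorm (x : 'rV[R]_d) : R := Num.sqrt (\sum_i x ord0 i ^+ 2).

Lemma measurable_enorm : measurable_fun setT enorm.
Proof.
apply: (measurableT_comp (continuous_measurable_fun (@sqrt_continuous R))).
apply: measurable_sum => i; apply: measurable_funX; exact: measurable_coor.
Qed.

Fixpoint Ck (k : nat) (f : 'rV[R]_d -> R) : Prop :=
  match k with
  | 0 => continuous f
  | k'.+1 => continuous f /\ forall i : 'I_d,
      (forall x, derivable f x (delta_mx ord0 i)) /\
      Ck k' (fun x => 'D_(delta_mx ord0 i) f x)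
  end.

Definition smooth (f : 'rV[R]_d -> R) := forall k, Ck k f.

(* C_0^oo(R^d \ {0}): the compact support (in R^d) avoids the origin. *)
Definition test_functions_off0 : set ('rV[R]_d -> R) :=
  [set f | [/\ smooth f, compact (closure [set x | f x != 0])
             & ~ closure [set x | f x != 0] 0]].

End euclidean_space.

Section the_form.
Context (R : realType) (d : nat).

Definition Gamma (s : R) : R :=
  \int[@lebesgue_measure R]_(t in `]0, +oo[) (t `^ (s - 1) * expR (- t)).

Definition stable_const (alpha : R) : R :=
  alpha * 2 ^+ d.-1 * Gamma ((alpha + d%:R) / 2) /
  (pi `^ (d%:R / 2) * Gamma (1 - alpha / 2)).

(* Values at x = 0 (where 0 `^ (- _) = 0 for a nonzero exponent) are irrelevant,
   the origin being negligible. *)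
Definition weight (delta : R) (x : 'rV[R]_d) : \bar R :=
  (enorm x `^ (- (2 * delta)))%:E.

Lemma measurable_weight (delta : R) : measurable_fun setT (weight delta).
Proof.
apply/measurable_EFinP.
apply: (measurableT_comp (@measurable_powR R _)); exact: measurable_enorm.
Qed.

Lemma weight_ge0 (delta : R) x : (0 <= weight delta x)%E.
Proof. by rewrite lee_fin powR_ge0. Qed.

(* |x|^(-2 delta) dx *)
Definition weighted_leb (delta : R) : {measure set 'rV[R]_d -> \bar R} :=
  density_measure (leb R d) (measurable_weight delta) (weight_ge0 delta).

Definition diagonal : set ('rV[R]_d * 'rV[R]_d) := [set p | p.1 = p.2].

Definition pre_form (alpha delta : R) : form 'rV[R]_d R := {|
  dom := @test_functions_off0 R d ;
  energy := fun u =>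
    ((2^-1 * stable_const alpha)%:E *
     \int[(leb R d \x leb R d)]_(p in ~` diagonal)
       ((u p.1 - u p.2) ^+ 2 /
        (enorm (p.1 - p.2) `^ (d%:R + alpha) *
         enorm p.1 `^ delta * enorm p.2 `^ delta))%:E)%E
|}.

Definition dirichlet_form (alpha delta : R) : form 'rV[R]_d R :=
  form_closure (weighted_leb delta) (pre_form alpha delta).

End the_form.

(* Main.v *)
(** Put E(u) for the double integral.  Splitting the kernel over |x - y| << |x|
    and translating, E(u) dominates the Hardy integral of
    u^2 |x|^(-2 delta - alpha) as soon as 2 delta + alpha <> d: the dilate
    u(2 x) differs from u by an increment that E controls, whereas dilation
    multiplies the weighted norm by a constant other than 1.  A multiple of
    |x|^(-alpha), cut down to an integrable function, then witnesses
    transience by Cauchy-Schwarz, and transience excludes recurrence.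

    If 2 delta + alpha = d, the form is dilation invariant, so a function that
    is L-Lipschitz in ln |x| and lives on 2^-k <= |x| <= 2^k has energy
    O(L^2 k).  Smooth cutoffs of ln |x| / k have L = O(1/k), so their energies
    tend to 0 while they converge to 1 off the origin.

    By Fatou's lemma, the limit defining the energy on the closure is again the
    double integral, so that it does not depend on the approximating sequence. *)
From HB Require Import structures.
Require Import Defs.
From mathcomp Require Import all_boot all_order all_algebra.
From mathcomp Require Import all_classical all_reals all_analysis.
From mathcomp Require Import measurable_realfun.
From mathcomp Require Import ring lra zify.

Set Implicit Arguments.
Unset Strict Implicit.
Unset Printing Implicit Defensive.

Import Order.TTheory GRing.Theory Num.Theory.
Import numFieldNormedType.Exports.

Local Open Scope classical_set_scope.
Local Open Scope ring_scope.

(** * Lebesgue measure on R^d *)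

(** The energy does not see the null set of pairs (x, 2 x), so the increment u(x) - u(2 x) is
    reached through intermediate points y with |x| <= |y| <= 2 |x|. Then (x, y) and (y, 2 x) are
    both pairs of comparable points, where the kernel is at least a multiple of |x|^(-2 delta -
    alpha - d), and averaging over y gains the volume of the shell, of order |x|^d. The Hardy
    integral is then absorbed into itself, which requires it to be finite. Finiteness holds for test
    functions, so what is carried over to the closure is not the Hardy bound but the inequality
    defining transience, by L2 convergence against a reference function in L2. In the critical case
    the squared increment of ln |x| is integrated in y against the kernel. Near the diagonal it
    gains |x - y|^2, which suffices because alpha < 2. Far away, where it is unbounded, it is
    dominated by the power alpha / 2 of |x| / |y| or |y| / |x|, small enough to stay integrable at
    the origin and at infinity. The result is a multiple of |x|^(-d), whose integral over an annulus
    counts dyadic shells. *)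

Section density_integral.
Local Open Scope ereal_scope.
Context (disp : measure_display) (T : measurableType disp) (R : realType).
Variables (mu : {measure set T -> \bar R}) (w : T -> \bar R).
Hypothesis mw : measurable_fun setT w.
Hypothesis w0 : forall x, 0 <= w x.
Hypothesis wfin : forall x, w x \is a fin_num.

Import HBNNSimple.

Lemma ge0_integral_density_measure (f : T -> \bar R) :
  measurable_fun setT f -> (forall x, 0 <= f x) ->
  \int[density_measure mu mw w0]_x f x = \int[mu]_x (f x * w x).
Proof.
move=> mf f0; pose f_ := nnsfun_approx measurableT mf.
transitivity (limn (fun n => \int[density_measure mu mw w0]_x (f_ n x)%:E)).
  rewrite -monotone_convergence//.
  - apply: eq_integral => y _; apply/esym/cvg_lim => //.
    exact: cvg_nnsfun_approx.
  - by move=> n; exact/measurable_EFinP/measurable_funP.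
  - by move=> n y _; rewrite lee_fin.
  - by move=> y _ m n mn; rewrite lee_fin; exact/lefP/nd_nnsfun_approx.
have mfn n : measurable_fun setT (EFin \o f_ n).
  exact/measurable_EFinP/measurable_funP.
rewrite [X in limn X](_ : _ = (fun n => \int[mu]_x ((f_ n x)%:E * w x))).
  rewrite -monotone_convergence//.
  - apply: eq_integral => x _ /=; apply/cvg_lim => //.
    by apply: cvgeZr => //; apply: cvg_nnsfun_approx.
  - by move=> n; apply: emeasurable_funM => //; exact: mfn.
  - by move=> n x _; rewrite mule_ge0// lee_fin.
  - move=> x _ m n mn; rewrite lee_wpmul2r// lee_fin.
    exact/lefP/nd_nnsfun_approx.
apply/funext => n.
transitivity (\sum_(k \in range (f_ n))
    \int[density_measure mu mw w0]_x (k * \1_(f_ n @^-1` [set k]) x)%:E).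
  under eq_integral do rewrite fimfunE -fsumEFin//.
  rewrite ge0_integral_fsum//.
  - by move=> y; exact/measurable_EFinP/measurable_funM.
  - by move=> y x _; rewrite nnfun_muleindic_ge0.
under eq_integral => x _.
  rewrite fimfunE -fsumEFin// ge0_mule_fsuml; last first.
    by move=> y; rewrite nnfun_muleindic_ge0.
  over.
rewrite ge0_integral_fsum//.
- apply: eq_fsbigr => k; rewrite inE => -[x _ <-]; set r := f_ n x.
  have r0 : (0 <= r)%R by [].
  have mA : measurable (f_ n @^-1` [set r]) by [].
  under eq_integral do rewrite EFinM.
  rewrite ge0_integralZl_EFin//; last exact/measurable_EFinP/measurable_indic.
  rewrite integral_indic// setIT.
  under [RHS]eq_integral do rewrite EFinM -muleA.
  rewrite ge0_integralZl_EFin//; last 2 first.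
  - by move=> y _; rewrite mule_ge0// lee_fin.
  - by apply: emeasurable_funM => //; exact/measurable_EFinP/measurable_indic.
  congr (_ * _); rewrite /= /density_measure_fun [LHS]integral_mkcond.
  apply: eq_integral => y _; rewrite patchE indicE.
  by case: (y \in _); rewrite ?mul1e ?mul0e.
- move=> y; apply: emeasurable_funM => //.
  by apply/measurable_EFinP; exact: measurable_funM.
- by move=> y x _; rewrite mule_ge0// nnfun_muleindic_ge0.
Qed.

End density_integral.

Section affine_change_of_variables.
Local Open Scope ereal_scope.
Context (R : realType).

Lemma measurable_affine (l b : R) : measurable_fun setT
  ((fun t => l * t + b)%R : measurableTypeR R -> measurableTypeR R).
Proof. by apply: measurable_funD => //; exact: measurable_funM. Qed.

(** The image of Lebesgue measure under t -> l t + b, rescaled by l, agrees with Lebesgue measure on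
    half-open intervals, hence everywhere by uniqueness. *)
Lemma ge0_integral_affine (l b : R) (f : R -> \bar R) : (0 < l)%R ->
  measurable_fun setT f -> (forall x, 0 <= f x) ->
  \int[@lebesgue_measure R]_x f x =
  l%:E * \int[@lebesgue_measure R]_x f (l * x + b)%R.
Proof.
move=> l0 mf f0; pose phi := (fun t => l * t + b)%R : measurableTypeR R -> measurableTypeR R.
have mphi : measurable_fun setT phi by exact: measurable_affine.
pose pm : {measure set (measurableTypeR R) -> \bar R} :=
  pushforward (@lebesgue_measure R) phi.
pose m : {measure set (measurableTypeR R) -> \bar R} := mscale (NngNum (ltW l0)) (pm mphi).
have mE A : measurable A -> @lebesgue_measure R A = m A.
  apply: lebesgue_measure_unique => _ [[c d]] _ <-.
  rewrite /m /pm /mscale /= /mscale /= /pushforward.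
  have -> : phi @^-1` `]c, d]%classic = `]((c - b) / l)%R, ((d - b) / l)%R]%classic.
    apply/seteqP; split => x /=; rewrite !in_itv/= ltr_pdivrMr// ler_pdivlMr//.
      by rewrite /phi ltrBlDr lerBrDr ![(x * l)%R]mulrC.
    by rewrite /phi ltrBlDr lerBrDr ![(x * l)%R]mulrC.
  rewrite !lebesgue_measure_itv/= !lte_fin ltr_pM2r ?invr_gt0// ltrD2r.
  case: ifPn => _; last by rewrite mule0.
  by rewrite -!EFinD -EFinM; congr EFin; field; rewrite gt_eqF.
transitivity (\int[m]_x f x); first by apply: eq_measure_integral => A mA _; exact: mE.
by rewrite ge0_integral_mscale// ge0_integral_pushforward.
Qed.

End affine_change_of_variables.

Section leb_integral.
Local Open Scope ereal_scope.
Context (R : realType).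

Lemma integral_lebS d (f : 'rV[R]_d.+1 -> \bar R) :
  measurable_fun setT f -> (forall x, 0 <= f x) ->
  \int[leb R d.+1]_x f x =
  \int[@lebesgue_measure R]_t \int[leb R d]_y f (rV_cons (t, y)).
Proof.
move=> mf f0.
transitivity (\int[@lebesgue_measure R \x leb R d]_p (f \o @rV_cons R d) p).
  rewrite -[RHS](@ge0_integral_pushforward _ _ _ _ R _ (@measurable_rV_cons R d)
    (@lebesgue_measure R \x leb R d) setT)//.
rewrite fubini_tonelli1//; last by move=> p; exact: f0.
by apply: measurableT_comp => //; exact: measurable_rV_cons.
Qed.

Lemma measurable_rV_affine d (l : R) (b : 'rV[R]_d) :
  measurable_fun setT (fun x : 'rV[R]_d => l *: x + b)%R.
Proof.
apply: measurable_fun_rVP => i; under eq_fun do rewrite !mxE.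
by apply: measurable_funD => //; apply: measurable_funM => //; exact: measurable_coor.
Qed.

Lemma rV_cons_affine d (l t : R) (b : 'rV[R]_d.+1) (y : 'rV[R]_d) :
  (l *: rV_cons (t, y) + b)%R =
  rV_cons (l * t + (rV_uncons b).1, l *: y + (rV_uncons b).2)%R.
Proof.
apply: (can_inj (@rV_unconsK R d)); rewrite rV_consK /rV_uncons.
have [yt yy] : rV_uncons (rV_cons (t, y)) = (t, y) by exact: rV_consK.
congr pair; first by rewrite mxE [X in (X + _)%R]mxE yt.
rewrite -[in RHS]yy; apply/rowP => i.
by rewrite mxE mxE [X in (X + _)%R = _]mxE [RHS]mxE [X in _ = (X + _)%R]mxE
  [X in _ = (_ * X + _)%R]mxE [X in _ = (_ + X)%R]mxE.
Qed.

(** Induction through [integral_lebS]: the head coordinate is the one-dimensional case. Dilations (b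
    = 0) and translations (l = 1) are both used later. *)
Lemma integral_leb_affine d (l : R) (b : 'rV[R]_d) (f : 'rV[R]_d -> \bar R) :
  (0 < l)%R -> measurable_fun setT f -> (forall x, 0 <= f x) ->
  \int[leb R d]_x f x = (l ^+ d)%:E * \int[leb R d]_x f (l *: x + b)%R.
Proof.
move=> l0; elim: d b f => [|d IHd] b f mf f0.
  rewrite expr0 mul1e; apply: eq_integral => x _; congr f.
  by apply/matrixP => i [].
rewrite !integral_lebS//; last first.
  by apply: measurableT_comp => //; exact: measurable_rV_affine.
under [X in _ = _ * X]eq_integral do under eq_integral do rewrite rV_cons_affine.
pose g t := \int[leb R d]_y f (rV_cons (t, y)).
have mfc : measurable_fun setT (f \o @rV_cons R d).
  by apply: measurableT_comp => //; exact: measurable_rV_cons.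
have mg : measurable_fun setT g.
  by apply: (measurable_fun_fubini_tonelli_F (f \o @rV_cons R d)) => // x; exact: f0.
rewrite (@ge0_integral_affine _ l (rV_uncons b).1 g)//; last first.
  by move=> t; exact: integral_ge0.
rewrite exprS EFinM -muleA; congr (_ * _).
have mfa : measurable_fun setT (f \o (fun x => l *: x + b)%R \o @rV_cons R d).
  apply: measurableT_comp; last exact: measurable_rV_cons.
  by apply: measurableT_comp => //; exact: measurable_rV_affine.
rewrite -ge0_integralZl_EFin//; first last.
- by rewrite exprn_ge0// ltW.
- under eq_fun do under eq_integral do rewrite -rV_cons_affine.
  by apply: (measurable_fun_fubini_tonelli_F _ mfa) => x; exact: f0.
- by move=> t _; exact: integral_ge0.
apply: eq_integral => t _; rewrite /g.
rewrite (IHd (rV_uncons b).2)//.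
apply: (@measurableT_comp _ _ _ _ _ _ (f \o @rV_cons R d)) => //.
Qed.

End leb_integral.

(** * Integrals of powers over dyadic shells *)

Section dyadic_shells.
Local Open Scope ereal_scope.
Context (disp : measure_display) (T : measurableType disp) (R : realType).
Variable mu : {measure set T -> \bar R}.

(* The sets need not be disjoint. *)
Lemma integral_le_cover (f : T -> \bar R) (M : nat -> R) (A : nat -> set T) (B : R) :
  measurable_fun setT f -> (forall x, 0 <= f x) ->
  (forall j, 0 <= M j)%R -> (forall j, measurable (A j)) ->
  (forall x, 0 < f x -> exists2 j, A j x & f x <= (M j)%:E) ->
  (forall n, \sum_(0 <= j < n) (M j)%:E * mu (A j) <= B%:E) ->
  \int[mu]_x f x <= B%:E.
Proof.
move=> mf f0 M0 mA fM MB.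
pose g j x : \bar R := ((M j)%:E * (\1_(A j) x)%:E).
have g0 j x : 0 <= g j x by rewrite mule_ge0// lee_fin.
have mg j : measurable_fun setT (g j).
  by apply: emeasurable_funM => //; exact/measurable_EFinP/measurable_indic.
apply: (@le_trans _ _ (\int[mu]_x (\sum_(0 <= j <oo) g j x))).
  apply: ge0_le_integral => //.
  - exact: (@ge0_emeasurable_sum _ _ _ _ g xpredT).
  - move=> x _; case: (ltP 0 (f x)) => [|fx0]; last first.
      by apply: (le_trans fx0); exact: nneseries_ge0.
    move=> /fM[j Ajx fMj]; apply: (le_trans fMj).
    apply: (@le_trans _ _ (g j x)).
      by rewrite /g indicE mem_set// mule1.
    rewrite (@nneseriesD1 _ (g^~ x) j xpredT)//.
    by rewrite leeDl// nneseries_ge0.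
rewrite integral_nneseries//.
apply: lime_le.
  by apply: is_cvg_nneseries => j _ _; exact: integral_ge0.
apply: nearW => n; apply: le_trans (MB n).
apply: lee_sum => j _; rewrite ge0_integralZl_EFin//.
- by rewrite integral_indic// setIT.
- exact/measurable_EFinP/measurable_indic.
Qed.

End dyadic_shells.

Section power_integrals.
Local Open Scope ereal_scope.
Context (disp : measure_display) (T : measurableType disp) (R : realType).
Variable mu : {measure set T -> \bar R}.
Variables (rho : T -> R) (C D : R).
Hypothesis mrho : measurable_fun setT rho.
Hypothesis C0 : (0 <= C)%R.
Hypothesis muC : forall s : R, (0 < s)%R ->
  mu [set x | rho x <= s]%R <= (C * s `^ D)%:E.

(** The factor 2^|a| covers both signs of a: the largest value on the shell is at s / 2 if a >= 0
    and at s if a < 0. *)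
Lemma powR_shell (s r a : R) : (0 < s -> s / 2 <= r -> r <= s ->
  r `^ (- a) <= 2 `^ `|a| * s `^ (- a))%R.
Proof.
move=> s0 sr rs; have r0 : (0 < r)%R by apply: lt_le_trans sr; rewrite divr_gt0.
have [a0|a0] := leP 0%R a.
  have -> : (2 `^ `|a| * s `^ (- a) = (s / 2) `^ (- a))%R.
    rewrite ger0_norm// powRM ?invr_ge0 ?(ltW s0)// mulrC; congr (_ * _)%R.
    by rewrite -(powR_inv1 (ler0n R 2)) -powRrM mulN1r opprK.
  rewrite !powRN lef_pV2 ?posrE ?powR_gt0 ?divr_gt0//.
  by rewrite ge0_ler_powR// ?nnegrE ?divr_ge0// ltW.
apply: (@le_trans _ _ (s `^ (- a))%R).
  by rewrite ge0_ler_powR// ?nnegrE ?oppr_ge0 ltW.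
rewrite ler_peMl ?powR_ge0//.
by rewrite -[X in (X <= _)%R](powRr0 2%R) ler_powR// ler1n.
Qed.

Lemma measurable_powR_rho a : measurable_fun setT (fun x => rho x `^ a)%R.
Proof. by apply: (measurableT_comp (@measurable_powR R _)). Qed.

(** On the shell of outer radius s the integrand is at most 2^|a| s^(-a), and the volume at most C
    s^D. The predicate [P] allows finitely many shells, as for a = D. The abstract [rho] stands for
    the norm of R^d with D = d, and for |t| on the line with D = 1. *)
Lemma integral_shells (s : nat -> R) (P : pred nat) (S : set T) (a B : R) :
  measurable S -> (forall j, 0 < s j)%R ->
  (forall x, S x -> exists2 j, P j & (s j / 2 <= rho x <= s j)%R) ->
  (forall n, \sum_(0 <= j < n | P j) s j `^ (D - a) <= B)%R ->
  \int[mu]_(x in S) (rho x `^ (- a))%:E <= (2 `^ `|a| * C * B)%:E.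
Proof.
move=> mS s0 Ss sB; rewrite integral_mkcond.
have ms j : measurable [set x | rho x <= s j]%R.
  rewrite -[X in measurable X]setTI; have := mrho measurableT (measurable_itv `]-oo, s j]).
  by rewrite preimage_itvNyc.
apply: (@integral_le_cover _ _ _ _ _
  (fun j => if P j then 2 `^ `|a| * s j `^ (- a) else 0)%R
  (fun j => [set x | rho x <= s j]%R)) => //.
- rewrite -measurable_restrictT//.
  by apply/measurable_EFinP/measurable_funTS; exact: measurable_powR_rho.
- by move=> x; apply: erestrict_ge0 => y _; rewrite lee_fin powR_ge0.
- by move=> j; case: ifP => // _; rewrite mulr_ge0 ?powR_ge0.
- move=> x; rewrite patchE; case: ifPn; rewrite ?ltxx// inE => Sx _.
  have [j Pj /andP[js sj]] := Ss _ Sx; exists j => //.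
  by rewrite Pj lee_fin powR_shell.
move=> n; apply: (@le_trans _ _
  (\sum_(0 <= j < n | P j) (2 `^ `|a| * C * s j `^ (D - a))%:E)).
  rewrite [leRHS]big_mkcond/=; apply: lee_sum => j _.
  case: ifPn => Pj; last by rewrite mul0e.
  apply: (@le_trans _ _ ((2 `^ `|a| * s j `^ (- a))%:E * (C * s j `^ D)%:E)).
    by rewrite lee_pmul// ?lee_fin ?mulr_ge0 ?powR_ge0// muC.
  rewrite -EFinM lee_fin powRD ?(gt_eqF (s0 j)) ?implybT//.
  by rewrite le_eqVlt; apply/orP; left; apply/eqP; ring.
rewrite sumEFin lee_fin -big_distrr/= ler_wpM2l// mulr_ge0// powR_ge0//.
Qed.

Lemma dyadic_index (x : R) : (1 <= x)%R ->
  exists j : nat, (2 ^+ j <= x < 2 ^+ j.+1)%R.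
Proof.
move=> x1.
have ex : exists n, (x < 2 ^+ n.+1)%R.
  exists (Num.truncn x); apply: lt_trans (Num.Theory.truncnS_gt x) _.
  by rewrite -natrX ltr_nat ltn_expl.
exists (ex_minn ex); case: ex_minnP => -[|n] xn minn; first by rewrite expr0 x1.
rewrite xn andbT leNgt; apply/negP => /minn.
by rewrite ltnn.
Qed.

Lemma sum_geometric_le (q : R) n : (0 <= q < 1)%R ->
  (\sum_(0 <= j < n) q ^+ j <= (1 - q)^-1)%R.
Proof.
move=> /andP[q0 q1]; rewrite -[leRHS]mul1r ler_pdivlMr ?subr_gt0//.
rewrite mulrC big_mkord -[X in (_ * X)%R]mulr1 -opprB mulNr.
rewrite (_ : (_ - 1) * _ = q ^+ n - 1)%R; last by rewrite subrX1 mulr1.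
by rewrite opprB gerBl exprn_ge0.
Qed.

(** The shells of outer radius r / 2^j contribute a geometric series of ratio 2^(-(D - a)) < 1. *)
Lemma integral_powR_inner (a : R) : (a < D)%R -> exists2 K : R, (0 <= K)%R &
  forall r : R, (0 < r)%R ->
  \int[mu]_(x in [set x | (0 < rho x <= r)%R]) (rho x `^ (- a))%:E
    <= (K * r `^ (D - a))%:E.
Proof.
move=> aD; pose q : R := (2 `^ (- (D - a)))%R.
have q01 : (0 <= q < 1)%R.
  rewrite powR_ge0/= -[ltRHS](powRr0 2%R) /q.
  by rewrite /powR !gt_eqF// ltr_expR ltr_pM2r ?ln_gt0 ?ltr1n// oppr_lt0 subr_gt0.
exists (2 `^ `|a| * C * (1 - q)^-1)%R.
  by rewrite !mulr_ge0 ?powR_ge0// invr_ge0 subr_ge0 ltW//; case/andP: q01.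
move=> r r0; rewrite -mulrA.
rewrite [X in (_ * X)%R]mulrC.
apply: (@integral_shells (fun j => r / 2 ^+ j)%R xpredT).
- rewrite -[X in measurable X]setTI.
  have := mrho measurableT (measurable_itv `]0%R, r]).
  by rewrite (_ : _ @^-1` _ = [set x | (0 < rho x <= r)%R])//.
- by move=> j; rewrite divr_gt0// exprn_gt0.
- move=> x /= /andP[rx0 rxr].
  have [j /andP[j1 j2]] : exists j : nat, (2 ^+ j <= r / rho x < 2 ^+ j.+1)%R.
    by apply: dyadic_index; rewrite ler_pdivlMr// mul1r.
  exists j => //; rewrite -mulrA -invfM -exprSr; apply/andP; split.
    by rewrite ler_pdivrMr ?exprn_gt0// mulrC -ler_pdivrMr// ltW.
  by rewrite ler_pdivlMr ?exprn_gt0// mulrC -ler_pdivlMr.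
- move=> n; apply: (@le_trans _ _ (\sum_(0 <= j < n) r `^ (D - a) * q ^+ j)%R).
    apply: ler_sum => j _; rewrite powRM ?invr_ge0 ?exprn_ge0 ?(ltW r0)//.
    rewrite le_eqVlt; apply/orP; left; apply/eqP; congr (_ * _)%R.
    rewrite -powR_invn// -powR_mulrn ?powR_ge0// /q -!powRrM; congr powR; ring.
  by rewrite -big_distrr/= ler_wpM2l ?powR_ge0// sum_geometric_le.
Qed.

Lemma integral_powR_outer (a : R) : (D < a)%R -> exists2 K : R, (0 <= K)%R &
  forall r : R, (0 < r)%R ->
  \int[mu]_(x in [set x | (r < rho x)%R]) (rho x `^ (- a))%:E
    <= (K * r `^ (D - a))%:E.
Proof.
move=> aD; pose q : R := (2 `^ (D - a))%R.
have q01 : (0 <= q < 1)%R.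
  rewrite powR_ge0/= -[ltRHS](powRr0 2%R) /q.
  by rewrite /powR !gt_eqF// ltr_expR ltr_pM2r ?ln_gt0 ?ltr1n// subr_lt0.
exists (2 `^ `|a| * C * (1 - q)^-1)%R.
  by rewrite !mulr_ge0 ?powR_ge0// invr_ge0 subr_ge0 ltW//; case/andP: q01.
move=> r r0; rewrite -mulrA.
rewrite [X in (_ * X)%R]mulrC.
apply: (@integral_shells (fun j => r * 2 ^+ j.+1)%R xpredT).
- rewrite -[X in measurable X]setTI.
  have := mrho measurableT (measurable_itv `]r, +oo[).
  by rewrite preimage_itvoy.
- by move=> j; rewrite mulr_gt0// exprn_gt0.
- move=> x /= rx.
  have [j /andP[j1 j2]] : exists j : nat, (2 ^+ j <= rho x / r < 2 ^+ j.+1)%R.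
    by apply: dyadic_index; rewrite ler_pdivlMr// mul1r ltW.
  exists j => //; rewrite exprSr mulrA mulfK//; apply/andP; split.
    by rewrite mulrC -ler_pdivlMr.
  by rewrite -mulrA -exprSr mulrC -ler_pdivrMr// ltW.
- move=> n; apply: (@le_trans _ _ (\sum_(0 <= j < n) r `^ (D - a) * q ^+ j)%R).
    apply: ler_sum => j _; rewrite powRM ?exprn_ge0 ?(ltW r0)//.
    rewrite ler_wpM2l ?powR_ge0// -powR_mulrn// powRAC powR_mulrn ?powR_ge0// -/q.
    (* The outer radii start at 2 r, so the series is that of q^(j+1), bounded termwise by q^j. *)
    by case/andP: q01 => q0 q1; rewrite exprS ler_piMl ?exprn_ge0// ltW.
  by rewrite -big_distrr/= ler_wpM2l ?powR_ge0// sum_geometric_le.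
Qed.

(** At the exponent D all shells contribute equally and the bound counts them: rho 2^k ranges over
    [1, 4^k], which meets 2 k + 1 dyadic intervals. *)
Lemma integral_powR_log (k : nat) :
  \int[mu]_(x in [set x | (2 ^- k <= rho x <= 2 ^+ k)%R]) (rho x `^ (- D))%:E
    <= (2 `^ `|D| * C * (k.*2.+1)%:R)%:E.
Proof.
apply: (@integral_shells (fun j => 2 ^+ j.+1 / 2 ^+ k)%R (fun j => (j < k.*2.+1)%N)).
- rewrite -[X in measurable X]setTI.
  have := mrho measurableT (measurable_itv `[(2 ^- k)%R, (2 ^+ k)%R]).
  by rewrite (_ : _ @^-1` _ = [set x | (2 ^- k <= rho x <= 2 ^+ k)%R]).
- by move=> j; rewrite divr_gt0// exprn_gt0.
- move=> x /= /andP[x1 x2].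
  have [j /andP[j1 j2]] : exists j : nat, (2 ^+ j <= rho x * 2 ^+ k < 2 ^+ j.+1)%R.
    by apply: dyadic_index; rewrite -ler_pdivrMr ?exprn_gt0// mul1r.
  exists j.
    rewrite ltnS -(@ler_eXn2l R 2) ?ltr1n//; apply: (le_trans j1).
    by rewrite -addnn exprD ler_wpM2r ?exprn_ge0.
  rewrite ler_pdivlMr ?exprn_gt0// (ltW j2) andbT.
  by rewrite mulrAC exprSr mulfK// ler_pdivrMr ?exprn_gt0.
- move=> n; rewrite subrr; under eq_bigr do rewrite powRr0.
  rewrite -(natr_sum _ _ _ (fun=> 1%N)) ler_nat; apply: leq_trans (geq_minr n _).
  elim: n => [|n IH]; first by rewrite big_geq.
  rewrite big_mkcond big_nat_recr//= -big_mkcond/=.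
  by move: IH; case: ltnP => nk; rewrite ?addn0; lia.
Qed.

End power_integrals.

(** * The Euclidean norm, volumes of balls and shells *)

Section euclidean_norm.
Context (R : realType) (d : nat).
Implicit Types x y : 'rV[R]_d.

Lemma enorm_ge0 x : 0 <= enorm x.
Proof. exact: sqrtr_ge0. Qed.

Lemma sqr_enorm x : enorm x ^+ 2 = \sum_i x ord0 i ^+ 2.
Proof. by rewrite sqr_sqrtr// sumr_ge0// => i _; exact: sqr_ge0. Qed.

Lemma enormZ (l : R) x : enorm (l *: x) = `|l| * enorm x.
Proof.
rewrite /enorm -sqrtr_sqr -sqrtrM ?sqr_ge0// mulr_sumr.
by congr Num.sqrt; apply: eq_bigr => i _; rewrite mxE exprMn.
Qed.

Lemma enormN x : enorm (- x) = enorm x.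
Proof. by rewrite -scaleN1r enormZ normrN1 mul1r. Qed.

Lemma enormB_sym x y : enorm (x - y) = enorm (y - x).
Proof. by rewrite -enormN opprB. Qed.

Lemma coor_le_enorm x i : `|x ord0 i| <= enorm x.
Proof.
rewrite -sqrtr_sqr /enorm ler_sqrt ?sumr_ge0// => [|j _]; last exact: sqr_ge0.
by rewrite (bigD1 i)//= lerDl sumr_ge0// => j _; exact: sqr_ge0.
Qed.

Lemma enorm_le_coor x (c : R) : 0 <= c -> (forall i, `|x ord0 i| <= c) ->
  enorm x <= Num.sqrt d%:R * c.
Proof.
move=> c0 xc; rewrite -[X in _ * X](ger0_norm c0) -sqrtr_sqr -sqrtrM// /enorm.
rewrite ler_sqrt ?mulr_ge0 ?sqr_ge0//.
apply: (@le_trans _ _ (\sum_(i < d) c ^+ 2)).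
  by apply: ler_sum => i _; rewrite -real_normK ?num_real// lerXn2r// nnegrE.
by rewrite sumr_const card_ord mulr_natl.
Qed.

Lemma enorm0 : enorm (0 : 'rV[R]_d) = 0.
Proof. by rewrite -(scale0r 0) enormZ normr0 mul0r. Qed.

Lemma enorm_eq0 x : (enorm x == 0) = (x == 0).
Proof.
apply/idP/idP => [/eqP x0|/eqP ->]; last by rewrite enorm0.
apply/eqP/rowP => i; rewrite mxE; apply/eqP; rewrite -normr_le0 -x0.
exact: coor_le_enorm.
Qed.

Lemma enorm_gt0 x : (0 < enorm x) = (x != 0).
Proof. by rewrite lt_neqAle enorm_ge0 andbT eq_sym enorm_eq0. Qed.

(** Young's inequality in each coordinate, with the weight |y| / |x| for which both sums equal |x|
    |y| / 2. *)
Lemma cauchy_schwarz_rV x y :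
  \sum_i x ord0 i * y ord0 i <= enorm x * enorm y.
Proof.
have [->|x0] := eqVneq x 0.
  by rewrite enorm0 mul0r big1// => i _; rewrite mxE mul0r.
have [->|y0] := eqVneq y 0.
  by rewrite enorm0 mulr0 big1// => i _; rewrite mxE mulr0.
have a0 : 0 < enorm x by rewrite enorm_gt0.
have b0 : 0 < enorm y by rewrite enorm_gt0.
apply: (@le_trans _ _ (\sum_i (x ord0 i ^+ 2 * (enorm y / (2 * enorm x)) +
   y ord0 i ^+ 2 * (enorm x / (2 * enorm y))))).
  apply: ler_sum => i _; set a := x _ i; set b := y _ i.
  rewrite -subr_ge0 (_ : _ - _ =
    (a * enorm y - b * enorm x) ^+ 2 / (2 * enorm x * enorm y)); last first.
    by field; rewrite !gt_eqF.
  by rewrite divr_ge0 ?sqr_ge0// !mulr_ge0// enorm_ge0.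
rewrite big_split/= -!mulr_suml -!sqr_enorm.
rewrite le_eqVlt; apply/orP; left; apply/eqP.
by field; rewrite !gt_eqF.
Qed.

Lemma enormD x y : enorm (x + y) <= enorm x + enorm y.
Proof.
rewrite -(@ler_pXn2r _ 2)// ?nnegrE ?addr_ge0 ?enorm_ge0//.
rewrite sqrrD !sqr_enorm.
have -> : \sum_i (x + y) ord0 i ^+ 2 = \sum_i x ord0 i ^+ 2 +
    (\sum_i x ord0 i * y ord0 i) *+ 2 + \sum_i y ord0 i ^+ 2.
  rewrite -sumrMnl -!big_split/=; apply: eq_bigr => i _.
  by rewrite mxE; ring.
by rewrite lerD2r lerD2l lerMn2r cauchy_schwarz_rV orbT.
Qed.

Lemma enormB x y : enorm (x - y) <= enorm x + enorm y.
Proof. by rewrite -[X in _ <= _ + X]enormN enormD. Qed.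

End euclidean_norm.

Section leb_balls.
Local Open Scope ereal_scope.
Context (R : realType).

Lemma measurable_cube d (p q : R) :
  measurable [set x : 'rV[R]_d | forall i, p <= x ord0 i <= q]%R.
Proof.
rewrite (_ : [set x | _] = \bigcap_(i in [set: 'I_d])
  ((fun x : 'rV[R]_d => x ord0 i) @^-1` `[p, q])).
  apply: fin_bigcap_measurable => // i _.
  by rewrite -[X in measurable X]setTI; exact: (@measurable_coor R d i).
apply/seteqP; split => [x xpq i _|x xpq i].
  by rewrite /= in_itv/=; exact: xpq.
by have := xpq i I; rewrite /= in_itv.
Qed.

Lemma leb_cube d (p q : R) : (p <= q)%R ->
  leb R d [set x : 'rV[R]_d | forall i, p <= x ord0 i <= q]%R = ((q - p) ^+ d)%:E.
Proof.
move=> pq; elim: d => [|d IHd].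
  rewrite expr0 /= diracE mem_set//=.
  by case.
rewrite /= /leb_step_fun /pushforward.
rewrite (_ : _ @^-1` _ = `[p, q]%classic `*`
    [set y : 'rV[R]_d | forall i, p <= y ord0 i <= q]%R).
  rewrite product_measure1E//; last exact: measurable_cube.
  rewrite IHd exprS EFinM; congr (_ * _).
  suff : lebesgue_measure `[p, q]%classic = (q - p)%:E by [].
  rewrite lebesgue_measure_itv/= lte_fin; case: ltP => // qp.
  by rewrite (@le_anti _ _ q p) ?subrr// qp pq.
have cE (t : R) (y : 'rV[R]_d) :
    (rV_cons (t, y) ord0 ord0 = t) * (forall i, rV_cons (t, y) ord0 (rshift 1 i) = y ord0 i).
  split; first by have [] := rV_consK (t, y).
  by move=> i; rewrite /rV_cons (@row_mxEr R 1 1 d).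
apply/seteqP; split => [[t y] /= H|[t y] [/= tpq H] i].
  split; first by have := H ord0; rewrite cE /= in_itv.
  by move=> i; have := H (rshift 1 i); rewrite cE.
rewrite -[i](@splitK 1 d); case: (@fintype.split 1 d i) => j /=.
  have -> : lshift d j = ord0 by apply/val_inj; rewrite /= ord1.
  by rewrite cE; rewrite in_itv in tpq.
by rewrite cE; exact: H.
Qed.

Lemma measurable_enorm_le d (s : R) : measurable [set x : 'rV[R]_d | enorm x <= s]%R.
Proof.
rewrite -[X in measurable X]setTI.
have := @measurable_enorm R d measurableT _ (measurable_itv `]-oo, s]).
by rewrite preimage_itvNyc.
Qed.

Lemma leb_ball_le d (s : R) : (0 <= s)%R ->
  leb R d [set x | enorm x <= s]%R <= ((2 * s) ^+ d)%:E.
Proof.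
move=> s0.
have -> : (2 * s = s - - s)%R by rewrite opprK mulr_natl mulr2n.
rewrite -leb_cube ?ge0_cp//.
apply: le_measure; rewrite ?inE; [exact: measurable_enorm_le|exact: measurable_cube|].
by move=> x /= xs i; rewrite -ler_norml (le_trans (coor_le_enorm x i)).
Qed.

Lemma leb_ball_le_powR d (s : R) : (0 < s)%R ->
  leb R d [set x | enorm x <= s]%R <= (2 ^+ d * s `^ d%:R)%:E.
Proof. by move=> s0; rewrite powR_mulrn ?(ltW s0)// -exprMn leb_ball_le// ltW. Qed.

Lemma measurable_rV_set1 d (a : 'rV[R]_d) : measurable [set a].
Proof.
rewrite (_ : [set a] = \bigcap_(i in [set: 'I_d])
  ((fun x : 'rV[R]_d => x ord0 i) @^-1` [set a ord0 i])).
  apply: fin_bigcap_measurable => // i _.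
  by rewrite -[X in measurable X]setTI; exact: (@measurable_coor R d i).
by apply/seteqP; split => [_ -> //|x xa]; apply/rowP => i; have /= := xa i I.
Qed.

Lemma leb_origin d : (0 < d)%N -> leb R d [set 0%R] = 0.
Proof.
move=> d0; apply/eqP; rewrite eq_le measure_ge0 andbT.
have := @leb_ball_le d 0 (lexx _); rewrite mulr0 expr0n gtn_eqF//; apply: le_trans.
apply: le_measure; rewrite ?inE; [exact: measurable_rV_set1|exact: measurable_enorm_le|].
by move=> _ -> /=; rewrite enorm0.
Qed.

(** The shell contains the cube of points with all coordinates in [s, 2 s] for s = r / sqrt d. *)
Lemma leb_annulus_ge d (r : R) : (0 < d)%N -> (0 <= r)%R ->
  ((r / Num.sqrt d%:R) ^+ d)%:E <=
  leb R d [set y : 'rV[R]_d | r <= enorm y <= 2 * r]%R.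
Proof.
move=> d0 r0.
set s := (r / _)%R; have sd0 : (0 < Num.sqrt (d%:R : R))%R by rewrite sqrtr_gt0 ltr0n.
have s0 : (0 <= s)%R by rewrite divr_ge0// ltW.
have -> : s = (2 * s - s)%R by rewrite mulr_natl mulr2n addrK.
rewrite -leb_cube; last by rewrite ler_peMl// ler1n.
apply: le_measure; rewrite ?inE; first exact: measurable_cube.
  rewrite -[X in measurable X]setTI.
  have := @measurable_enorm R d measurableT _ (measurable_itv `[r, (2 * r)%R]).
  by rewrite (_ : _ @^-1` _ = [set y | r <= enorm y <= 2 * r]%R).
move=> x /= xs; apply/andP; split; last first.
  have -> : (2 * r = Num.sqrt d%:R * (2 * s))%R.
    by rewrite /s mulrCA [(_ * (r / _))%R]mulrC divfK// gt_eqF.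
  apply: enorm_le_coor; first by rewrite mulr_ge0.
  move=> i; have /andP[x1 x2] := xs i; rewrite ger0_norm//.
  exact: le_trans x1.
have -> : r = Num.sqrt (\sum_(i < d) s ^+ 2).
  rewrite sumr_const card_ord -[X in Num.sqrt X]mulr_natl sqrtrM// sqrtr_sqr ger0_norm//.
  by rewrite /s mulrC divfK// gt_eqF.
rewrite /enorm ler_sqrt ?sumr_ge0// => [|i _]; last exact: sqr_ge0.
apply: ler_sum => i _; have /andP[x1 _] := xs i.
by rewrite lerXn2r// nnegrE// (le_trans s0).
Qed.

End leb_balls.

(** * The Hardy inequality *)

Section real_integrals.
Context (disp : measure_display) (T : measurableType disp) (R : realType).
Variable mu : {measure set T -> \bar R}.
Implicit Types f g : T -> R.

Lemma ge0_le_integral_EFin f g :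
  measurable_fun setT f -> measurable_fun setT g ->
  (forall x, 0 <= f x) -> (forall x, f x <= g x) ->
  (\int[mu]_x (f x)%:E <= \int[mu]_x (g x)%:E)%E.
Proof.
move=> mf mg f0 fg; apply: ge0_le_integral => //.
- by move=> x _; rewrite lee_fin.
- exact/measurable_EFinP.
- exact/measurable_EFinP.
- by move=> x _; rewrite lee_fin.
Qed.

Lemma ge0_integralD_EFin f g :
  measurable_fun setT f -> measurable_fun setT g ->
  (forall x, 0 <= f x) -> (forall x, 0 <= g x) ->
  (\int[mu]_x (f x + g x)%:E = \int[mu]_x (f x)%:E + \int[mu]_x (g x)%:E)%E.
Proof.
move=> mf mg f0 g0; under eq_integral do rewrite EFinD.
rewrite ge0_integralD//.
- by move=> x _; rewrite lee_fin.
- exact/measurable_EFinP.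
- by move=> x _; rewrite lee_fin.
- exact/measurable_EFinP.
Qed.

Lemma ge0_integralM_EFin (k : R) f : 0 <= k ->
  measurable_fun setT f -> (forall x, 0 <= f x) ->
  (\int[mu]_x (k * f x)%:E = k%:E * \int[mu]_x (f x)%:E)%E.
Proof.
move=> k0 mf f0; under eq_integral do rewrite EFinM.
rewrite ge0_integralZl_EFin//; first by move=> x _; rewrite lee_fin.
exact/measurable_EFinP.
Qed.

Lemma measurable_set_ler f g : measurable_fun setT f -> measurable_fun setT g ->
  measurable [set x | f x <= g x].
Proof.
move=> mf mg; have := measurable_fun_ler mf mg measurableT (Y := [set true]) I.
rewrite setTI (_ : _ @^-1` _ = [set x | f x <= g x])//.
Qed.

End real_integrals.

Section jump_kernel.
Context (R : realType) (d : nat).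

Lemma measurable_subrV : measurable_fun setT
  (fun p : 'rV[R]_d * 'rV[R]_d => p.1 - p.2).
Proof.
apply: measurable_fun_rVP => i; under eq_fun do rewrite !mxE.
apply: measurable_funB.
  by apply: (measurableT_comp (measurable_coor i)); exact: measurable_fst.
by apply: (measurableT_comp (measurable_coor i)); exact: measurable_snd.
Qed.

Lemma measurable_enorm_powR (a : R) :
  measurable_fun setT (fun x : 'rV[R]_d => enorm x `^ a).
Proof.
by apply: (measurableT_comp (@measurable_powR R _)); exact: measurable_enorm.
Qed.

(** Defined on all pairs: the numerator vanishes on the diagonal, so that the energy becomes an
    integral over the whole product. *)
Definition jump_density (alpha delta : R) (u : 'rV[R]_d -> R)
    (p : 'rV[R]_d * 'rV[R]_d) : R :=
  (u p.1 - u p.2) ^+ 2 /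
  (enorm (p.1 - p.2) `^ (d%:R + alpha) * enorm p.1 `^ delta * enorm p.2 `^ delta).

Definition jump_energy (alpha delta : R) (u : 'rV[R]_d -> R) : \bar R :=
  (\int[leb R d \x leb R d]_p (jump_density alpha delta u p)%:E)%E.

Lemma jump_density_ge0 alpha delta u p : 0 <= jump_density alpha delta u p.
Proof. by rewrite divr_ge0 ?sqr_ge0// !mulr_ge0 ?powR_ge0. Qed.

Lemma measurable_fst_rV (f : 'rV[R]_d -> R) : measurable_fun setT f ->
  measurable_fun setT (fun p : 'rV[R]_d * 'rV[R]_d => f p.1).
Proof. by move=> mf; apply: (measurableT_comp mf); exact: measurable_fst. Qed.

Lemma measurable_snd_rV (f : 'rV[R]_d -> R) : measurable_fun setT f ->
  measurable_fun setT (fun p : 'rV[R]_d * 'rV[R]_d => f p.2).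
Proof. by move=> mf; apply: (measurableT_comp mf); exact: measurable_snd. Qed.

Lemma measurable_sqr_diff (u : 'rV[R]_d -> R) : measurable_fun setT u ->
  measurable_fun setT (fun p : 'rV[R]_d * 'rV[R]_d => (u p.1 - u p.2) ^+ 2).
Proof.
move=> mu; apply: measurable_funX; apply: measurable_funB.
  exact: measurable_fst_rV.
exact: measurable_snd_rV.
Qed.

Lemma measurable_jump_density alpha delta u : measurable_fun setT u ->
  measurable_fun setT (jump_density alpha delta u).
Proof.
move=> mu; rewrite (_ : jump_density _ _ _ = fun p =>
  (u p.1 - u p.2) ^+ 2 * (enorm (p.1 - p.2) `^ (- (d%:R + alpha)) *
  (enorm p.1 `^ (- delta) * enorm p.2 `^ (- delta)))); last first.
  apply/funext => p; rewrite /jump_density !powRN -!invfM.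
  by rewrite mulrA.
apply: measurable_funM; first exact: measurable_sqr_diff.
apply: measurable_funM.
  exact: (measurableT_comp (measurable_enorm_powR _) measurable_subrV).
apply: measurable_funM.
  exact: (measurable_fst_rV (measurable_enorm_powR _)).
exact: (measurable_snd_rV (measurable_enorm_powR _)).
Qed.

Lemma pre_form_energyE alpha delta u : energy (pre_form d alpha delta) u =
  ((2^-1 * stable_const d alpha)%:E * jump_energy alpha delta u)%E.
Proof.
rewrite /=; congr (_ * _)%E; rewrite integral_mkcond /jump_energy.
apply: eq_integral => -[x y] _; rewrite patchE.
case: ifPn => //; rewrite notin_setE /= /diagonal /= => /contrapT xy.
by rewrite /jump_density/= (xy : x = y) subrr expr0n/= mul0r.
Qed.

End jump_kernel.

Section hardy.
Context (R : realType) (d : nat) (alpha delta : R).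
Hypotheses (d0 : (0 < d)%N) (alpha0 : 0 < alpha) (delta0 : 0 <= delta).
Let s := 2 * delta + alpha.
Hypothesis sd : s != d%:R.
Implicit Types u : 'rV[R]_d -> R.

Let mu := leb R d.

Let s0 : 0 < s. Proof. by rewrite /s ltr_wpDl// mulr_ge0. Qed.

(** Comparable points, the first having the smaller norm. If (x, y) is in [D], then so is (y, 2
    x). *)
Let D : set ('rV[R]_d * 'rV[R]_d) :=
  [set p | enorm p.1 <= enorm p.2] `&` [set p | enorm p.2 <= 2 * enorm p.1].

Let mD : measurable D.
Proof.
have m1 := measurable_fst_rV (@measurable_enorm R d).
have m2 := measurable_snd_rV (@measurable_enorm R d).
apply: measurableI; first by apply: (measurable_set_ler m1 m2).
apply: (measurable_set_ler m2); exact: measurable_funM.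
Qed.

Let local_density u (p : 'rV[R]_d * 'rV[R]_d) : R :=
  \1_D p * ((u p.1 - u p.2) ^+ 2 * enorm p.1 `^ (- (s + d%:R))).

Let local_density_ge0 u p : 0 <= local_density u p.
Proof.
rewrite /local_density indicE; apply: mulr_ge0; first exact: ler0n.
by rewrite mulr_ge0 ?sqr_ge0 ?powR_ge0.
Qed.

Let measurable_local_density u : measurable_fun setT u ->
  measurable_fun setT (local_density u).
Proof.
move=> mu0; apply: measurable_funM; first exact: measurable_indic.
apply: measurable_funM; first exact: measurable_sqr_diff.
exact: (measurable_fst_rV (measurable_enorm_powR _)).
Qed.

(** On [D], |x - y| <= 3 |x| and |y| <= 2 |x|, so the three factors of the denominator are
    controlled by powers of |x|. *)
Let local_density_le u p :
  local_density u p <= 3 `^ (d%:R + alpha) * 2 `^ delta * jump_density alpha delta u p.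
Proof.
case: p => x y; rewrite /local_density indicE; case: (boolP (_ \in D)); last first.
  move=> _; rewrite mul0r; apply: mulr_ge0; last exact: jump_density_ge0.
  by apply: mulr_ge0; exact: powR_ge0.
rewrite inE mul1r => -[/= xy yx].
have [->|xny] := eqVneq x y.
  by rewrite /jump_density/= subrr expr0n/= !mul0r mulr0.
have x0 : 0 < enorm x.
  rewrite lt_neqAle enorm_ge0 andbT eq_sym; apply/eqP => x0.
  have y0 : enorm y == 0 by rewrite eq_le enorm_ge0 andbT -(mulr0 2) -x0.
  move/eqP: x0 => /eqP/eqP; rewrite enorm_eq0 => /eqP x0.
  by move: y0 xny; rewrite enorm_eq0 x0 => /eqP ->; rewrite eqxx.
have y0 : 0 < enorm y by exact: lt_le_trans xy.
have xy0 : 0 < enorm (x - y) by rewrite enorm_gt0 subr_eq0.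
rewrite /jump_density/= mulrCA ler_wpM2l ?sqr_ge0// powRN.
rewrite -[X in X <= _]mul1r ler_pdivrMr ?powR_gt0// mulrAC ler_pdivlMr ?mulr_gt0 ?powR_gt0//.
rewrite mul1r.
have -> : enorm x `^ (s + d%:R) =
    enorm x `^ (d%:R + alpha) * enorm x `^ delta * enorm x `^ delta.
  rewrite -!powRD ?(gt_eqF x0) ?implybT//; congr powR; rewrite /s; ring.
rewrite [leRHS](_ : _ = (3 * enorm x) `^ (d%:R + alpha) * enorm x `^ delta *
    (2 * enorm x) `^ delta); last first.
  by rewrite !powRM ?(ltW x0)//; ring.
have le_pw (a b r : R) : 0 <= r -> 0 <= a -> a <= b -> a `^ r <= b `^ r.
  by move=> r0 a0 ab; rewrite ge0_ler_powR// ?nnegrE// (le_trans a0).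
rewrite ler_pM ?mulr_ge0 ?powR_ge0//; last by rewrite le_pw// enorm_ge0.
rewrite ler_wpM2r ?powR_ge0// le_pw ?enorm_ge0//.
  by rewrite addr_ge0// ltW.
apply: (le_trans (enormB _ _)); rewrite (_ : 3 * _ = enorm x + 2 * enorm x) ?lerD2l//.
ring.
Qed.

Lemma weighted_doubling u : measurable_fun setT u ->
  ((2 `^ (s - d%:R))%:E * \int[mu]_x (u x ^+ 2 * enorm x `^ (- s))%:E =
  \int[mu]_x (u (2 *: x) ^+ 2 * enorm x `^ (- s))%:E)%E.
Proof.
move=> mu0.
have mf a : measurable_fun setT (fun x => u x ^+ 2 * enorm x `^ a).
  by apply: measurable_funM; [exact: measurable_funX|exact: measurable_enorm_powR].
rewrite (@integral_leb_affine R d 2 0)//; last 2 first.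
- exact/measurable_EFinP.
- by move=> x; rewrite lee_fin mulr_ge0 ?sqr_ge0 ?powR_ge0.
under eq_integral do rewrite addr0 enormZ ger0_norm// powRM ?enorm_ge0// mulrCA.
rewrite ge0_integralM_EFin ?powR_ge0//.
- rewrite !muleA -!EFinM -powR_mulrn// -!powRD ?pnatr_eq0 ?implybT//.
  by rewrite (_ : _ + _ = 0) ?powRr0 ?mul1e//; ring.
- apply: measurable_funM; last exact: measurable_enorm_powR.
  apply: measurable_funX; apply: (measurableT_comp mu0).
  by have := @measurable_rV_affine R d 2 0; under eq_fun do rewrite addr0.
- by move=> x; rewrite mulr_ge0 ?sqr_ge0 ?powR_ge0.
Qed.

Let dilated_density u (p : 'rV[R]_d * 'rV[R]_d) : R :=
  \1_D p * ((u p.2 - u (2 *: p.1)) ^+ 2 * enorm p.1 `^ (- (s + d%:R))).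

Let dilated_density_ge0 u p : 0 <= dilated_density u p.
Proof.
rewrite /dilated_density indicE; apply: mulr_ge0; first exact: ler0n.
by rewrite mulr_ge0 ?sqr_ge0 ?powR_ge0.
Qed.

Let measurable_dilate u : measurable_fun setT u ->
  measurable_fun setT (fun x : 'rV[R]_d => u (2 *: x)).
Proof.
move=> mu0; apply: (measurableT_comp mu0).
by have := @measurable_rV_affine R d 2 0; under eq_fun do rewrite addr0.
Qed.

Let measurable_dilated_density u : measurable_fun setT u ->
  measurable_fun setT (dilated_density u).
Proof.
move=> mu0; apply: measurable_funM; first exact: measurable_indic.
apply: measurable_funM; last exact: (measurable_fst_rV (measurable_enorm_powR _)).
apply: measurable_funX; apply: measurable_funB; first exact: measurable_snd_rV.
exact: (measurable_fst_rV (measurable_dilate mu0)).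
Qed.

(** For fixed y, put z = 2 x: membership of (x, y) in [D] becomes that of (y, z), the Jacobian is
    2^(-d), and |x|^(-(s + d)) becomes 2^(s + d) |z|^(-(s + d)), where |z| may be replaced by the
    smaller |y|. Hence the factor 2^s. *)
Let integral_dilated_density_le u : measurable_fun setT u ->
  (\int[mu \x mu]_p (dilated_density u p)%:E <=
  (2 `^ s)%:E * \int[mu \x mu]_p (local_density u p)%:E)%E.
Proof.
move=> mu0.
rewrite fubini_tonelli2; last 2 first.
- by apply/measurable_EFinP; exact: measurable_dilated_density.
- by move=> p; rewrite lee_fin.
have mG1 : measurable_fun setT (EFin \o local_density u).
  by apply/measurable_EFinP; exact: measurable_local_density.
rewrite fubini_tonelli1//; last by move=> p; rewrite lee_fin.
rewrite -ge0_integralZl_EFin ?powR_ge0//; last 2 first.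
- by move=> x _; apply: integral_ge0 => y _; rewrite lee_fin.
- by apply: measurable_fun_fubini_tonelli_F => // p; rewrite lee_fin.
apply: ge0_le_integral => //.
- by move=> x _; apply: integral_ge0 => y _; rewrite lee_fin.
- apply: measurable_fun_fubini_tonelli_G => [|p]; last by rewrite lee_fin.
  by apply/measurable_EFinP; exact: measurable_dilated_density.
- apply: emeasurable_funM => //.
  by apply: measurable_fun_fubini_tonelli_F => // p; rewrite lee_fin.
move=> y _; rewrite /fubini_F /fubini_G.
pose H z : R := \1_D (y, z) * ((u y - u z) ^+ 2 * enorm z `^ (- (s + d%:R))).
have H0 z : 0 <= H z.
  rewrite /H indicE; apply: mulr_ge0; first exact: ler0n.
  by rewrite mulr_ge0 ?sqr_ge0 ?powR_ge0.
have mH : measurable_fun setT H.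
  apply: measurable_funM.
    exact: (measurableT_comp (measurable_indic mD) (@pair1_measurable _ _ _ _ y)).
  apply: measurable_funM; last exact: measurable_enorm_powR.
  by apply: measurable_funX; apply: measurable_funB.
have mH2 : measurable_fun setT (fun x : 'rV[R]_d => H (2 *: x)) by exact: measurable_dilate.
have HE x : dilated_density u (x, y) = 2 `^ (s + d%:R) * H (2 *: x).
  rewrite /dilated_density /H/= [RHS]mulrCA; congr (_ * _).
    rewrite !indicE; congr (_%:R); congr nat_of_bool.
    apply/idP/idP; rewrite !inE /D/= enormZ ger0_norm// => -[h1 h2]; split => //.
      by rewrite ler_pM2l.
    by move: h2; rewrite ler_pM2l.
  rewrite [RHS]mulrCA enormZ ger0_norm// powRM ?enorm_ge0// [2 `^ _ * (_ * _)]mulrA [2 `^ (- _)]powRN.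
  by rewrite divff ?mul1r// gt_eqF// powR_gt0.
have HG z : H z <= local_density u (y, z).
  rewrite /H /local_density/= indicE.
  case: (boolP (_ \in D)); last by rewrite !mul0r.
  rewrite inE !mul1r => -[/= yz zy].
  have [y0|y0] := eqVneq y 0.
    have : z == 0 by rewrite -enorm_eq0 eq_le enorm_ge0 (le_trans zy)// y0 enorm0 mulr0.
    by move=> /eqP ->; rewrite y0 subrr expr0n/= !mul0r.
  have y1 : 0 < enorm y by rewrite enorm_gt0.
  rewrite ler_wpM2l ?sqr_ge0// !powRN lef_pV2 ?posrE ?powR_gt0//.
    by rewrite ge0_ler_powR// ?nnegrE ?enorm_ge0// addr_ge0// ltW.
  exact: lt_le_trans yz.
clearbody H; have H20 (x : 'rV[R]_d) : 0 <= H (2 *: x) by exact: H0.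
have -> : (\int[mu]_x (dilated_density u (x, y))%:E =
    (2 `^ (s + d%:R))%:E * \int[mu]_x (H (2 *: x))%:E)%E.
  rewrite -(ge0_integralM_EFin mu (powR_ge0 _ _) mH2 H20).
  by apply: eq_integral => x _; rewrite HE.
have HI : (\int[mu]_z (H z)%:E = (2 ^+ d)%:E * \int[mu]_x (H (2 *: x))%:E)%E.
  have mEH : measurable_fun setT (EFin \o H) by exact/measurable_EFinP.
  have EH0 x : (0 <= (EFin \o H) x)%E by rewrite lee_fin.
  rewrite [LHS](@integral_leb_affine R d 2 0 (EFin \o H) (ltr0n _ 2) mEH EH0).
  by congr (_ * _)%E; apply: eq_integral => x _ /=; rewrite addr0.
rewrite powRD ?pnatr_eq0 ?implybT// powR_mulrn// EFinM -muleA -HI.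
rewrite lee_pmul ?lee_fin ?powR_ge0//; first by apply: integral_ge0 => z _; rewrite lee_fin.
apply: ge0_le_integral_EFin => //.
exact: (measurableT_comp (measurable_local_density mu0) (@pair1_measurable _ _ _ _ y)).
Qed.

(** The shell |x| <= |y| <= 2 |x| has volume at least c0 |x|^d. *)
Let c0 : R := (Num.sqrt d%:R ^+ d)^-1.
Let C1 : R := 3 `^ (d%:R + alpha) * 2 `^ delta.
Let C2 : R := c0^-1 * (2 * C1 + 2 * (2 `^ s * C1)).

Let integral_local_density_le u : measurable_fun setT u ->
  (\int[mu \x mu]_p (local_density u p)%:E <= C1%:E * jump_energy alpha delta u)%E.
Proof.
move=> mu0; rewrite /jump_energy -ge0_integralM_EFin ?mulr_ge0 ?powR_ge0//.
- apply: ge0_le_integral_EFin => //; first exact: measurable_local_density.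
  by apply: measurable_funM => //; exact: measurable_jump_density.
- exact: measurable_jump_density.
- by move=> p; exact: jump_density_ge0.
Qed.

(** The increment is split at y, and the square of the sum bounded by twice the sum of squares, for
    all y with (x, y) in [D]. Since u(x) - u(2 x) is constant in y, integrating over y multiplies it
    by the volume of the shell, which turns |x|^(-(s + d)) into |x|^(-s). *)
Lemma integral_dilation_difference_le u : measurable_fun setT u ->
  (\int[mu]_x ((u x - u (2 *: x)) ^+ 2 * enorm x `^ (- s))%:E <=
  C2%:E * jump_energy alpha delta u)%E.
Proof.
move=> mu0.
pose G p : R := \1_D p * ((u p.1 - u (2 *: p.1)) ^+ 2 * enorm p.1 `^ (- (s + d%:R))).
have G0 p : 0 <= G p.
  rewrite /G indicE; apply: mulr_ge0; first exact: ler0n.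
  by rewrite mulr_ge0 ?sqr_ge0 ?powR_ge0.
have mw a : measurable_fun setT (fun x : 'rV[R]_d => (u x - u (2 *: x)) ^+ 2 * enorm x `^ a).
  apply: measurable_funM; last exact: measurable_enorm_powR.
  by apply: measurable_funX; apply: measurable_funB => //; exact: measurable_dilate.
have mG : measurable_fun setT G.
  apply: measurable_funM; first exact: measurable_indic.
  exact: (measurable_fst_rV (mw _)).
have c00 : 0 < c0 by rewrite invr_gt0 exprn_gt0// sqrtr_gt0 ltr0n.
have lower : (c0%:E * \int[mu]_x ((u x - u (2 *: x)) ^+ 2 * enorm x `^ (- s))%:E <=
    \int[mu \x mu]_p (G p)%:E)%E.
  rewrite fubini_tonelli1; last 2 first.
  - exact/measurable_EFinP.
  - by move=> p; rewrite lee_fin.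
  have w0 x : 0 <= (u x - u (2 *: x)) ^+ 2 * enorm x `^ (- s).
    by rewrite mulr_ge0 ?sqr_ge0 ?powR_ge0.
  rewrite -ge0_integralM_EFin ?(ltW c00)//.
  apply: ge0_le_integral => //.
  - by move=> x _; rewrite lee_fin mulr_ge0 ?(ltW c00).
  - by apply/measurable_EFinP; exact: measurable_funM.
  - apply: measurable_fun_fubini_tonelli_F => [|p]; last by rewrite lee_fin.
    exact/measurable_EFinP.
  move=> x _; rewrite /fubini_F.
  pose S := [set y | D (x, y)].
  have mS : measurable S by rewrite -[S]setTI; exact: pair1_measurable.
  set W := (u x - _) ^+ 2.
  have -> : (\int[mu]_y (G (x, y))%:E =
      (W * enorm x `^ (- (s + d%:R)))%:E * mu S)%E.
    have GE y : G (x, y) = W * enorm x `^ (- (s + d%:R)) * \1_S y.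
      rewrite /G/= mulrC; congr (_ * _); rewrite !indicE.
    rewrite (eq_integral (fun y => (W * enorm x `^ (- (s + d%:R)) * \1_S y)%:E)); last first.
      by move=> y _; rewrite GE.
    rewrite (ge0_integralM_EFin mu _ (measurable_indic mS)).
    - by rewrite integral_indic// setIT.
    - by rewrite mulr_ge0 ?sqr_ge0 ?powR_ge0.
    - by move=> y; rewrite indicE.
  have -> : S = [set y | enorm x <= enorm y <= 2 * enorm x].
    by apply/seteqP; split => y /=; [move=> [/= -> ->]|move=> /andP[]].
  apply: le_trans (lee_pmul _ _ (lexx _) (leb_annulus_ge d0 (enorm_ge0 x))); last 2 first.
  - by rewrite lee_fin mulr_ge0 ?sqr_ge0 ?powR_ge0.
  - by rewrite lee_fin exprn_ge0// divr_ge0// ?enorm_ge0 ?sqrtr_ge0.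
  rewrite -EFinM lee_fin.
  have [->|x0] := eqVneq x 0.
    rewrite enorm0 powR0 ?oppr_eq0 ?gt_eqF// !mulr0 mul0r expr0n gtn_eqF// mulr0//.
  have x1 : enorm x != 0 by rewrite enorm_eq0.
  have -> : enorm x `^ (- s) = enorm x `^ (- (s + d%:R)) * enorm x ^+ d.
    rewrite -[enorm x ^+ d]powR_mulrn ?enorm_ge0// -powRD ?x1 ?implybT//.
    by congr powR; ring.
  by rewrite le_eqVlt expr_div_n -/c0 /c0; apply/orP; left; apply/eqP; ring.
pose J := jump_energy alpha delta u.
have J0 : (0 <= J)%E by apply: integral_ge0 => p _; rewrite lee_fin jump_density_ge0.
have C10 : 0 <= C1 by rewrite mulr_ge0 ?powR_ge0.
have A := integral_local_density_le mu0.
have B : (\int[mu \x mu]_p (dilated_density u p)%:E <= (2 `^ s * C1)%:E * J)%E.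
  apply: (le_trans (integral_dilated_density_le mu0)).
  by rewrite EFinM -muleA lee_wpmul2l// lee_fin powR_ge0.
have upper : (\int[mu \x mu]_p (G p)%:E <= (2 * C1 + 2 * (2 `^ s * C1))%:E * J)%E.
  apply: (@le_trans _ _ (\int[mu \x mu]_p
      (2 * local_density u p + 2 * dilated_density u p)%:E)%E).
    apply: ge0_le_integral_EFin => //.
      apply: measurable_funD; apply: measurable_funM => //.
        exact: measurable_local_density.
      exact: measurable_dilated_density.
    move=> p; rewrite /G /local_density /dilated_density.
    set i := \1_D p; set P := _ `^ _; set a := u p.1; set b := u p.2.
    set c := u (2 *: p.1).
    have -> : 2 * (i * ((a - b) ^+ 2 * P)) + 2 * (i * ((b - c) ^+ 2 * P)) =
        i * ((2 * (a - b) ^+ 2 + 2 * (b - c) ^+ 2) * P) by ring.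
    have i0 : 0 <= i by rewrite /i indicE; exact: ler0n.
    rewrite (ler_wpM2l i0)//.
    rewrite ler_wpM2r ?powR_ge0// -subr_ge0.
    rewrite (_ : _ - _ = (a - b - (b - c)) ^+ 2) ?sqr_ge0//; ring.
  rewrite ge0_integralD_EFin//; last 4 first.
  - by apply: measurable_funM => //; exact: measurable_local_density.
  - by apply: measurable_funM => //; exact: measurable_dilated_density.
  - by move=> p; rewrite mulr_ge0.
  - by move=> p; rewrite mulr_ge0.
  rewrite !ge0_integralM_EFin//; last 2 first.
  - exact: measurable_dilated_density.
  - exact: measurable_local_density.
  rewrite [X in (_ <= X * _)%E]EFinD ge0_muleDl ?lee_fin ?mulr_ge0 ?powR_ge0//.
  apply: leeD; rewrite [in leRHS]EFinM -[leRHS]muleA lee_wpmul2l//.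
set X := (\int[mu]_x _)%E in lower *.
have -> : X = (c0^-1%:E * (c0%:E * X))%E.
  by rewrite muleA -EFinM mulVf ?mul1e// gt_eqF.
rewrite /C2 EFinM -[leRHS]muleA lee_wpmul2l ?lee_fin ?invr_ge0 ?(ltW c00)//.
exact: le_trans lower upper.
Qed.

Let C2_ge0 : 0 <= C2.
Proof.
have C10 : 0 <= C1 by rewrite mulr_ge0 ?powR_ge0.
rewrite /C2 mulr_ge0 ?addr_ge0 ?mulr_ge0 ?powR_ge0//.
by rewrite invr_ge0 /c0 invr_ge0 exprn_ge0// sqrtr_ge0.
Qed.

(** Young's inequality with a free weight, so that the coefficient of a^2 can be brought as close to
    1 as the dilation factor demands. *)
Lemma sqr_le_sqr_diff (t a b : R) : 0 < t ->
  b ^+ 2 <= (1 + t) * a ^+ 2 + (1 + t^-1) * (a - b) ^+ 2.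
Proof.
move=> t0; rewrite -subr_ge0 (_ : _ - _ = (t * a + (a - b)) ^+ 2 / t); last first.
  by field; rewrite gt_eqF.
by rewrite divr_ge0 ?sqr_ge0// ltW.
Qed.

(* Since dilation by 2 multiplies the weighted L2 norm by a factor different
   from 1, a function is controlled by its difference with its dilate. *)
Theorem hardy_inequality : exists2 C : R, 0 < C &
  forall u, measurable_fun setT u ->
    (\int[mu]_x (u x ^+ 2 * enorm x `^ (- s))%:E < +oo)%E ->
    (\int[mu]_x (u x ^+ 2 * enorm x `^ (- s))%:E <= C%:E * jump_energy alpha delta u)%E.
Proof.
pose k : R := 2 `^ (s - d%:R).
have k0 : 0 < k by rewrite powR_gt0.
have k1 : k != 1.
  rewrite /k powR_eq1 negb_or pnatr_eq1/= negb_or subr_eq0 sd andbT.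
  by rewrite -leNgt.
(* Write Iw and Iv for the Hardy integrals of u and of its dilate, so that Iv = k Iw. If k > 1,
   bounding Iv by (1 + t) Iw leaves the coefficient k - 1 - t on Iw; if k < 1, bounding Iw by (1 +
   t) Iv leaves 1 - k - t k. Both are at least t for this choice. *)
pose t : R := `|k - 1| / 2.
have t0 : 0 < t by rewrite divr_gt0// normr_gt0 subr_eq0.
pose K : R := (1 + t^-1) / t * C2.
have K0 : 0 <= K.
  by rewrite /K mulr_ge0// divr_ge0 ?addr_ge0 ?invr_ge0// ltW.
(* K is only known to be nonnegative, and the constant multiplies an energy that may be +oo. *)
exists (K + 1) => [|u mu0 fin]; first by rewrite ltr_wpDl.
set w := fun x => u x ^+ 2 * enorm x `^ (- s).
set v := fun x => u (2 *: x) ^+ 2 * enorm x `^ (- s).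
set z := fun x => (u x - u (2 *: x)) ^+ 2 * enorm x `^ (- s).
have mw : measurable_fun setT w.
  by apply: measurable_funM; [exact: measurable_funX|exact: measurable_enorm_powR].
have mv : measurable_fun setT v.
  apply: measurable_funM; last exact: measurable_enorm_powR.
  by apply: measurable_funX; exact: measurable_dilate.
have mz : measurable_fun setT z.
  apply: measurable_funM; last exact: measurable_enorm_powR.
  by apply: measurable_funX; apply: measurable_funB => //; exact: measurable_dilate.
have w0 x : 0 <= w x by rewrite mulr_ge0 ?sqr_ge0 ?powR_ge0.
have v0 x : 0 <= v x by rewrite mulr_ge0 ?sqr_ge0 ?powR_ge0.
have z0 x : 0 <= z x by rewrite mulr_ge0 ?sqr_ge0 ?powR_ge0.
have Iv := weighted_doubling mu0.
have Iz := integral_dilation_difference_le mu0.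
pose J := jump_energy alpha delta u.
have J0 : (0 <= J)%E by apply: integral_ge0 => p _; rewrite lee_fin jump_density_ge0.
have T0 : 0 <= 1 + t by rewrite addr_ge0 ?(ltW t0).
have T1 : 0 <= 1 + t^-1 by rewrite addr_ge0 ?invr_ge0 ?(ltW t0).
have compare (f g : 'rV[R]_d -> R) : measurable_fun setT f -> measurable_fun setT g ->
    (forall x, 0 <= f x) -> (forall x, 0 <= g x) ->
    (forall x, f x <= (1 + t) * g x + (1 + t^-1) * z x) ->
    (\int[mu]_x (f x)%:E <= (1 + t)%:E * \int[mu]_x (g x)%:E +
      (1 + t^-1)%:E * \int[mu]_x (z x)%:E)%E.
  move=> mf mg f0 g0 fg; rewrite -!ge0_integralM_EFin//.
  rewrite -ge0_integralD_EFin//; last 4 first.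
  - exact: measurable_funM.
  - exact: measurable_funM.
  - by move=> x; rewrite mulr_ge0.
  - by move=> x; rewrite mulr_ge0.
  apply: ge0_le_integral_EFin => //.
  by apply: measurable_funD; apply: measurable_funM.
have vw : (\int[mu]_x (v x)%:E <= (1 + t)%:E * \int[mu]_x (w x)%:E +
    (1 + t^-1)%:E * \int[mu]_x (z x)%:E)%E.
  apply: compare => // x; rewrite /v /w /z [(1 + t) * _]mulrA [(1 + t^-1) * _]mulrA -mulrDl ler_wpM2r ?powR_ge0//.
  exact: sqr_le_sqr_diff.
have wv : (\int[mu]_x (w x)%:E <= (1 + t)%:E * \int[mu]_x (v x)%:E +
    (1 + t^-1)%:E * \int[mu]_x (z x)%:E)%E.
  apply: compare => // x; rewrite /v /w /z [(1 + t) * _]mulrA [(1 + t^-1) * _]mulrA -mulrDl ler_wpM2r ?powR_ge0//.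
  by rewrite -[X in _ <= _ + _ * X]sqrrN opprB; exact: sqr_le_sqr_diff.
move: Iv Iz vw wv; rewrite -/w -/v -/z -/J -/k.
have : (\int[mu]_x (w x)%:E \is a fin_num)%E.
  by rewrite ge0_fin_numE// integral_ge0// => x _; rewrite lee_fin.
have : (0 <= \int[mu]_x (w x)%:E)%E by apply: integral_ge0 => x _; rewrite lee_fin.
have : (0 <= \int[mu]_x (z x)%:E)%E by apply: integral_ge0 => x _; rewrite lee_fin.
move=> Iz0 Iw0 Iwf <- zJ.
have [->|Jfin] := eqVneq J +oo%E.
  by move=> _ _; rewrite gt0_muley ?leey// lte_fin ltr_wpDl.
have Jf : J \is a fin_num by rewrite ge0_fin_numE// ltey.
have Izf : (\int[mu]_x (z x)%:E \is a fin_num)%E.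
  rewrite ge0_fin_numE//; apply: le_lt_trans zJ _.
  by rewrite -ge0_fin_numE ?mule_ge0 ?lee_fin// fin_numM.
move: zJ Iz0 Iw0 J0.
rewrite -(fineK Izf) -(fineK Iwf) -(fineK Jf).
set z' := fine (\int[mu]_x (z x)%:E); set w' := fine (\int[mu]_x (w x)%:E).
set j := fine J.
rewrite -!EFinM -!EFinD !lee_fin => zj z'0 w'0 j0 h1 h2.
have tw : t * w' <= (1 + t^-1) * z'.
  rewrite /t; move: h1 h2; rewrite /t; have [k_gt1|k_le1] := ltP 1 k.
    by rewrite gtr0_norm ?subr_gt0//; nra.
  rewrite ler0_norm ?subr_le0//; nra.
rewrite mulrDl mul1r; apply: (@le_trans _ _ (K * j)); last by rewrite lerDl.
have -> : K * j = ((1 + t^-1) * (C2 * j)) / t by rewrite /K; ring.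
by rewrite ler_pdivlMr// mulrC (le_trans tw)// ler_wpM2l.
Qed.

End hardy.

(** * Closures of forms and transience *)

Section continuous_rV.
Context (R : realType) (d : nat).

Let dyadic (k : nat) (x : 'rV[R]_d) : 'rV[int]_d :=
  map_mx (fun t => Num.floor (t * 2 ^+ k)) x.

Let measurable_dyadic k (n : 'rV[int]_d) : measurable (dyadic k @^-1` [set n]).
Proof.
rewrite (_ : _ @^-1` _ = \bigcap_(i in [set: 'I_d])
  ((fun x : 'rV[R]_d => x ord0 i * 2 ^+ k) @^-1` `[(n ord0 i)%:~R, (n ord0 i + 1)%:~R[)).
  apply: fin_bigcap_measurable => // i _; rewrite -[X in measurable X]setTI.
  suff : measurable_fun setT (fun x : 'rV[R]_d => x ord0 i * 2 ^+ k) by exact.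
  by apply: measurable_funM => //; exact: measurable_coor.
apply/seteqP; split => [x <- i _|x xn]; rewrite /= ?in_itv/=.
  by rewrite mxE Num.Theory.floor_le_tmp Num.Theory.floorD1_gt.
apply/rowP => i; rewrite mxE; apply/eqP.
by have := xn i I; rewrite /= in_itv/= => /andP[h1 h2]; rewrite Num.Theory.floor_eq h1.
Qed.

(** The sigma-algebra is generated by the coordinates and not by the open sets. The function is the
    pointwise limit of its values at points rounded down to the grid of mesh 2^-k, and each of these
    approximations is constant on countably many measurable cubes. *)
Lemma continuous_measurable_rV (f : 'rV[R]_d -> R) :
  continuous f -> measurable_fun setT f.
Proof.
move=> cf; pose g k x := f (map_mx (fun n : int => n%:~R / 2 ^+ k) (dyadic k x)).
apply: (@measurable_fun_cvg _ _ _ _ g) => [k|x _].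
  move=> _ B _; rewrite setTI.
  pose F n := if n \in [set n | B (f (map_mx (fun n : int => n%:~R / 2 ^+ k) n))]
    then dyadic k @^-1` [set n] else set0.
  rewrite (_ : _ @^-1` _ = \bigcup_n F n).
    apply: countable_bigcupT_measurable => [|n]; first exact: countableP.
    by rewrite /F; case: ifP => // _; exact: measurable_dyadic.
  apply/seteqP; split => [x Bx|x [n _]] /=; first by exists (dyadic k x) => //; rewrite /F mem_set.
  by rewrite /F; case: ifPn => //; rewrite inE => + xn; rewrite /= -xn.
apply: (@cvg_comp _ _ _ (fun k => map_mx (fun n : int => n%:~R / 2 ^+ k) (dyadic k x)) f _ (nbhs x));
  last exact: cf.
apply/cvg_ballP => e e0; near=> k; split => // i j.
rewrite !mxE -[X in ball X _ _](mulfK (_ : 2 ^+ k != 0 :> R)) ?expf_neq0//.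
rewrite /ball/= -mulrBl normrM [X in _ * X]gtr0_norm ?invr_gt0 ?exprn_gt0//.
rewrite ltr_pdivrMr ?exprn_gt0//.
apply: (@lt_trans _ _ 1).
  rewrite ger0_norm ?subr_ge0 ?Num.Theory.floor_le//.
  by rewrite ltrBlDl; have := Num.Theory.lt_succ_floor (x i j * 2 ^+ k); rewrite intrD.
rewrite -ltr_pdivrMl// mulr1.
have : (k < 2 ^ k)%N by exact: ltn_expl.
rewrite -(ltr_nat R) natrX; apply: le_lt_trans.
near: k; exact: nbhs_infty_ger.
Unshelve. all: by end_near. Qed.

End continuous_rV.

Section L2_norm.
Context (disp : measure_display) (T : measurableType disp) (R : realType).
Variable mu : {measure set T -> \bar R}.
Implicit Types f g : T -> R.

Lemma Lnorm2E f :
  ('N[mu]_2%:E[EFin \o f] = sqrte (\int[mu]_x (f x ^+ 2)%:E))%E.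
Proof.
rewrite unlock -poweR12_sqrt.
  congr (_ `^ _)%E; apply: eq_integral => x _ /=.
  by rewrite -real_normK ?num_real// powR_mulrn.
by apply: integral_ge0 => x _; rewrite lee_fin sqr_ge0.
Qed.

Lemma cauchy_schwarz_integral f g : measurable_fun setT f -> measurable_fun setT g ->
  (\int[mu]_x (`|f x * g x|)%:E <=
   sqrte (\int[mu]_x (f x ^+ 2)%:E) * sqrte (\int[mu]_x (g x ^+ 2)%:E))%E.
Proof.
move=> mf mg; rewrite -!Lnorm2E.
apply: le_trans (hoelder mu mf mg _ _ _) => //; last by rewrite [RHS]splitr mul1r.
by rewrite Lnorm1.
Qed.

Lemma Lfun2P f : measurable_fun setT f ->
  (\int[mu]_x (f x ^+ 2)%:E < +oo)%E -> f \in Lfun mu 2%:E.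
Proof.
move=> mf fin; rewrite inE; apply/andP; split; rewrite inE/=; first exact: mf.
rewrite /finite_norm Lnorm2E.
have I0 : (0 <= \int[mu]_x (f x ^+ 2)%:E)%E.
  by apply: integral_ge0 => x _; rewrite lee_fin sqr_ge0.
by rewrite -ge0_fin_numE ?sqrte_ge0// sqrte_fin_num// ge0_fin_numE.
Qed.

Lemma Lfun_measurable (p : \bar R) f : f \in Lfun mu p -> measurable_fun setT f.
Proof. by move=> /sub_Lfun_mfun; rewrite inE. Qed.

End L2_norm.

Section weighted_measure.
Context (R : realType) (d : nat) (delta : R).

Lemma integral_weighted_leb (f : 'rV[R]_d -> R) :
  measurable_fun setT f -> (forall x, 0 <= f x) ->
  (\int[weighted_leb d delta]_x (f x)%:E =
   \int[leb R d]_x (f x * enorm x `^ (- (2 * delta)))%:E)%E.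
Proof.
move=> mf f0; rewrite /weighted_leb ge0_integral_density_measure//.
exact/measurable_EFinP.
Qed.

End weighted_measure.

Section integrable_tails.
Context (R : realType) (d : nat).

Lemma integral_lt_pinfty_tail (w : 'rV[R]_d -> R) (K b : R) :
  measurable_fun setT w -> (forall x, 0 <= w x) -> d%:R < b ->
  (forall x, enorm x <= 1 -> w x <= K) ->
  (forall x, 1 < enorm x -> w x <= K * enorm x `^ (- b)) ->
  (\int[leb R d]_x (w x)%:E < +oo)%E.
Proof.
move=> mw w0 db wi wo.
have K0 : 0 <= K by apply: le_trans (w0 0) (wi _ _); rewrite enorm0.
have [C C0 outer] := @integral_powR_outer _ _ R (leb R d) (@enorm R d) (2 ^+ d) d%:R
  (@measurable_enorm R d) (exprn_ge0 _ (ler0n _ _)) (@leb_ball_le_powR R d) b db.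
pose A := [set x : 'rV[R]_d | enorm x <= 1].
pose B := [set x : 'rV[R]_d | 1 < enorm x].
have mA : measurable A by exact: measurable_enorm_le.
have mB : measurable B.
  rewrite -[X in measurable X]setTI.
  have := @measurable_enorm R d measurableT _ (measurable_itv `]1, +oo[).
  by rewrite preimage_itvoy.
have mb : measurable_fun setT (fun x : 'rV[R]_d => K * enorm x `^ (- b)).
  by apply: measurable_funM => //; exact: measurable_enorm_powR.
have -> : (\int[leb R d]_x (w x)%:E = \int[leb R d]_(x in A `|` B) (w x)%:E)%E.
  congr (integral _ _ _); apply/esym/seteqP; split => // x _.
  by rewrite /A /B/=; case: (leP (enorm x) 1); [left|right].
rewrite ge0_integral_setU//; last 3 first.
- by apply/measurable_funTS/measurable_EFinP.
- by move=> x _; rewrite lee_fin.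
- by apply/disj_setPS => x []; rewrite /A /B /= leNgt => /negP.
rewrite lte_add_pinfty//.
  apply: (@le_lt_trans _ _ (\int[leb R d]_(x in A) (cst K%:E) x)%E).
    apply: ge0_le_integral => //.
    - by move=> x _; rewrite lee_fin.
    - exact/measurable_funTS/measurable_EFinP.
  rewrite (integral_cst (leb R d) mA K%:E) lte_mul_pinfty ?lee_fin//.
  by apply: le_lt_trans (leb_ball_le d ler01) _; rewrite ltry.
apply: (@le_lt_trans _ _ (\int[leb R d]_(x in B) (K%:E * (enorm x `^ (- b))%:E))%E).
  apply: ge0_le_integral => //.
  - by move=> x _; rewrite lee_fin.
  - exact/measurable_funTS/measurable_EFinP.
  - by apply/measurable_funTS; apply/measurable_EFinP.
rewrite ge0_integralZl_EFin//; last 2 first.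
- by move=> x _; rewrite lee_fin powR_ge0.
- by apply/measurable_funTS/measurable_EFinP; exact: measurable_enorm_powR.
rewrite lte_mul_pinfty ?lee_fin//.
by apply: le_lt_trans (outer 1 ltr01) _; rewrite ltry.
Qed.

End integrable_tails.

Section test_functions.
Context (R : realType) (d : nat).

Lemma sup_norm_le_enorm (x : 'rV[R]_d) : `|x| <= enorm x.
Proof.
rewrite /Num.norm/= mx_normrE; apply: bigmax_le => [|[i j] _]; first exact: enorm_ge0.
by rewrite ord1 coor_le_enorm.
Qed.

Lemma enorm_le_sup_norm (x : 'rV[R]_d) : enorm x <= Num.sqrt d%:R * `|x|.
Proof.
apply: enorm_le_coor => // i; rewrite /Num.norm/= mx_normrE.
exact: (le_bigmax _ (fun ij : 'I_1 * 'I_d => `|x ij.1 ij.2|) (ord0, i)).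
Qed.

Lemma test_function_measurable (f : 'rV[R]_d -> R) :
  test_functions_off0 f -> measurable_fun setT f.
Proof. by move=> -[/(_ 0%N) cf _ _]; exact: continuous_measurable_rV. Qed.

Lemma compact_norm_le (V : normedModType R) (A : set V) : compact A ->
  exists M : R, forall x, A x -> `|x| <= M.
Proof.
move=> /compact_bounded[N [_ NA]]; exists (N + 1) => x Ax.
by apply: (NA (N + 1)) => //; rewrite ltrDl.
Qed.

Lemma test_function_bounded (f : 'rV[R]_d -> R) : test_functions_off0 f ->
  exists2 M : R, 0 <= M & forall x, `|f x| <= M.
Proof.
move=> [/(_ 0%N) /= cf cK _]; set K := closure _ in cK.
have /compact_norm_le[M fM] : compact (f @` K).
  apply: continuous_compact => //; exact: continuous_subspaceT.
exists `|M| => // x; have [->|fx] := eqVneq (f x) 0; first by rewrite normr0.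
apply: (le_trans _ (ler_norm M)); apply: fM.
by exists x => //; exact: subset_closure.
Qed.

Lemma test_function_support (f : 'rV[R]_d -> R) : test_functions_off0 f ->
  exists r1 r2 : R, [/\ 0 < r1, 1 <= r2 & forall x, f x != 0 -> r1 <= enorm x <= r2].
Proof.
move=> [_ cK K0]; set K := closure _ in cK K0.
have [M KM] := compact_norm_le cK.
have /nbhs_ballP[e /= e0 eK] : nbhs (0 : 'rV[R]_d) (~` K).
  by apply: open_nbhs_nbhs; split => //; exact/closed_openC/closed_closure.
exists e, (Num.sqrt d%:R * `|M| + 1); split => //.
  by rewrite lerDr mulr_ge0// sqrtr_ge0.
move=> x fx; have Kx : K x by exact: subset_closure.
apply/andP; split.
  rewrite leNgt; apply/negP => xe.
  have : (~` K) x; last by [].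
  apply: eK; rewrite mx_norm_ball /ball_/= sub0r normrN.
  exact: le_lt_trans (sup_norm_le_enorm x) xe.
apply: (le_trans (enorm_le_sup_norm x)).
apply: (@le_trans _ _ (Num.sqrt d%:R * `|M|)); last by rewrite lerDl.
by rewrite ler_wpM2l ?sqrtr_ge0//; apply: (le_trans _ (ler_norm M)); exact: KM.
Qed.

Lemma test_function_weighted_integral (f : 'rV[R]_d -> R) (a : R) :
  test_functions_off0 f -> (\int[leb R d]_x (f x ^+ 2 * enorm x `^ (- a))%:E < +oo)%E.
Proof.
move=> tf; have mf := test_function_measurable tf.
have [M M0 fM] := test_function_bounded tf.
have [r1 [r2 [r10 r21 supp]]] := test_function_support tf.
have r20 : 0 < r2 by exact: lt_le_trans r21.
(* The sum covers both signs of a: |x|^(-a) is largest at r1 or at r2. *)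
pose K0 := M ^+ 2 * (r1 `^ (- a) + r2 `^ (- a)).
have K00 : 0 <= K0 by rewrite mulr_ge0 ?sqr_ge0 ?addr_ge0 ?powR_ge0.
pose b : R := d%:R + 1.
have wK x : f x ^+ 2 * enorm x `^ (- a) <= K0.
  have [->|fx] := eqVneq (f x) 0; first by rewrite expr0n/= mul0r.
  have /andP[x1 x2] := supp _ fx.
  have x0 : 0 < enorm x by exact: lt_le_trans x1.
  apply: ler_pM; rewrite ?sqr_ge0 ?powR_ge0//.
    by rewrite -real_normK ?num_real// lerXn2r ?nnegrE.
  have [a0|a0] := leP 0 a.
    apply: (@le_trans _ _ (r1 `^ (- a))); last by rewrite lerDl powR_ge0.
    rewrite !powRN lef_pV2 ?posrE ?powR_gt0//.
    by rewrite ge0_ler_powR// nnegrE ltW.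
  apply: (@le_trans _ _ (r2 `^ (- a))); last by rewrite lerDr powR_ge0.
  by rewrite ge0_ler_powR// ?nnegrE ?oppr_ge0 ltW.
(* Decay comes from the bounded support, where 1 <= r2^b |x|^(-b); as r2 >= 1, the same constant
   serves inside the unit ball. *)
apply: (@integral_lt_pinfty_tail _ _ _ (K0 * r2 `^ b) b).
- by apply: measurable_funM; [exact: measurable_funX|exact: measurable_enorm_powR].
- by move=> x; rewrite mulr_ge0 ?sqr_ge0 ?powR_ge0.
- by rewrite ltrDl.
- move=> x _; apply: (le_trans (wK x)); rewrite ler_peMr//.
  by rewrite -[X in X <= _](powRr0 r2) ler_powR// addr_ge0.
move=> x x1; have [->|fx] := eqVneq (f x) 0.
  by rewrite expr0n/= mul0r mulr_ge0 ?powR_ge0// mulr_ge0 ?powR_ge0.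
have /andP[_ x2] := supp _ fx; apply: (le_trans (wK x)).
rewrite -mulrA ler_peMr// powRN ler_pdivlMr ?powR_gt0 ?(lt_trans _ x1)// mul1r.
by rewrite ge0_ler_powR// ?nnegrE ?enorm_ge0// ?(ltW r20)// addr_ge0.
Qed.

Lemma test_function_Lfun (f : 'rV[R]_d -> R) (delta : R) :
  test_functions_off0 f -> f \in Lfun (weighted_leb d delta) 2%:E.
Proof.
move=> tf; have mf := test_function_measurable tf; apply: Lfun2P => //.
rewrite integral_weighted_leb; first exact: test_function_weighted_integral.
- exact: measurable_funX.
- by move=> x; exact: sqr_ge0.
Qed.

End test_functions.

Section limits_of_integrals.
Context (R : realType).

Lemma cvge_eventually_lt (E : nat -> \bar R) (r c : R) :
  E k @[k --> \oo] --> r%:E -> r < c ->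
  exists N, forall k, (N <= k)%N -> (E k < c%:E)%E.
Proof.
move=> Er rc; have [N _ NE] := Er _ (@nbhs_open_ereal_lt R r (fun=> c) rc).
by exists N => k /NE.
Qed.

Lemma cvg_EFin_real (u : nat -> R) (l : R) :
  (u k)%:E @[k --> \oo] --> l%:E -> u k @[k --> \oo] --> l.
Proof. by move=> /fine_cvgP[_]. Qed.

Context (disp : measure_display) (T : measurableType disp).
Variable mu : {measure set T -> \bar R}.

Lemma fatou_le (F : nat -> T -> R) (f : T -> R) (e : \bar R) (N : nat) :
  (forall k, measurable_fun setT (F k)) -> (forall k x, 0 <= F k x) ->
  measurable_fun setT f -> (forall x, 0 <= f x) ->
  {ae mu, forall x, F k x @[k --> \oo] --> f x} ->
  (forall k, (N <= k)%N -> (\int[mu]_x (F k x)%:E <= e)%E) ->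
  (\int[mu]_x (f x)%:E <= e)%E.
Proof.
move=> mF F0 mf f0 Ff Fe.
pose G k x := (F (k + N)%N x)%:E.
have mG k : measurable_fun setT (G k) by exact/measurable_EFinP.
have G0 k x : (0 <= G k x)%E by rewrite lee_fin.
apply: (@le_trans _ _ (\int[mu]_x limn_einf (G^~ x))%E); last first.
  apply: (le_trans (fatou mu measurableT mG (fun k x _ => G0 k x))).
  rewrite limn_einf_lim; apply: lime_le; first exact: is_cvg_einfs.
  apply: nearW => k; apply: ereal_inf_le.
  exists (\int[mu]_x G k x)%E; first by exists k => /=.
  by apply: Fe; rewrite leq_addl.
apply: ae_ge0_le_integral => //.
- by move=> x _; rewrite lee_fin.
- exact/measurable_EFinP.
- move=> x _; rewrite limn_einf_lim; apply: lime_ge; first exact: is_cvg_einfs.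
  by apply: nearW => k; apply: le_ereal_inf_tmp => _ [j _ <-].
- rewrite (_ : (fun x => limn_einf (G^~ x)) = (fun x => - limn_esup (fun k => - G k x))%E).
    apply: measurableT_comp => //; apply: measurable_fun_limn_esup => k.
    exact: measurableT_comp.
  by apply/funext => x; rewrite /limn_einf.
apply: filterS Ff => x Fx _.
have /cvg_limn_einf_sup[-> _] : G k x @[k --> \oo] --> (f x)%:E; last by [].
apply: cvg_EFin; first by apply: nearW.
by rewrite -(cvg_shiftn N (F^~ x)) in Fx.
Qed.

End limits_of_integrals.

(** * Reference functions on closures, transience against recurrence *)

Section abstract_forms.
Context (disp : measure_display) (T : measurableType disp) (R : realType).
Variables (n : {measure set T -> \bar R}) (A : Defs.form T R).

Lemma sqrtr_addsqr_le (r a : R) : 0 <= a -> Num.sqrt (r + a ^+ 2) <= Num.sqrt r + a.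
Proof.
move=> a0; rewrite -[leRHS]ger0_norm ?addr_ge0 ?sqrtr_ge0// -sqrtr_sqr.
rewrite ler_sqrt ?sqr_ge0// sqrrD -addrA lerD//.
  have [r0|r0] := leP 0 r; first by rewrite sqr_sqrtr.
  by apply: (le_trans (ltW r0)); exact: sqr_ge0.
by rewrite lerDr mulrn_wge0// mulr_ge0// sqrtr_ge0.
Qed.

(** Split |u| g <= |v k| g + |v k - u| g: the energy of [v k] bounds the first integral, and the
    second tends to 0 by Cauchy-Schwarz, which is where [g] has to be in L2. *)
Lemma closure_approx_bound (g u : T -> R) (v : nat -> T -> R) (r : \bar R) :
  (forall w, dom A w -> measurable_fun setT w) ->
  (forall w, 0 <= energy A w)%E ->
  (forall x, 0 <= g x) -> g \in Lfun n 2%:E ->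
  (forall w, dom A w -> (\int[n]_x (`|w x| * g x)%:E <= sqrte (energy A w))%E) ->
  measurable_fun setT u -> closure_approx n A u v ->
  energy A (v k) @[k --> \oo] --> r ->
  (\int[n]_x (`|u x| * g x)%:E <= sqrte r)%E.
Proof.
move=> mA A0 g0 gL2 Ag mu [vA _ vu] Er.
have mg := Lfun_measurable gL2.
have mv k : measurable_fun setT (v k) by exact: mA.
case: r Er => [r||] Er; last 2 first.
- by rewrite leey.
- have [N _ NE] := cvgeNy_lt Er 0.
  by have := NE N (leqnn N); rewrite ltNge A0.
apply/lee_addgt0Pr => e e0.
(* One half of e pays for sqrt (r + a^2) <= sqrt r + a, the other for the L2 error. *)
pose a := e / 2; have a0 : 0 < a by rewrite divr_gt0.
pose G := ('N[n]_2%:E[EFin \o g])%E.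
have Gfin : G \is a fin_num.
  rewrite ge0_fin_numE ?Lnorm_ge0//.
  by move: gL2; rewrite inE => /andP[_]; rewrite inE.
have G0 : 0 <= fine G by rewrite fine_ge0// Lnorm_ge0.
pose c := a / (fine G + 1).
have c0 : 0 < c by rewrite divr_gt0// ltr_wpDl.
have [N1 EN1] := cvge_eventually_lt Er (ltr_pwDr (exprn_gt0 2 a0) (lexx r)).
have [N2 EN2] := cvge_eventually_lt vu c0.
pose k := maxn N1 N2.
have E1 := EN1 k (leq_maxl _ _); have E2 := EN2 k (leq_maxr _ _).
have mvu : measurable_fun setT (v k \- u) by exact: measurable_funB.
have split : (\int[n]_x (`|u x| * g x)%:E <= \int[n]_x (`|v k x| * g x)%:E +
    \int[n]_x (`|(v k \- u) x * g x|)%:E)%E.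
  rewrite -ge0_integralD_EFin; last 4 first.
  - by apply: measurable_funM => //; exact: measurableT_comp.
  - by apply: measurableT_comp => //; exact: measurable_funM.
  - by move=> x; rewrite mulr_ge0.
  - by move=> x.
  apply: ge0_le_integral_EFin.
  - by apply: measurable_funM => //; exact: measurableT_comp.
  - apply: measurable_funD.
      by apply: measurable_funM => //; exact: measurableT_comp.
    by apply: measurableT_comp => //; exact: measurable_funM.
  - by move=> x; rewrite mulr_ge0.
  move=> x; rewrite normrM (ger0_norm (g0 x)) -mulrDl ler_wpM2r//=.
  have := ler_normB (v k x) (v k x - u x).
  by rewrite opprB [X in `|X| <= _]addrC subrK.
apply: (le_trans split).
have -> : ((Num.sqrt r)%:E + e%:E = (Num.sqrt r + a)%:E + a%:E)%E.
  by rewrite -!EFinD; congr EFin; rewrite /a; field.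
apply: leeD.
  apply: (le_trans (Ag _ (vA k))).
  apply: (@le_trans _ _ (sqrte (r + a ^+ 2)%:E)).
    by rewrite lee_sqrt ?(ltW E1)// (le_trans (A0 (v k)) (ltW E1)).
  by rewrite /= lee_fin sqrtr_addsqr_le// ltW.
apply: (le_trans (cauchy_schwarz_integral n mvu mg)).
rewrite -!Lnorm2E -/G -(fineK Gfin).
apply: (@le_trans _ _ (c%:E * (fine G)%:E)%E).
  by rewrite lee_wpmul2r ?lee_fin// ltW.
rewrite -EFinM lee_fin /c mulrAC ler_pdivrMr ?ltr_wpDl//.
by rewrite ler_wpM2l ?(ltW a0)// lerDl.
Qed.

Lemma form_closure_bound (g : T -> R) :
  (forall w, dom A w -> measurable_fun setT w) ->
  (forall w, 0 <= energy A w)%E ->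
  (forall x, 0 <= g x) -> g \in Lfun n 2%:E ->
  (forall w, dom A w -> (\int[n]_x (`|w x| * g x)%:E <= sqrte (energy A w))%E) ->
  forall u, dom (form_closure n A) u ->
    (\int[n]_x (`|u x| * g x)%:E <= sqrte (energy (form_closure n A) u))%E.
Proof.
move=> mA A0 g0 gL2 Ag u [uL2 _].
rewrite /=; set S := [set r | _].
have [eS|nS] := pselect (exists r, S r).
  have [v vu Er] := xgetPex +oo%E eS.
  exact: (closure_approx_bound mA A0 g0 gL2 Ag (Lfun_measurable uL2) vu Er).
(* Without a convergent sequence of energies the energy is the default +oo, and the bound is
   trivial. *)
by rewrite xgetPN ?leey// => r Sr; apply: nS; exists r.
Qed.

(** The value 0 differs from the default +oo, so an actual sequence attains it. *)
Lemma extended_energy0P (u : T -> \bar R) : extended_energy n A u = 0%E ->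
  exists2 v, extended_approx n A u v & energy A (v k) @[k --> \oo] --> 0%E.
Proof.
rewrite /extended_energy; set S := [set r | _].
have [eS Su|nS] := pselect (exists r, S r).
  by have := xgetPex +oo%E eS; rewrite Su.
by rewrite xgetPN// => r Sr; apply: nS; exists r.
Qed.

(** Along a sequence that approximates 1 with energies tending to 0, Fatou's lemma makes the
    integral of [g] vanish, although [g] is positive almost everywhere. *)
Lemma transient_recurrent_trivial :
  (forall w, dom A w -> measurable_fun setT w) ->
  transient n A -> recurrent n A -> n setT = 0%E.
Proof.
move=> mA [g [_ ig g0 Ag]] [_ /extended_energy0P[v [vA _ v1] E0]].
have mg : measurable_fun setT g by apply/measurable_EFinP; exact: measurable_int ig.
(* Positivity of [g] holds only almost everywhere, whereas [fatou_le] asks for functions that are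
   nonnegative everywhere; hence the absolute value. *)
have mng : measurable_fun setT (fun x => `|g x|) by exact: measurableT_comp.
have mv k : measurable_fun setT (v k) by exact: mA.
have mF k : measurable_fun setT (fun x => `|v k x| * `|g x|).
  by apply: measurable_funM => //; exact: measurableT_comp.
have Ig0 : (\int[n]_x (`|g x|)%:E = 0)%E.
  apply/le_anti/andP; split; last by apply: integral_ge0 => x _; rewrite lee_fin.
  apply/lee_addgt0Pr => e e0; rewrite add0e.
  have [N EN] := cvge_eventually_lt E0 (exprn_gt0 2 e0).
  apply: (@fatou_le _ _ _ n (fun k x => `|v k x| * `|g x|) _ _ N) => //.
  - apply: filterS v1 => x vx1; rewrite -[X in _ --> X]mul1r.
    apply: cvgMl; rewrite -[X in _ --> X]normr1.
    by apply: cvg_norm; exact: (cvg_EFin_real vx1).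
  move=> k /EN Ek; apply: (@le_trans _ _ (\int[n]_x (`|v k x| * g x)%:E)%E).
    rewrite le_eqVlt; apply/orP; left; apply/eqP.
    apply: ae_eq_integral => //.
    - exact/measurable_EFinP.
    - by apply/measurable_EFinP; apply: measurable_funM => //; exact: measurableT_comp.
    - by apply: filterS g0 => x gx0 _; rewrite (gtr0_norm gx0).
  apply: (le_trans (Ag _ (vA k))).
  have -> : e%:E = sqrte (e ^+ 2)%:E by rewrite /= sqrtr_sqr gtr0_norm.
  by rewrite lee_sqrt ?(ltW Ek)// lee_fin sqr_ge0.
have gz : ae_eq n setT (EFin \o g) (cst 0%E).
  apply/(ae_eq_integral_abs n measurableT); first exact/measurable_EFinP.
  by rewrite -Ig0; apply: eq_integral.
apply/(negligibleP n measurableT).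
have ae_false : {ae n, forall x : T, False}.
  apply: filterS2 g0 gz => x gx /(_ I) /= [] gx0.
  by move: gx; rewrite gx0 ltxx.
by apply: negligibleS ae_false => x _ h; exact: h.
Qed.

End abstract_forms.

Lemma ae_weighted_leb_neq0 (R : realType) (d : nat) (delta : R) : (0 < d)%N ->
  {ae (weighted_leb d delta), forall x : 'rV[R]_d, x != 0}.
Proof.
move=> d0; exists [set 0]; split; first exact: measurable_rV_set1.
  rewrite /weighted_leb /density_measure/= /density_measure_fun.
  rewrite (eq_integral (cst (weight delta (0 : 'rV[R]_d)))); last first.
    by move=> x; rewrite inE => ->.
  rewrite integral_cst; last exact: measurable_rV_set1.
  by apply/eqP; rewrite mule_eq0; apply/orP; right; apply/eqP; exact: leb_origin.
by move=> x /= /negP/negPn/eqP.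
Qed.

(** * Transience when 2 delta + alpha differs from d *)

Section transience.
Context (R : realType) (d : nat) (alpha delta : R).
Hypotheses (d0 : (0 < d)%N) (alpha0 : 0 < alpha) (delta0 : 0 <= delta).
Hypothesis critical : 2 * delta + alpha != d%:R.
Hypothesis const0 : 0 < stable_const d alpha.
Let s := 2 * delta + alpha.

(** The first power absorbs the weight |x|^(-2 delta) near the origin, and makes [g0] vanish there.
    The second makes both g0 |x|^(-2 delta) and g0^2 |x|^(alpha - 2 delta) integrable at
    infinity. *)
Let g0 (x : 'rV[R]_d) : R :=
  Num.min (enorm x `^ (2 * delta + 1)) (enorm x `^ (- (d%:R + alpha))).

Let g0_ge0 x : 0 <= g0 x.
Proof. by rewrite le_min !powR_ge0. Qed.

Let measurable_g0 : measurable_fun setT g0.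
Proof. by apply: measurable_minr; exact: measurable_enorm_powR. Qed.

Let g0_le1 x : g0 x <= 1.
Proof.
rewrite ge_min; apply/orP; have [x1|x1] := leP (enorm x) 1; [left|right].
  apply: (@le_trans _ _ (1 `^ (2 * delta + 1))); last by rewrite powR1.
  by rewrite ge0_ler_powR ?nnegrE ?enorm_ge0// addr_ge0// mulr_ge0.
rewrite powRN invf_le1 ?powR_gt0 ?(lt_trans _ x1)//.
by rewrite -[leLHS](powRr0 (enorm x)) ler_powR ?(ltW x1)// addr_ge0// ltW.
Qed.

Let integral_g0 : (\int[weighted_leb d delta]_x (g0 x)%:E < +oo)%E.
Proof.
rewrite integral_weighted_leb//.
apply: (@integral_lt_pinfty_tail _ _ _ 1 (d%:R + alpha + 2 * delta)).
- by apply: measurable_funM => //; exact: measurable_enorm_powR.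
- by move=> x; rewrite mulr_ge0// powR_ge0.
- by rewrite -addrA ltrDl ltr_pwDl// mulr_ge0.
- move=> x x1; have [x0|x0] := eqVneq (enorm x) 0.
    have -> : g0 x = 0.
      apply/le_anti; rewrite g0_ge0 andbT ge_min x0 powR0 ?lexx//.
      by rewrite gt_eqF// ltr_wpDl// mulr_ge0.
    by rewrite mul0r.
  apply: (@le_trans _ _ (enorm x `^ (2 * delta + 1) * enorm x `^ (- (2 * delta)))).
    by rewrite ler_wpM2r ?powR_ge0// ge_min lexx.
  rewrite -powRD ?x0 ?implybT// (_ : 2 * delta + 1 + - (2 * delta) = 1) ?powRr1 ?enorm_ge0//; ring.
- move=> x x1; rewrite mul1r.
  apply: (@le_trans _ _ (enorm x `^ (- (d%:R + alpha)) * enorm x `^ (- (2 * delta)))).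
    by rewrite ler_wpM2r ?powR_ge0// ge_min lexx orbT.
  rewrite -powRD ?(gt_eqF (lt_trans ltr01 x1)) ?implybT// (_ : - (d%:R + alpha) + - (2 * delta) = - (d%:R + alpha + 2 * delta))//.
  ring.
Qed.

(** The second factor in Cauchy-Schwarz: u g |x|^(-2 delta) is the product of u |x|^(-s/2), whose
    square is the Hardy integrand, and g |x|^((alpha - 2 delta)/2). *)
Let integral_sqr_g0 :
  (\int[leb R d]_x (g0 x ^+ 2 * enorm x `^ (alpha - 2 * delta))%:E < +oo)%E.
Proof.
apply: (@integral_lt_pinfty_tail _ _ _ 1 (2 * d%:R + alpha + 2 * delta)).
- by apply: measurable_funM; [exact: measurable_funX|exact: measurable_enorm_powR].
- by move=> x; rewrite mulr_ge0 ?sqr_ge0// powR_ge0.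
- have : (0 < d%:R :> R) by rewrite ltr0n.
  by move: alpha0 delta0; lra.
- move=> x x1; have [x0|x0] := eqVneq (enorm x) 0.
    have -> : g0 x = 0.
      apply/le_anti; rewrite g0_ge0 andbT ge_min x0 powR0 ?lexx//.
      by rewrite gt_eqF// ltr_wpDl// mulr_ge0.
    by rewrite expr0n/= mul0r.
  apply: (@le_trans _ _ (enorm x `^ (2 * delta + 1) ^+ 2 * enorm x `^ (alpha - 2 * delta))).
    by rewrite ler_wpM2r ?powR_ge0// lerXn2r ?nnegrE ?powR_ge0// ge_min lexx.
  rewrite expr2 -!powRD ?x0 ?implybT//.
  rewrite -[leRHS](powRr0 (enorm x)).
  rewrite ger_powR ?x1 ?lt_neqAle ?enorm_ge0 ?andbT 1?eq_sym ?x0//.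
  by move: alpha0 delta0; lra.
- move=> x x1; rewrite mul1r.
  apply: (@le_trans _ _ (enorm x `^ (- (d%:R + alpha)) ^+ 2 * enorm x `^ (alpha - 2 * delta))).
    by rewrite ler_wpM2r ?powR_ge0// lerXn2r ?nnegrE ?powR_ge0// ge_min lexx orbT.
  rewrite expr2 -!powRD ?(gt_eqF (lt_trans ltr01 x1)) ?implybT//.
  rewrite ler_powR ?(ltW x1)//; move: alpha0; lra.
Qed.

Let cst0 : 0 < 2^-1 * stable_const d alpha.
Proof. by rewrite mulr_gt0// invr_gt0. Qed.

Lemma pre_form_energy_ge0 w : (0 <= energy (pre_form d alpha delta) w)%E.
Proof.
rewrite pre_form_energyE mule_ge0 ?lee_fin ?(ltW cst0)//.
by apply: integral_ge0 => p _; rewrite lee_fin jump_density_ge0.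
Qed.

Let reference_function : exists2 c : R, 0 < c & forall u, test_functions_off0 u ->
  (\int[weighted_leb d delta]_x (`|u x| * (c * g0 x))%:E <=
   sqrte (energy (pre_form d alpha delta) u))%E.
Proof.
have [C C0 hardy] := hardy_inequality d0 alpha0 delta0 critical.
pose B := (\int[leb R d]_x (g0 x ^+ 2 * enorm x `^ (alpha - 2 * delta))%:E)%E.
have B0 : (0 <= B)%E.
  by apply: integral_ge0 => x _; rewrite lee_fin mulr_ge0 ?sqr_ge0 ?powR_ge0.
have Bfin : B \is a fin_num by rewrite ge0_fin_numE.
have K0 : 0 <= fine B by rewrite fine_ge0.
pose c0 := 2^-1 * stable_const d alpha.
pose D := C * (fine B + 1).
have D0 : 0 < D by rewrite mulr_gt0// ltr_wpDl.
(* As c <= 1, c^2 <= c and therefore C c^2 (fine B) <= c D <= c0. The + 1 in [D] makes it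
   positive. *)
pose c := Num.min 1 (c0 / D).
have c_gt0 : 0 < c by rewrite lt_min ltr01 divr_gt0.
have cD : C * (c ^+ 2 * fine B) <= c0.
  have c1 : c <= 1 by rewrite ge_min lexx.
  have c2 : c <= c0 / D by rewrite ge_min lexx orbT.
  rewrite ler_pdivlMr// in c2; apply: le_trans c2.
  have cc : c ^+ 2 <= c by rewrite expr2 ler_piMr// ltW.
  have -> : c * D = C * (c * (fine B + 1)) by rewrite /D; ring.
  rewrite ler_wpM2l ?(ltW C0)//; apply: ler_pM => //; first exact: sqr_ge0.
  by rewrite lerDl.
exists c => // u tu.
have mu := test_function_measurable tu.
have mg : measurable_fun setT (fun x => c * g0 x) by exact: measurable_funM.
rewrite integral_weighted_leb; last 2 first.
- by apply: measurable_funM => //; exact: measurableT_comp.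
- by move=> x; rewrite !mulr_ge0 ?(ltW c_gt0).
pose a x := u x * enorm x `^ (- (s / 2)).
pose b x := c * g0 x * enorm x `^ ((alpha - 2 * delta) / 2).
have ma : measurable_fun setT a.
  by apply: measurable_funM => //; exact: measurable_enorm_powR.
have mb : measurable_fun setT b.
  by apply: measurable_funM => //; exact: measurable_enorm_powR.
have sqr_powR (x : 'rV[R]_d) (r : R) : (enorm x `^ (r / 2)) ^+ 2 = enorm x `^ r.
  by rewrite -powR_mulrn ?powR_ge0// -powRrM; congr powR; field.
have -> : (\int[leb R d]_x (`|u x| * (c * g0 x) * enorm x `^ (- (2 * delta)))%:E =
    \int[leb R d]_x (`|a x * b x|)%:E)%E.
  apply: eq_integral => x _; congr EFin; rewrite /a /b !normrM.
  rewrite [`|c|]gtr0_norm// [`|g0 x|]ger0_norm// !(ger0_norm (powR_ge0 _ _)).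
  (* Exponents do not add for powers of 0; at the origin [g0] vanishes, and so do both sides. *)
  have [x0|x0] := eqVneq (enorm x) 0.
    have -> : g0 x = 0.
      apply/le_anti; rewrite g0_ge0 andbT ge_min x0 powR0 ?lexx//.
      by rewrite gt_eqF// ltr_wpDl// mulr_ge0.
    by rewrite !(mulr0, mul0r).
  have -> : enorm x `^ (- (2 * delta)) =
      enorm x `^ (- (s / 2)) * enorm x `^ ((alpha - 2 * delta) / 2).
    by rewrite -powRD ?x0 ?implybT//; congr powR; rewrite /s; field.
  ring.
apply: (le_trans (cauchy_schwarz_integral (leb R d) ma mb)).
have Ia : (\int[leb R d]_x (a x ^+ 2)%:E = \int[leb R d]_x (u x ^+ 2 * enorm x `^ (- s))%:E)%E.
  by apply: eq_integral => x _; rewrite /a exprMn -mulNr sqr_powR.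
have Ib : (\int[leb R d]_x (b x ^+ 2)%:E = (c ^+ 2 * fine B)%:E)%E.
  rewrite EFinM fineK// /B -ge0_integralM_EFin ?sqr_ge0//.
  - by apply: eq_integral => x _; rewrite /b !exprMn sqr_powR mulrA.
  - by apply: measurable_funM; [exact: measurable_funX|exact: measurable_enorm_powR].
  - by move=> x; rewrite mulr_ge0 ?sqr_ge0 ?powR_ge0.
have I0 : (0 <= \int[leb R d]_x (u x ^+ 2 * enorm x `^ (- s))%:E)%E.
  by apply: integral_ge0 => x _; rewrite lee_fin mulr_ge0 ?sqr_ge0 ?powR_ge0.
have J0 : (0 <= jump_energy alpha delta u)%E.
  by apply: integral_ge0 => p _; rewrite lee_fin jump_density_ge0.
rewrite Ia Ib -sqrteM// pre_form_energyE lee_sqrt; last first.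
  by rewrite mule_ge0 ?lee_fin ?(ltW cst0).
apply: (@le_trans _ _ ((C%:E * jump_energy alpha delta u) * (c ^+ 2 * fine B)%:E)%E).
  rewrite lee_wpmul2r ?lee_fin ?mulr_ge0 ?(ltW c_gt0)//.
  by apply: hardy => //; exact: test_function_weighted_integral.
by rewrite muleAC -EFinM lee_wpmul2r ?lee_fin.
Qed.

Theorem transient_dirichlet_form :
  transient (weighted_leb d delta) (dirichlet_form d alpha delta).
Proof.
have [c c0 bound] := reference_function.
pose g x := c * g0 x.
have mg : measurable_fun setT g by exact: measurable_funM.
have gge0 x : 0 <= g x by rewrite mulr_ge0 ?(ltW c0).
have Ig : (\int[weighted_leb d delta]_x (g x)%:E < +oo)%E.
  by rewrite ge0_integralM_EFin ?(ltW c0)// lte_mul_pinfty ?lee_fin ?(ltW c0).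
have g2 : g \in Lfun (weighted_leb d delta) 2%:E.
  (* Since g <= c, g^2 <= c g, and the integrability of g suffices. *)
  apply: Lfun2P => //; apply: (@le_lt_trans _ _ (c%:E * \int[weighted_leb d delta]_x (g x)%:E)%E).
    rewrite -ge0_integralM_EFin ?(ltW c0)//.
    apply: ge0_le_integral_EFin.
    - exact: measurable_funX.
    - exact: measurable_funM.
    - by move=> x; exact: sqr_ge0.
    - by move=> x; rewrite expr2 ler_wpM2r// /g ler_piMr ?(ltW c0).
  by rewrite lte_mul_pinfty ?lee_fin ?(ltW c0).
exists g; split.
- by exists c => x; rewrite ger0_norm// /g ler_piMr ?(ltW c0).
- apply/integrableP; split; first exact/measurable_EFinP.
  by under eq_integral do rewrite /= ger0_norm//.
- have pos x : x != 0 -> 0 < g x.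
    by move=> x0; rewrite /g mulr_gt0// lt_min !powR_gt0// enorm_gt0.
  by apply: filterS (ae_weighted_leb_neq0 delta d0) => x; exact: pos.
move=> u du; apply: (form_closure_bound _ pre_form_energy_ge0 gge0 g2 _ du).
  by move=> w; exact: test_function_measurable.
by move=> w; exact: bound.
Qed.

Theorem not_recurrent_dirichlet_form :
  ~ recurrent (weighted_leb d delta) (dirichlet_form d alpha delta).
Proof.
move=> rec.
have dm w : dom (dirichlet_form d alpha delta) w -> measurable_fun setT w.
  by move=> [wL _]; exact: Lfun_measurable wL.
have nT := transient_recurrent_trivial dm transient_dirichlet_form rec.
(* The weighted measure is not zero: on this shell the weight is at least 2^(-2 delta). *)
pose A := [set y : 'rV[R]_d | 1 <= enorm y <= 2 * 1].
have mA : measurable A.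
  rewrite -[X in measurable X]setTI.
  have := @measurable_enorm R d measurableT _ (measurable_itv `[1, (2 * 1)]).
  by rewrite (_ : _ @^-1` _ = A).
pose c : R := 2 `^ (- (2 * delta)).
have c0 : 0 < c by rewrite powR_gt0.
have w0 x : (0 <= weight delta x)%E by exact: weight_ge0.
have : (0 < c%:E * leb R d A)%E.
  rewrite mule_gt0//; apply: lt_le_trans (leb_annulus_ge d0 ler01).
  by rewrite lte_fin exprn_gt0// divr_gt0// sqrtr_gt0 ltr0n.
rewrite ltNge => /negP; apply; rewrite -nT.
have -> : (c%:E * leb R d A = \int[leb R d]_(x in A) (cst c%:E) x)%E.
  by rewrite integral_cst.
apply: (@le_trans _ _ (\int[leb R d]_(x in A) weight delta x)%E); last first.
  by apply: ge0_subset_integral => //; exact: measurable_weight.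
apply: ge0_le_integral => //.
- by move=> x _; rewrite lee_fin ltW.
- by apply: measurable_funTS; exact: measurable_weight.
move=> x; rewrite /A /= mulr1 => /andP[x1 x2]; rewrite lee_fin /c !powRN.
have x0 : 0 < enorm x by exact: lt_le_trans x1.
rewrite lef_pV2 ?posrE ?powR_gt0// ge0_ler_powR// ?nnegrE ?mulr_ge0// ltW//.
Qed.

End transience.

(** * Positivity of the Gamma function and of the constant in the form *)

Section gamma_function.
Context (R : realType).
Local Open Scope ereal_scope.

Let mu := @lebesgue_measure R.

Let mu_ball_le (s : R) : (0 < s)%R ->
  mu [set t : measurableTypeR R | `|t| <= s]%R <= (2 * s `^ 1)%:E.
Proof.
move=> s0; rewrite (_ : [set t | _] = `[(- s)%R, s]%classic).
  rewrite /mu lebesgue_measure_itv/= lte_fin powRr1 ?(ltW s0)//.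
  case: ifP => _; last by rewrite lee_fin mulr_ge0// ltW.
  by rewrite -EFinD lee_fin opprK mulr_natl mulr2n.
by apply/seteqP; split => t /=; rewrite in_itv/= ler_norml.
Qed.

Let mnorm : measurable_fun setT (fun t : measurableTypeR R => `|t|%R).
Proof. exact: normr_measurable. Qed.

(** [Gamma] is a real number, equal to 0 if the integral diverges, so its positivity depends on
    convergence. Near 0 the exponent s - 1 exceeds -1; at infinity t^(s + 1) <= t^m <= m! exp t
    leaves t^(-2). *)
Lemma integral_Gamma_lty (s : R) : (0 < s)%R ->
  \int[mu]_(t in `]0%R, +oo[) (t `^ (s - 1) * expR (- t))%:E < +oo.
Proof.
move=> s0.
have [K1 K10 inner] := @integral_powR_inner _ _ R mu (fun t : measurableTypeR R => `|t|%R) 2 1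
  mnorm (ler0n _ _) mu_ball_le (1 - s) (ltac:(by rewrite gtrBl)).
have [K2 K20 outer] := @integral_powR_outer _ _ R mu (fun t : measurableTypeR R => `|t|%R) 2 1
  mnorm (ler0n _ _) mu_ball_le 2 (ltac:(by rewrite ltr1n)).
pose f t : R := (t `^ (s - 1) * expR (- t))%R.
have f0 t : (0 <= f t)%R by rewrite mulr_ge0 ?powR_ge0 ?expR_ge0.
have mf : measurable_fun setT f.
  apply: measurable_funM; first exact: measurable_powR.
  by apply: measurableT_comp => //; exact: measurableT_comp.
have mp a : measurable_fun setT (fun t : R => `|t| `^ a)%R.
  by apply: (measurableT_comp (@measurable_powR R _)); exact: mnorm.
have -> : `]0%R, +oo[%classic = `]0%R, 1%R]%classic `|` `]1%R, +oo[%classic :> set R.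
  apply/seteqP; split => t /=; rewrite !in_itv/= !andbT.
    by move=> t0; case: (leP t 1%R) => t1; [left; rewrite t0|right].
  by case=> [/andP[]//|]; apply: lt_trans.
rewrite ge0_integral_setU//=; last 3 first.
- by apply/measurable_funTS/measurable_EFinP.
- by move=> t _; rewrite ?lee_fin f0.
- by apply/disj_setPS => t []; rewrite /= !in_itv/= andbT leNgt => /andP[_ /negP].
rewrite lte_add_pinfty//.
  apply: (@le_lt_trans _ _ (\int[mu]_(t in `]0%R, 1%R]) (`|t| `^ (- (1 - s)))%:E)).
    apply: ge0_le_integral => //=.
    - by move=> t _; rewrite ?lee_fin f0.
    - by apply/measurable_funTS/measurable_EFinP.
    - by apply/measurable_funTS/measurable_EFinP; exact: mp.
    move=> t; rewrite /= in_itv/= => /andP[t0 t1]; rewrite lee_fin gtr0_norm// opprB.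
    by rewrite ler_piMr ?powR_ge0// expR_le1 oppr_le0 ltW.
  apply: (@le_lt_trans _ _ (\int[mu]_(t in [set t : R | (0 < `|t| <= 1)%R]) (`|t| `^ (- (1 - s)))%:E)).
    apply: ge0_subset_integral => //=.
    - rewrite -[X in measurable X]setTI.
      have := mnorm measurableT (measurable_itv `]0%R, 1%R]).
      by rewrite (_ : _ @^-1` _ = [set t | (0 < `|t| <= 1)%R]).
    - by apply/measurable_funTS/measurable_EFinP; exact: mp.
    - by move=> t; rewrite /= in_itv/= => /andP[t0 t1]; rewrite gtr0_norm// t0.
  by apply: le_lt_trans (inner 1%R ltr01) _; rewrite ltry.
pose m := (Num.truncn (s + 1)).+1; pose C : R := m`!%:R.
have C0 : (0 <= C)%R by rewrite ler0n.
apply: (@le_lt_trans _ _ (\int[mu]_(t in `]1%R, +oo[) (C%:E * (`|t| `^ (- 2))%:E))).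
  apply: ge0_le_integral => //=.
  - by move=> t _; rewrite ?lee_fin f0.
  - by apply/measurable_funTS/measurable_EFinP.
  - apply/measurable_funTS; apply: emeasurable_funM => //.
    by apply/measurable_EFinP; exact: mp.
  move=> t; rewrite /= in_itv/= andbT => t1.
  have t0 : (0 < t)%R by exact: lt_trans t1.
  rewrite -EFinM lee_fin gtr0_norm//.
  have h1 : (t `^ (s + 1) <= t ^+ m)%R.
    rewrite -powR_mulrn ?(ltW t0)// ler_powR ?(ltW t1)//.
    by rewrite ltW// Num.Theory.truncnS_gt.
  have h2 : (t ^+ m <= C * expR t)%R.
    have := @expR_ge1Dxn R t (Num.truncn (s + 1)) (ltW t0); rewrite -/m -/C => h.
    rewrite mulrC -ler_pdivrMr ?ltr0n ?fact_gt0//.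
    by apply: le_trans h; rewrite lerDr.
  have -> : (t `^ (s - 1) = t `^ (s + 1) * t `^ (- 2))%R.
    by rewrite -powRD ?(gt_eqF t0) ?implybT//; congr powR; ring.
  rewrite mulrAC ler_wpM2r ?powR_ge0// expRN ler_pdivrMr ?expR_gt0//.
  exact: le_trans h1 h2.
rewrite ge0_integralZl_EFin//; last first.
  by apply/measurable_funTS/measurable_EFinP; exact: mp.
rewrite lte_mul_pinfty ?lee_fin//.
apply: (@le_lt_trans _ _ (\int[mu]_(t in [set t : R | (1 < `|t|)%R]) (`|t| `^ (- 2))%:E)).
  apply: ge0_subset_integral => //=.
  - rewrite -[X in measurable X]setTI.
    have := mnorm measurableT (measurable_itv `]1%R, +oo[).
    by rewrite preimage_itvoy.
  - by apply/measurable_funTS/measurable_EFinP; exact: mp.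
  - move=> t; rewrite /= in_itv/= andbT => t1; rewrite gtr0_norm//.
    exact: lt_trans t1.
by apply: le_lt_trans (outer 1%R ltr01) _; rewrite ltry.
Qed.

Lemma Gamma_gt0 (s : R) : (0 < s)%R -> (0 < Gamma s)%R.
Proof.
move=> s0; have fin := integral_Gamma_lty s0.
pose f t : R := (t `^ (s - 1) * expR (- t))%R.
have f0 t : (0 <= f t)%R by rewrite mulr_ge0 ?powR_ge0 ?expR_ge0.
have mf : measurable_fun setT f.
  apply: measurable_funM; first exact: measurable_powR.
  by apply: measurableT_comp => //; exact: measurableT_comp.
rewrite /Gamma /Rintegral fine_gt0//; apply/andP; split; last exact: fin.
(* On [1, 2] the power t^(s - 1) is at least 1 if s >= 1, and at least 2^(s - 1) otherwise. *)
pose c : R := (Num.min 1 (2 `^ (s - 1)) * expR (- 2))%R.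
have c0 : (0 < c)%R.
  by rewrite /c mulr_gt0 ?expR_gt0// lt_min ltr01 powR_gt0.
apply: (@lt_le_trans _ _ (\int[mu]_(t in `[1%R, 2%R]) (cst c%:E) t)).
  have m12 : mu `[1%R, 2%R]%classic = (2 - 1)%:E.
    by rewrite /mu lebesgue_measure_itv/= lte_fin ltr1n/= -EFinD.
  have -> : \int[mu]_(t in `[1%R, 2%R]) (cst c%:E) t = c%:E * (2 - 1)%:E.
    by rewrite -m12; exact: integral_cst.
  by rewrite -EFinM lte_fin mulr_gt0// subr_gt0 ltr1n.
apply: (@le_trans _ _ (\int[mu]_(t in `[1%R, 2%R]) (f t)%:E)).
  apply: ge0_le_integral => //=.
  - by move=> t _; rewrite ?lee_fin ltW.
  - by apply/measurable_funTS/measurable_EFinP.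
  move=> t; rewrite /= in_itv/= => /andP[t1 t2]; rewrite lee_fin.
  have t0 : (0 < t)%R by exact: lt_le_trans t1.
  rewrite /c /f; apply: ler_pM; [by rewrite le_min ler01 powR_ge0|exact: expR_ge0| |
    by rewrite ler_expR lerN2].
  rewrite ge_min; case: (leP 1%R s) => s1; apply/orP; [left|right].
    by rewrite -[X in (X <= _)%R](powRr0 t) ler_powR// subr_ge0.
  have e : (s - 1 = - (1 - s))%R by rewrite opprB.
  rewrite e !powRN lef_pV2 ?posrE ?powR_gt0//.
  by rewrite ge0_ler_powR// ?nnegrE ?subr_ge0// ltW.
apply: ge0_subset_integral => //=.
- by apply/measurable_funTS/measurable_EFinP.
- by move=> t _; rewrite ?lee_fin f0.
- move=> t; rewrite /= !in_itv/= andbT => /andP[t1 _].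
  exact: lt_le_trans t1.
Qed.

Lemma stable_const_gt0 (d : nat) (alpha : R) : (0 < alpha < 2)%R ->
  (0 < stable_const d alpha)%R.
Proof.
move=> /andP[a0 a2]; rewrite /stable_const.
have h1 : (0 < Gamma ((alpha + d%:R) / 2))%R by apply: Gamma_gt0; rewrite divr_gt0// ltr_pwDl.
have h2 : (0 < Gamma (1 - alpha / 2))%R.
  by apply: Gamma_gt0; rewrite subr_gt0 ltr_pdivrMr// mul1r.
apply: divr_gt0; last by apply: mulr_gt0 => //; exact/powR_gt0/pi_gt0.
by apply: mulr_gt0 => //; apply: mulr_gt0 => //; exact: exprn_gt0.
Qed.

End gamma_function.

(** * Energy estimate and cutoffs in the critical case *)

Section energy_of_log_lipschitz_functions.
Context (R : realType) (d : nat) (alpha delta : R).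
Hypotheses (d0 : (0 < d)%N) (alpha0 : 0 < alpha) (alpha2 : alpha < 2).
Hypotheses (alphad : alpha < d%:R) (critical : 2 * delta + alpha = d%:R).
Local Notation V := 'rV[R]_d.
Let mu := leb R d.

Let delta0 : 0 < delta.
Proof. by move: alphad critical; lra. Qed.

Let log_density (p : V * V) : R :=
  (ln (enorm p.1) - ln (enorm p.2)) ^+ 2 /
  (enorm (p.1 - p.2) `^ (d%:R + alpha) * enorm p.1 `^ delta * enorm p.2 `^ delta).

Let log_densityE : log_density = jump_density alpha delta (fun x : V => ln (enorm x)).
Proof. by []. Qed.

Let log_density_ge0 p : 0 <= log_density p.
Proof. by rewrite log_densityE; exact: jump_density_ge0. Qed.

Let log_densityN (x y : V) : log_density (x, y) = (ln (enorm x) - ln (enorm y)) ^+ 2 *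
  (enorm (y - x) `^ (- (d%:R + alpha)) * enorm x `^ (- delta) * enorm y `^ (- delta)).
Proof. by rewrite /log_density/= enormB_sym !powRN -!invfM. Qed.

Let measurable_log_density : measurable_fun setT log_density.
Proof.
rewrite log_densityE; apply: measurable_jump_density.
by apply: (measurableT_comp (@measurable_ln R)); exact: measurable_enorm.
Qed.

Lemma ln_le_diff (a b : R) : 0 < b -> b <= a -> ln a - ln b <= (a - b) / b.
Proof.
move=> b0 ba; have a0 : 0 < a by exact: lt_le_trans ba.
rewrite -ln_div ?posrE//.
have -> : a / b = 1 + (a - b) / b by field; rewrite gt_eqF.
apply: le_ln1Dx; apply: (@lt_le_trans _ _ 0); first by rewrite oppr_lt0.
by rewrite divr_ge0 ?subr_ge0// ltW.
Qed.

(** With t = ln a - ln b, this is exp (eta t / 2) >= eta t / 2, squared. *)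
Lemma sqr_ln_le (a b eta : R) : 0 < eta -> 0 < b -> b <= a ->
  (ln a - ln b) ^+ 2 <= 4 / eta ^+ 2 * (a `^ eta * b `^ (- eta)).
Proof.
move=> eta0 b0 ba; have a0 : 0 < a by exact: lt_le_trans ba.
set t := ln a - ln b.
have t0 : 0 <= t by rewrite subr_ge0 ler_ln.
have -> : a `^ eta * b `^ (- eta) = expR (eta * t / 2) ^+ 2.
  by rewrite /powR !gt_eqF// -expRD -expRM_natl; congr expR; rewrite /t; field.
have h : eta * t / 2 <= expR (eta * t / 2).
  by apply: le_trans (expR_ge1Dx _); rewrite lerDr.
apply: (@le_trans _ _ (4 / eta ^+ 2 * (eta * t / 2) ^+ 2)).
  by rewrite le_eqVlt; apply/orP; left; apply/eqP; field; rewrite gt_eqF.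
rewrite ler_wpM2l ?divr_ge0 ?sqr_ge0// lerXn2r// nnegrE ?expR_ge0//.
by rewrite divr_ge0// mulr_ge0// ltW.
Qed.

(** This value keeps both far regions integrable: eta + delta = d / 2 < d at the origin, and alpha +
    delta - eta > 0 at infinity. *)
Let eta : R := alpha / 2.

(** Here |y| >= |x| / 2, so the increment of ln is at most 2 |x - y| / |x|; its square lowers the
    singularity on the diagonal by two orders. *)
Let near_bound (x y : V) : x != 0 -> enorm (y - x) <= enorm x / 2 ->
  log_density (x, y) <= 4 * 2 `^ delta * enorm x `^ (- (2 * delta + 2)) *
    enorm (y - x) `^ (- (d%:R + alpha - 2)).
Proof.
move=> x0 yx; set r := enorm x.
have r0 : 0 < r by rewrite enorm_gt0.
have [->|xy] := eqVneq y x.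
  by rewrite /log_density/= !subrr expr0n/= mul0r !mulr_ge0 ?powR_ge0.
set w := enorm (y - x).
have w0 : 0 < w by rewrite enorm_gt0 subr_eq0.
have y1 : r / 2 <= enorm y.
  have : r <= enorm y + w.
    by have := enormB y (y - x); rewrite opprB addrC subrK.
  by move: yx; rewrite -/w -/r; lra.
have y2 : enorm y <= r + w.
  by have := enormD x (y - x); rewrite addrC subrK.
have ey0 : 0 < enorm y by apply: lt_le_trans y1; rewrite divr_gt0.
have l2 : (ln r - ln (enorm y)) ^+ 2 <= 4 * (w ^+ 2 / r ^+ 2).
  have -> : 4 * (w ^+ 2 / r ^+ 2) = (2 * w / r) ^+ 2 by field; rewrite gt_eqF.
  rewrite -real_normK ?num_real// lerXn2r// ?nnegrE ?divr_ge0 ?mulr_ge0 ?(ltW w0) ?(ltW r0)//.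
  have [ry|yr] := leP r (enorm y).
    rewrite distrC ger0_norm ?subr_ge0 ?ler_ln ?posrE//.
    apply: (le_trans (ln_le_diff r0 ry)); rewrite ler_pM2r ?invr_gt0//.
    by move: y2 w0; lra.
  rewrite ger0_norm ?subr_ge0 ?ler_ln ?posrE// ?(ltW yr)//.
  apply: (le_trans (ln_le_diff ey0 (ltW yr))).
  rewrite ler_pdivrMr// mulrAC ler_pdivlMr//.
  have h1 : r - enorm y <= w.
    by have := enormB y (y - x); rewrite opprB addrC subrK -/r -/w; lra.
  have h2 : 2 * w * (r / 2) <= 2 * w * enorm y by rewrite ler_wpM2l// mulr_ge0// ltW.
  have h3 : (r - enorm y) * r <= w * r by rewrite ler_wpM2r// ltW.
  by move: h2 h3; lra.
rewrite log_densityN -/r -/w.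
have yd : enorm y `^ (- delta) <= 2 `^ delta * r `^ (- delta).
  have -> : 2 `^ delta * r `^ (- delta) = (r / 2) `^ (- delta).
    rewrite powRM ?invr_ge0 ?(ltW r0)// mulrC; congr (_ * _).
    by rewrite -(powR_inv1 (ler0n R 2)) -powRrM mulN1r opprK.
  rewrite !powRN lef_pV2 ?posrE ?powR_gt0 ?divr_gt0//.
  by rewrite ge0_ler_powR ?nnegrE ?divr_ge0 ?(ltW r0) ?(ltW ey0) ?(ltW delta0).
have -> : 4 * 2 `^ delta * r `^ (- (2 * delta + 2)) * w `^ (- (d%:R + alpha - 2)) =
    4 * (w ^+ 2 / r ^+ 2) * (w `^ (- (d%:R + alpha)) * r `^ (- delta) *
    (2 `^ delta * r `^ (- delta))).
  have -> : w `^ (- (d%:R + alpha - 2)) = w ^+ 2 * w `^ (- (d%:R + alpha)).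
    rewrite -[w ^+ 2]powR_mulrn ?(ltW w0)// -powRD ?(gt_eqF w0) ?implybT//.
    by congr powR; ring.
  have -> : r `^ (- (2 * delta + 2)) = r `^ (- delta) * r `^ (- delta) / r ^+ 2.
    rewrite -[r ^+ 2]powR_mulrn ?(ltW r0)// -powRN -!powRD ?(gt_eqF r0) ?implybT//.
    by congr powR; ring.
  ring.
apply: ler_pM => //; first exact: sqr_ge0.
  by rewrite !mulr_ge0 ?powR_ge0.
by rewrite ler_wpM2l ?mulr_ge0 ?powR_ge0.
Qed.

(** As |y - x| > |x| / 2, the distance can be replaced by |x|, and only a weak singularity at y = 0
    remains. *)
Let far_inner_bound (x y : V) : x != 0 -> y != 0 -> enorm x / 2 < enorm (y - x) ->
  enorm y <= enorm x ->
  log_density (x, y) <= 4 / eta ^+ 2 * 2 `^ (d%:R + alpha) *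
    enorm x `^ (eta - (d%:R + alpha) - delta) * enorm y `^ (- (eta + delta)).
Proof.
move=> x0 y0 yx yx1; set r := enorm x; set t := enorm y.
have r0 : 0 < r by rewrite enorm_gt0.
have t0 : 0 < t by rewrite enorm_gt0.
have eta0 : 0 < eta by rewrite divr_gt0.
rewrite log_densityN -/r -/t.
have -> : 4 / eta ^+ 2 * 2 `^ (d%:R + alpha) * r `^ (eta - (d%:R + alpha) - delta) *
    t `^ (- (eta + delta)) = 4 / eta ^+ 2 * (r `^ eta * t `^ (- eta)) *
    ((2 `^ (d%:R + alpha) * r `^ (- (d%:R + alpha))) * r `^ (- delta) * t `^ (- delta)).
  have -> : r `^ (eta - (d%:R + alpha) - delta) =
      r `^ eta * r `^ (- (d%:R + alpha)) * r `^ (- delta).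
    by rewrite -!powRD ?(gt_eqF r0) ?implybT.
  have -> : t `^ (- (eta + delta)) = t `^ (- eta) * t `^ (- delta).
    by rewrite -powRD ?(gt_eqF t0) ?implybT// opprD.
  ring.
apply: ler_pM; [exact: sqr_ge0|by rewrite !mulr_ge0 ?powR_ge0|exact: sqr_ln_le|].
rewrite ler_wpM2r ?powR_ge0// ler_wpM2r ?powR_ge0//.
have -> : 2 `^ (d%:R + alpha) * r `^ (- (d%:R + alpha)) = (r / 2) `^ (- (d%:R + alpha)).
  rewrite powRM ?invr_ge0 ?(ltW r0)// mulrC; congr (_ * _).
  by rewrite -(powR_inv1 (ler0n R 2)) -powRrM mulN1r opprK.
have yx0 : 0 < enorm (y - x) by apply: le_lt_trans yx; rewrite divr_ge0 ?enorm_ge0.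
rewrite !powRN lef_pV2 ?posrE ?powR_gt0 ?divr_gt0//.
by rewrite ge0_ler_powR ?nnegrE ?divr_ge0 ?(ltW r0) ?(ltW yx0) ?(ltW yx)// addr_ge0// ltW.
Qed.

(** Here |y| <= |x| + |y - x| <= 3 |y - x|, so the distance can be replaced by |y|. *)
Let far_outer_bound (x y : V) : x != 0 -> enorm x / 2 < enorm (y - x) ->
  enorm x < enorm y ->
  log_density (x, y) <= 4 / eta ^+ 2 * 3 `^ (d%:R + alpha) *
    enorm x `^ (- (eta + delta)) * enorm y `^ (- (d%:R + alpha + delta - eta)).
Proof.
move=> x0 yx yx1; set r := enorm x; set t := enorm y.
have r0 : 0 < r by rewrite enorm_gt0.
have t0 : 0 < t by exact: lt_trans yx1.
have eta0 : 0 < eta by rewrite divr_gt0.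
rewrite log_densityN -/r -/t.
have -> : 4 / eta ^+ 2 * 3 `^ (d%:R + alpha) * r `^ (- (eta + delta)) *
    t `^ (- (d%:R + alpha + delta - eta)) = 4 / eta ^+ 2 * (t `^ eta * r `^ (- eta)) *
    ((3 `^ (d%:R + alpha) * t `^ (- (d%:R + alpha))) * r `^ (- delta) * t `^ (- delta)).
  have -> : t `^ (- (d%:R + alpha + delta - eta)) =
      t `^ eta * t `^ (- (d%:R + alpha)) * t `^ (- delta).
    by rewrite -!powRD ?(gt_eqF t0) ?implybT//; congr powR; ring.
  have -> : r `^ (- (eta + delta)) = r `^ (- eta) * r `^ (- delta).
    by rewrite -powRD ?(gt_eqF r0) ?implybT// opprD.
  ring.
apply: ler_pM; [exact: sqr_ge0|by rewrite !mulr_ge0 ?powR_ge0| |].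
  by rewrite -sqrrN opprB; apply: sqr_ln_le => //; exact: ltW.
rewrite ler_wpM2r ?powR_ge0// ler_wpM2r ?powR_ge0//.
have -> : 3 `^ (d%:R + alpha) * t `^ (- (d%:R + alpha)) = (t / 3) `^ (- (d%:R + alpha)).
  rewrite powRM ?invr_ge0 ?(ltW t0)// mulrC; congr (_ * _).
  by rewrite -(powR_inv1 (ler0n R 3)) -powRrM mulN1r opprK.
have yx0 : 0 < enorm (y - x) by apply: le_lt_trans yx; rewrite divr_ge0 ?enorm_ge0.
rewrite !powRN lef_pV2 ?posrE ?powR_gt0 ?divr_gt0//.
rewrite ge0_ler_powR ?nnegrE ?divr_ge0 ?(ltW t0) ?(ltW yx0)//.
  by rewrite addr_ge0// ltW.
have : t <= r + enorm (y - x) by have := enormD x (y - x); rewrite addrC subrK.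
by move: yx; rewrite -/r; lra.
Qed.

Let log_density_sym (x y : V) : log_density (x, y) = log_density (y, x).
Proof.
by rewrite !log_densityN -sqrrN opprB enormB_sym; congr (_ * _); rewrite mulrAC.
Qed.

Let integral_indicM (S : set V) (f : V -> R) :
  (\int[mu]_x (\1_S x * f x)%:E = \int[mu]_(x in S) (f x)%:E)%E.
Proof.
rewrite [RHS]integral_mkcond; apply: eq_integral => x _.
by rewrite patchE indicE; case: (x \in S); rewrite ?mul1r ?mul0r.
Qed.

Let measurable_shell (a b : R) : measurable [set y : V | a < enorm y <= b].
Proof.
rewrite -[X in measurable X]setTI.
have := @measurable_enorm R d measurableT _ (measurable_itv `]a, b]).
by rewrite (_ : _ @^-1` _ = [set y : V | a < enorm y <= b]).
Qed.

(** Each of the three regions contributes a constant times |x|^(-d), the power that dilation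
    invariance forces. *)
Lemma integral_log_density_le : exists2 C : R, 0 <= C & forall x : V, x != 0 ->
  (\int[mu]_y (log_density (x, y))%:E <= (C * enorm x `^ (- d%:R))%:E)%E.
Proof.
have eta0 : 0 < eta by rewrite divr_gt0.
pose a1 : R := d%:R + alpha - 2; pose a2 : R := eta + delta.
pose a3 : R := d%:R + alpha + delta - eta.
have inner a : a < d%:R -> _ := @integral_powR_inner _ _ R mu (@enorm R d) (2 ^+ d) d%:R
  (@measurable_enorm R d) (exprn_ge0 _ (ler0n _ _)) (@leb_ball_le_powR R d) a.
have [K1 K10 I1] : exists2 K : R, 0 <= K & forall r : R, 0 < r ->
    (\int[mu]_(x in [set x | (0 < enorm x <= r)%R]) (enorm x `^ (- a1))%:E
    <= (K * r `^ (d%:R - a1))%:E)%E.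
  by apply: inner; rewrite /a1; move: alpha2; lra.
have [K2 K20 I2] : exists2 K : R, 0 <= K & forall r : R, 0 < r ->
    (\int[mu]_(x in [set x | (0 < enorm x <= r)%R]) (enorm x `^ (- a2))%:E
    <= (K * r `^ (d%:R - a2))%:E)%E.
  by apply: inner; rewrite /a2 /eta; move: critical delta0 alpha0; lra.
have [K3 K30 I3] := @integral_powR_outer _ _ R mu (@enorm R d) (2 ^+ d) d%:R
  (@measurable_enorm R d) (exprn_ge0 _ (ler0n _ _)) (@leb_ball_le_powR R d) a3
  (ltac:(by rewrite /a3 /eta; move: delta0 alpha0; lra)).
pose c1 : R := 4 * 2 `^ delta; pose c2 : R := 4 / eta ^+ 2 * 2 `^ (d%:R + alpha).
pose c3 : R := 4 / eta ^+ 2 * 3 `^ (d%:R + alpha).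
have c10 : 0 <= c1 by rewrite mulr_ge0// powR_ge0.
have c20 : 0 <= c2 by rewrite mulr_ge0 ?powR_ge0// divr_ge0// sqr_ge0.
have c30 : 0 <= c3 by rewrite mulr_ge0 ?powR_ge0// divr_ge0// sqr_ge0.
exists (c1 * K1 + c2 * K2 + c3 * K3) => [|x x0].
  by rewrite !addr_ge0// mulr_ge0.
set r := enorm x; have r0 : 0 < r by rewrite enorm_gt0.
pose S1 := [set y : V | 0 < enorm y <= r / 2].
pose S2 := [set y : V | 0 < enorm y <= r].
pose S3 := [set y : V | r < enorm y].
have mS1 : measurable S1 by exact: measurable_shell.
have mS2 : measurable S2 by exact: measurable_shell.
have mS3 : measurable S3.
  rewrite -[X in measurable X]setTI.
  have := @measurable_enorm R d measurableT _ (measurable_itv `]r, +oo[).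
  by rewrite preimage_itvoy.
pose f1 (y : V) : R := \1_S1 y * enorm y `^ (- a1).
pose f2 (y : V) : R := \1_S2 y * enorm y `^ (- a2).
pose f3 (y : V) : R := \1_S3 y * enorm y `^ (- a3).
have mf (S : set V) a : measurable S -> measurable_fun setT (fun y : V => \1_S y * enorm y `^ a).
  by move=> mS; apply: measurable_funM; [exact: measurable_indic|exact: measurable_enorm_powR].
have f0 (S : set V) a y : 0 <= \1_S y * enorm y `^ a.
  by rewrite mulr_ge0 ?powR_ge0// indicE.
(* The translation has the form expected by [integral_leb_affine]. *)
have mt : measurable_fun setT (fun y : V => 1 *: y + - x) by exact: measurable_rV_affine.
have mg1 : measurable_fun setT (fun y : V => f1 (1 *: y + - x)).
  by apply: (measurableT_comp (mf S1 (- a1) mS1)).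
pose d1 := c1 * r `^ (- (2 * delta + 2)); pose d2 := c2 * r `^ (eta - (d%:R + alpha) - delta).
pose d3 := c3 * r `^ (- (eta + delta)).
have d10 : 0 <= d1 by rewrite mulr_ge0 ?powR_ge0.
have d20 : 0 <= d2 by rewrite mulr_ge0 ?powR_ge0.
have d30 : 0 <= d3 by rewrite mulr_ge0 ?powR_ge0.
have f10 y : 0 <= f1 y by exact: f0.
have f20 y : 0 <= f2 y by exact: f0.
have f30 y : 0 <= f3 y by exact: f0.
have mf1 : measurable_fun setT f1 by exact: mf.
have mf2 : measurable_fun setT f2 by exact: mf.
have mf3 : measurable_fun setT f3 by exact: mf.
have J1 : (\int[mu]_y (f1 (1 *: y + - x))%:E <= (K1 * r `^ (d%:R - a1))%:E)%E.
  have mE : measurable_fun setT (EFin \o f1) by exact/measurable_EFinP.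
  have E0 y : (0 <= (EFin \o f1) y)%E by rewrite lee_fin; exact: f10.
  have := @integral_leb_affine R d 1 (- x) (EFin \o f1) ltr01 mE E0.
  rewrite expr1n mul1e => <-; rewrite integral_indicM.
  apply: (le_trans (I1 (r / 2) _)); first by rewrite divr_gt0.
  rewrite lee_fin ler_wpM2l// ge0_ler_powR ?nnegrE ?divr_ge0 ?(ltW r0)//.
    by rewrite /a1; move: alpha2; lra.
  by rewrite ler_pdivrMr// ler_peMr ?(ltW r0)// ler1n.
have J2 : (\int[mu]_y (f2 y)%:E <= (K2 * r `^ (d%:R - a2))%:E)%E.
  by rewrite integral_indicM; exact: I2.
have J3 : (\int[mu]_y (f3 y)%:E <= (K3 * r `^ (d%:R - a3))%:E)%E.
  by rewrite integral_indicM; exact: I3.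
have hm (c K a b : R) : a + b = - d%:R -> c * r `^ a * (K * r `^ b) = c * K * r `^ (- d%:R).
  by move=> <-; rewrite powRD ?(gt_eqF r0) ?implybT//; ring.
have h1 : d1 * (K1 * r `^ (d%:R - a1)) = c1 * K1 * r `^ (- d%:R).
  by rewrite /d1 hm//; rewrite /a1; move: critical; lra.
have h2 : d2 * (K2 * r `^ (d%:R - a2)) = c2 * K2 * r `^ (- d%:R).
  by rewrite /d2 hm//; rewrite /a2; move: critical; lra.
have h3 : d3 * (K3 * r `^ (d%:R - a3)) = c3 * K3 * r `^ (- d%:R).
  by rewrite /d3 hm//; rewrite /a3; move: critical; lra.
have f1E y : y != x -> enorm (y - x) <= r / 2 -> f1 (1 *: y + - x) = enorm (y - x) `^ (- a1).
  move=> yx near; rewrite /f1 scale1r indicE mem_set ?mul1r//.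
  by rewrite /S1/= near enorm_gt0 subr_eq0 yx.
have f2E y : y != 0 -> enorm y <= r -> f2 y = enorm y `^ (- a2).
  move=> y0 yr; rewrite /f2 indicE mem_set ?mul1r//.
  by rewrite /S2/= yr enorm_gt0 y0.
have f3E y : r < enorm y -> f3 y = enorm y `^ (- a3).
  by move=> ry; rewrite /f3 indicE mem_set ?mul1r.
clearbody f1 f2 f3.
have pw y : log_density (x, y) <= d1 * f1 (1 *: y + - x) + (d2 * f2 y + d3 * f3 y).
  have t1 := mulr_ge0 d10 (f10 (1 *: y + - x)).
  have t2 := mulr_ge0 d20 (f20 y); have t3 := mulr_ge0 d30 (f30 y).
  (* The density is 0 at y = 0, as a nonzero power of 0 is 0. *)
  have [y0|y0] := eqVneq y 0.
    suff -> : log_density (x, y) = 0 by exact: (addr_ge0 t1 (addr_ge0 t2 t3)).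
    by rewrite log_densityN y0 enorm0 [0 `^ (- delta)]powR0 ?oppr_eq0 ?gt_eqF// !mulr0.
  have [yx|yx] := eqVneq y x.
    suff -> : log_density (x, y) = 0 by exact: (addr_ge0 t1 (addr_ge0 t2 t3)).
    by rewrite log_densityN -yx subrr expr0n/= mul0r.
  have [near|far] := leP (enorm (y - x)) (r / 2).
    apply: (le_trans (near_bound x0 near)); rewrite (f1E y yx near).
    by rewrite lerDl; exact: (addr_ge0 t2 t3).
  have [yr|ry] := leP (enorm y) r.
    apply: (le_trans (far_inner_bound x0 y0 far yr)); rewrite (f2E y y0 yr) addrCA.
    by rewrite lerDl; exact: (addr_ge0 t1 t3).
  apply: (le_trans (far_outer_bound x0 far ry)); rewrite (f3E y ry) addrA.
  by rewrite lerDr; exact: (addr_ge0 t1 t2).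
clearbody d1 d2 d3.
apply: (@le_trans _ _ (\int[mu]_y (d1 * f1 (1 *: y + - x) + (d2 * f2 y + d3 * f3 y))%:E)%E).
  apply: ge0_le_integral_EFin => //.
    exact: (measurableT_comp measurable_log_density (@pair1_measurable _ _ _ _ x)).
  by apply: measurable_funD; [|apply: measurable_funD]; apply: measurable_funM.
rewrite ge0_integralD_EFin; last 4 first.
- exact: measurable_funM.
- by apply: measurable_funD; apply: measurable_funM.
- by move=> y; rewrite mulr_ge0.
- by move=> y; rewrite addr_ge0// mulr_ge0.
rewrite ge0_integralD_EFin; last 4 first.
- exact: measurable_funM.
- exact: measurable_funM.
- by move=> y; rewrite mulr_ge0.
- by move=> y; rewrite mulr_ge0.
rewrite (ge0_integralM_EFin mu d10 mg1)// (ge0_integralM_EFin mu d20 mf2)//.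
rewrite (ge0_integralM_EFin mu d30 mf3)// !mulrDl !EFinD -addeA.
apply: leeD; last apply: leeD.
- apply: (@le_trans _ _ (d1%:E * (K1 * r `^ (d%:R - a1))%:E)%E); last by rewrite -EFinM h1.
  by apply: lee_wpmul2l J1; rewrite lee_fin.
- apply: (@le_trans _ _ (d2%:E * (K2 * r `^ (d%:R - a2))%:E)%E); last by rewrite -EFinM h2.
  by apply: lee_wpmul2l J2; rewrite lee_fin.
- apply: (@le_trans _ _ (d3%:E * (K3 * r `^ (d%:R - a3))%:E)%E); last by rewrite -EFinM h3.
  by apply: lee_wpmul2l J3; rewrite lee_fin.
Qed.

(** Only pairs with a point in the annulus contribute. By symmetry it is enough to put x there;
    integrating in y leaves |x|^(-d), and [integral_powR_log] counts the shells. *)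
Theorem jump_energy_log_lipschitz : exists2 C : R, 0 <= C &
  forall (k : nat) (L : R) (u : V -> R), 0 <= L -> measurable_fun setT u ->
    (forall x y, 0 < enorm x -> 0 < enorm y ->
      `|u x - u y| <= L * `|ln (enorm x) - ln (enorm y)|) ->
    (forall x, u x != 0 -> 2 ^- k <= enorm x <= 2 ^+ k) ->
    (jump_energy alpha delta u <= (C * L ^+ 2 * k.*2.+1%:R)%:E)%E.
Proof.
have [C C0 IC] := integral_log_density_le.
pose B : R := 2 `^ `|d%:R : R| * 2 ^+ d.
have B0 : 0 <= B by rewrite mulr_ge0 ?powR_ge0 ?exprn_ge0.
exists (2 * C * B) => [|k L u L0 mu0 lip supp]; first by rewrite !mulr_ge0.
pose A := [set x : V | 2 ^- k <= enorm x <= 2 ^+ k].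
have mA : measurable A.
  rewrite -[X in measurable X]setTI.
  have := @measurable_enorm R d measurableT _ (measurable_itv `[(2 ^- k), (2 ^+ k)]).
  by rewrite (_ : _ @^-1` _ = A).
pose F (p : V * V) : R := \1_A p.1 * log_density p.
pose G (p : V * V) : R := \1_A p.2 * log_density p.
have mF : measurable_fun setT F.
  by apply: measurable_funM => //; exact: (measurable_fst_rV (measurable_indic mA)).
have mG : measurable_fun setT G.
  by apply: measurable_funM => //; exact: (measurable_snd_rV (measurable_indic mA)).
have F0 p : 0 <= F p by rewrite mulr_ge0// indicE.
have G0 p : 0 <= G p by rewrite mulr_ge0// indicE.
have pw p : jump_density alpha delta u p <= L ^+ 2 * (F p + G p).
  have rhs0 : 0 <= L ^+ 2 * (F p + G p) by rewrite mulr_ge0 ?sqr_ge0 ?addr_ge0.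
  case: p rhs0 => x y rhs0.
  (* The Lipschitz hypothesis is silent at the origin; there the denominator is 0, and hence also
     the quotient. *)
  have z0 : (0 : R) `^ delta = 0 by rewrite powR0// gt_eqF.
  have [x0|x0] := eqVneq x 0.
    by rewrite {1}/jump_density/= {3}x0 enorm0 z0 mulr0 mul0r invr0 mulr0.
  have [y0|y0] := eqVneq y 0.
    by rewrite {1}/jump_density/= {3}y0 enorm0 z0 mulr0 invr0 mulr0.
  have ex0 : 0 < enorm x by rewrite enorm_gt0.
  have ey0 : 0 < enorm y by rewrite enorm_gt0.
  have [/andP[/eqP ux /eqP uy]|] := boolP ((u x == 0) && (u y == 0)).
    by rewrite {1}/jump_density/= ux uy subrr expr0n/= mul0r.
  rewrite negb_and => uxy.
  have le1 : log_density (x, y) <= F (x, y) + G (x, y).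
    have iA z : A z -> \1_A z = 1 :> R by move=> h; rewrite indicE mem_set.
    have FE0 := F0 (x, y); have GE0 := G0 (x, y).
    case/orP: uxy => /supp h.
      have -> : F (x, y) = log_density (x, y) by rewrite /F/= (iA x h) mul1r.
      by rewrite lerDl.
    have -> : G (x, y) = log_density (x, y) by rewrite /G/= (iA y h) mul1r.
    by rewrite lerDr.
  apply: (@le_trans _ _ (L ^+ 2 * log_density (x, y))); last by rewrite ler_wpM2l ?sqr_ge0.
  rewrite /jump_density /log_density/= mulrA ler_wpM2r//.
    by rewrite invr_ge0 !mulr_ge0 ?powR_ge0.
  rewrite -exprMn -[leLHS]real_normK ?num_real// -[leRHS]real_normK ?num_real//.
  by rewrite lerXn2r ?nnegrE// normrM (ger0_norm L0) lip.
have IF : (\int[mu \x mu]_p (F p)%:E <= (C * (B * k.*2.+1%:R))%:E)%E.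
  rewrite fubini_tonelli1; last 2 first.
  - exact/measurable_EFinP.
  - by move=> p; rewrite lee_fin.
  apply: (@le_trans _ _ (\int[mu]_x (C * (\1_A x * enorm x `^ (- d%:R)))%:E)%E).
    apply: ge0_le_integral => //.
    - by move=> x _; apply: integral_ge0 => y _; rewrite lee_fin.
    - by apply: measurable_fun_fubini_tonelli_F => [|p]; [exact/measurable_EFinP|rewrite lee_fin].
    - apply/measurable_EFinP; apply: measurable_funM => //; apply: measurable_funM.
        exact: measurable_indic.
      exact: measurable_enorm_powR.
    move=> x _; rewrite /fubini_F /F/=.
    have ml : measurable_fun setT (fun y => log_density (x, y)).
      exact: (measurableT_comp measurable_log_density (@pair1_measurable _ _ _ _ x)).
    rewrite (ge0_integralM_EFin mu _ ml) ?indicE//.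
    case: (boolP (x \in A)) => xA; last by rewrite mul0e mul0r mulr0.
    rewrite mul1e mul1r; apply: IC; rewrite -enorm_gt0.
    by move: xA; rewrite inE => /andP[h _]; apply: lt_le_trans h; rewrite invr_gt0 exprn_gt0.
  rewrite ge0_integralM_EFin//; last 2 first.
  - by apply: measurable_funM; [exact: measurable_indic|exact: measurable_enorm_powR].
  - by move=> x; rewrite mulr_ge0 ?powR_ge0// indicE.
  rewrite integral_indicM EFinM lee_wpmul2l ?lee_fin//.
  exact: (@integral_powR_log _ _ R mu (@enorm R d) (2 ^+ d) d%:R
    (@measurable_enorm R d) (exprn_ge0 _ (ler0n _ _)) (@leb_ball_le_powR R d) k).
have GF : (\int[mu \x mu]_p (G p)%:E = \int[mu \x mu]_p (F p)%:E)%E.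
  rewrite fubini_tonelli2; last 2 first.
  - exact/measurable_EFinP.
  - by move=> p; rewrite lee_fin.
  rewrite fubini_tonelli1; last 2 first.
  - exact/measurable_EFinP.
  - by move=> p; rewrite lee_fin.
  apply: eq_integral => x _; apply: eq_integral => y _.
  by rewrite /F /G/= log_density_sym.
apply: (@le_trans _ _ (\int[mu \x mu]_p (L ^+ 2 * (F p + G p))%:E)%E).
  apply: ge0_le_integral_EFin => //.
  - exact: measurable_jump_density.
  - by apply: measurable_funM => //; exact: measurable_funD.
  - by move=> p; exact: jump_density_ge0.
rewrite ge0_integralM_EFin ?sqr_ge0//; last 2 first.
- exact: measurable_funD.
- by move=> p; rewrite addr_ge0.
rewrite ge0_integralD_EFin// GF.
have -> : (2 * C * B * L ^+ 2 * k.*2.+1%:R)%:E =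
    ((L ^+ 2)%:E * ((C * (B * k.*2.+1%:R))%:E + (C * (B * k.*2.+1%:R))%:E))%E.
  by rewrite -EFinD -EFinM; congr EFin; ring.
by rewrite lee_wpmul2l ?lee_fin ?sqr_ge0// leeD.
Qed.

End energy_of_log_lipschitz_functions.

(** * Smooth functions of one and several variables *)

Section smooth_functions_of_one_variable.
Context (R : realType).
Implicit Types (U : set R) (f g : R -> R).

(** Derivatives are exhibited at each order and required on [U] only, so that a family closed under
    differentiation is handled by induction on k. *)
Fixpoint C1On U (k : nat) f : Prop :=
  match k with
  | 0 => forall x, U x -> {for x, continuous f}
  | k'.+1 => exists2 g, (forall x, U x -> is_derive x 1 f (g x)) & C1On U k' g
  end.

Lemma is_derive_continuous f (x l : R) : is_derive x 1 f l -> {for x, continuous f}.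
Proof.
move=> h; apply: differentiable_continuous; apply/derivable1_diffP.
exact: ex_derive.
Qed.

Lemma C1On_continuous U k f : C1On U k f -> forall x, U x -> {for x, continuous f}.
Proof.
by case: k => [//|k] [g fg _] x Ux; exact: is_derive_continuous (fg x Ux).
Qed.

Lemma C1On_lincomb U k (c : R) f g :
  C1On U k f -> C1On U k g -> C1On U k (fun x => f x + c * g x).
Proof.
elim: k f g => [|k IH] f g /=.
  move=> cf cg x Ux; apply: cvgD; first exact: cf.
  by apply: cvgM; [exact: cvg_cst|exact: cg].
move=> [f' ff' kf] [g' gg' kg]; exists (fun x => f' x + c * g' x); last exact: IH.
move=> x Ux; have hf := ff' x Ux; have hg := gg' x Ux.
have -> : (fun x => f x + c * g x) = f + (c \*: g) by apply/funext.
exact: is_deriveD.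
Qed.

(** The derivative is written as a linear combination to match [C1On_lincomb]. *)
Lemma is_derive_invX n (x : R) : 0 < x ->
  is_derive x 1 (fun x : R => (x^-1) ^+ n) (0 + (- n%:R) * (x^-1) ^+ n.+1).
Proof.
move=> x0; have h1 : is_derive x 1 (fun y : R => y^-1) (- x ^- 2 *: 1).
  by apply: is_deriveV; exact: lt0r_neq0.
have -> : (fun y : R => (y^-1) ^+ n) = (fun y : R => y^-1) ^+ n.
  by apply/funext => y; rewrite exprfctE.
apply: (is_derive_eq (is_deriveX n h1)).
rewrite add0r /GRing.scale/= mulr1 ?exprfctE.
case: n => [|n]; first by rewrite ?mulr0n oppr0 !mul0r.
by rewrite /= -exprVn; set w := x^-1; rewrite !exprS; ring.
Qed.

Lemma C1On_cst U k (c : R) : C1On U k (fun=> c).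
Proof.
elim: k c => [|k IH] c /=; first by move=> x _; exact: cvg_cst.
by exists (fun=> 0) => // x _; exact: is_derive_cst.
Qed.

Lemma C1On_inv k n : C1On [set x | 0 < x] k (fun x : R => (x^-1) ^+ n).
Proof.
elim: k n => [|k IH] n /=.
  by move=> x x0; exact: is_derive_continuous (is_derive_invX n x0).
exists (fun x => 0 + (- n%:R) * (x^-1) ^+ n.+1) => [x|]; first exact: is_derive_invX.
by apply: C1On_lincomb; [exact: C1On_cst|exact: IH].
Qed.

Lemma C1On_ln k : C1On [set x | 0 < x] k (@ln R).
Proof.
case: k => [|k] /=; first by move=> x; exact: continuous_ln.
exists (fun x => (x^-1) ^+ 1); last exact: C1On_inv.
by move=> x x0; rewrite expr1; exact: is_derive1_ln.
Qed.

(* t^-n exp(-1/t), extended by 0; these functions are flat at 0 and their span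
   is stable under differentiation. *)
Definition flat_exp (n : nat) (t : R) : R :=
  if 0 < t then (t^-1) ^+ n * expR (- t^-1) else 0.

Lemma flat_exp_ge0 n t : 0 <= flat_exp n t.
Proof.
rewrite /flat_exp; case: ifP => // t0.
by rewrite mulr_ge0 ?expR_ge0// exprn_ge0// invr_ge0 ltW.
Qed.

(** The exponential series at w = 1 / t gives exp w >= w^(n+m+1) / (n+m+1)!, that is, vanishing at 0
    to any order. *)
Lemma flat_exp_le n m t : 0 < t -> flat_exp n t <= ((n + m).+1)`!%:R * t ^+ m.+1.
Proof.
move=> t0; rewrite /flat_exp t0; set w := t^-1.
have w0 : 0 < w by rewrite invr_gt0.
have := @expR_ge1Dxn R w (n + m)%N (ltW w0).
set F := _`!%:R; have F0 : 0 < F by rewrite ltr0n fact_gt0.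
move=> h; have {h} : w ^+ (n + m).+1 / F <= expR w.
  by apply: le_trans h; rewrite lerDr.
rewrite ler_pdivrMr// expRN ler_pdivrMr ?expR_gt0// => h.
have -> : F * t ^+ m.+1 * expR w = (expR w * F) / w ^+ m.+1.
  by rewrite -exprVn invrK; ring.
by rewrite ler_pdivlMr ?exprn_gt0// -exprD addnS.
Qed.

Lemma is_derive_flat_exp (n : nat) (t : R) :
  is_derive t 1 (flat_exp n) (flat_exp n.+2 t + - n%:R * flat_exp n.+1 t).
Proof.
case: (ltgtP t 0) => [t0|t0|->].
- rewrite /flat_exp ltNge (ltW t0)/= mulr0 addr0.
  apply: (near_eq_is_derive _ (is_derive_cst (0 : R) t 1)).
  near=> y; rewrite ltNge ltW//; near: y.
  by apply: lt_nbhsl.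
- have h1 : is_derive t 1 (fun y : R => y^-1) (- t ^- 2 *: 1).
    by apply: is_deriveV; exact: lt0r_neq0.
  have h2 : is_derive t 1 (expR \o (- (fun y : R => y^-1))) (expR (- t^-1) * - (- t ^- 2 *: 1)).
    exact: is_derive1_comp.
  have h3 : is_derive t 1 (((fun y : R => y^-1) ^+ n) * (expR \o (- (fun y : R => y^-1))))
      (flat_exp n.+2 t + - n%:R * flat_exp n.+1 t).
    apply: (is_derive_eq (is_deriveM (is_deriveX n h1) h2)).
    rewrite /flat_exp t0 /GRing.scale/= ?exprfctE mulr1/= -exprVn.
    have -> : (- (fun y : R => y^-1)) t = - t^-1 by [].
    set w := t^-1; set X := expR _.
    case: n => [|n]; first by rewrite !expr0 !exprS; ring.
    by rewrite /= !exprS; ring.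
  apply: (near_eq_is_derive _ h3); near=> y; rewrite /flat_exp ifT//; last first.
    by near: y; exact: lt_nbhsr.
  by rewrite [LHS]/GRing.mul/= exprfctE.
(* At 0 the difference quotient is at most a multiple of |h|, by [flat_exp_le] with m = 1. *)
rewrite /flat_exp ltxx mulr0 addr0.
pose F : R := ((n + 1).+1)`!%:R.
have F0 : 0 < F by rewrite ltr0n fact_gt0.
have lim : h^-1 *: ((flat_exp n \o shift 0) (h *: 1) - flat_exp n 0) @[h --> 0^'] --> (0 : R).
  apply/cvgrPdist_lt => e e0; near=> h.
  have h0 : h != 0 by near: h; exact: nbhs_dnbhs_neq.
  rewrite sub0r normrN /= addr0 [flat_exp n 0]/flat_exp ltxx subr0.
  rewrite /GRing.scale/= mulr1 normrM normfV (ger0_norm (flat_exp_ge0 _ _)).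
  have [hpos|hneg] := ltP 0 h; last first.
    by have -> : flat_exp n h = 0; rewrite ?mulr0// /flat_exp ltNge hneg.
  rewrite gtr0_norm// mulrC ltr_pdivrMr//.
  apply: (le_lt_trans (flat_exp_le n 1 hpos)).
  rewrite -/F expr2 mulrA ltr_pM2r// mulrC -ltr_pdivlMr//.
  apply: le_lt_trans (ler_norm h) _.
  near: h; apply: dnbhs0_lt; exact: divr_gt0.
split; first by apply/cvg_ex; exists 0.
exact/cvg_lim.
Unshelve. all: by end_near. Qed.

Lemma C1On_flat_exp k n : C1On setT k (flat_exp n).
Proof.
elim: k n => [|k IH] n /=.
  by move=> x _; exact: is_derive_continuous (is_derive_flat_exp n x).
exists (fun t => flat_exp n.+2 t + - n%:R * flat_exp n.+1 t).
  by move=> x _; exact: is_derive_flat_exp.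
exact: C1On_lincomb.
Qed.

Lemma flat_exp0_le1 t : flat_exp 0 t <= 1.
Proof.
rewrite /flat_exp; case: ifP => // t0; rewrite expr0 mul1r expR_le1.
by rewrite oppr_le0 invr_ge0 ltW.
Qed.

(** The derivative w^2 exp (-w), with w = 1 / t, is at most 2 because exp w >= w^2 / 2. *)
Lemma flat_exp0_lipschitz s t : `|flat_exp 0 s - flat_exp 0 t| <= 2 * `|s - t|.
Proof.
wlog st : s t / t <= s.
  move=> H; case: (leP t s) => [/H//|/ltW/H].
  by rewrite distrC [`|t - s|]distrC.
have cf : {within `[t, s], continuous (flat_exp 0)}.
  apply: continuous_subspaceT => x; exact: (C1On_flat_exp 0 0).
have [c _ ->] := MVT_segment st (fun x _ => is_derive_flat_exp 0 x) cf.
rewrite oppr0 mul0r addr0 normrM ler_wpM2r//.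
rewrite ger0_norm ?flat_exp_ge0//; have [c0|c0] := ltP 0 c; last first.
  by rewrite /flat_exp ltNge c0.
rewrite /flat_exp c0; set w := c^-1.
have w0 : 0 < w by rewrite invr_gt0.
rewrite expRN ler_pdivrMr ?expR_gt0//.
have := @expR_ge1Dxn R w 1%N (ltW w0); rewrite (_ : 2`! = 2%N)// => h.
have {h} : w ^+ 2 / 2 <= expR w by apply: le_trans h; rewrite lerDr.
by rewrite ler_pdivrMr// mulrC.
Qed.

End smooth_functions_of_one_variable.

Section smooth_functions_of_several_variables.
Context (R : realType) (d : nat).
Local Notation V := 'rV[R]_d.
Implicit Types (U : set V) (f g : V -> R).
Let e (i : 'I_d) : V := delta_mx ord0 i.

Lemma difference_quotientE f (x v : V) :
  (fun h : R => h^-1 *: (((fun t : R => f (t *: v + x)) \o shift 0) (h *: 1) -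
     (fun t : R => f (t *: v + x)) 0)) =
  (fun h : R => h^-1 *: ((f \o shift x) (h *: v) - f x)).
Proof.
apply/funext => h /=; rewrite scale0r add0r addr0.
by rewrite [h *: 1]mulr1.
Qed.

Lemma is_derive_lineP f (x v : V) (l : R) :
  is_derive (0 : R) 1 (fun t : R => f (t *: v + x)) l <-> is_derive x v f l.
Proof.
by split=> -[]; rewrite /derivable /derive ?difference_quotientE => h1 h2;
  split; rewrite /derivable /derive ?difference_quotientE.
Qed.

Lemma is_derive_comp_rV (f : R -> R) g (x v : V) (l m : R) :
  is_derive (g x) 1 f m -> is_derive x v g l ->
  is_derive x v (fun y => f (g y)) (m * l).
Proof.
move=> hf /is_derive_lineP hg; apply/is_derive_lineP.
apply: (@is_derive1_comp _ f (fun t : R => g (t *: v + x))) => //.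
by rewrite scale0r add0r.
Qed.

(** A local version of [Ck]: smoothness of the cutoffs is checked on two open sets and glued by
    [CkOnU]. *)
Fixpoint CkOn U (k : nat) f : Prop :=
  match k with
  | 0 => forall x, U x -> {for x, continuous f}
  | k'.+1 => (forall x, U x -> {for x, continuous f}) /\
      forall i, (forall x, U x -> derivable f x (e i)) /\
        CkOn U k' (fun x => 'D_(e i) f x)
  end.

Lemma CkOn_continuous U k f : CkOn U k f -> forall x, U x -> {for x, continuous f}.
Proof. by case: k => [//|k] []. Qed.

Lemma CkOn_setT k f : CkOn setT k f -> Ck k f.
Proof.
elim: k f => [|k IH] f /=; first by move=> h x; exact: h.
move=> [cf h]; split; first by move=> x; exact: cf.
by move=> i; have [h1 h2] := h i; split; [move=> x; exact: h1|exact: IH].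
Qed.

Lemma Ck_setT k f : Ck k f -> CkOn setT k f.
Proof.
elim: k f => [|k IH] f /=; first by move=> h x _; exact: h.
move=> [cf h]; split; first by move=> x _; exact: cf.
by move=> i; have [h1 h2] := h i; split; [move=> x _; exact: h1|exact: IH].
Qed.

Lemma CkOnW U k f : CkOn U k.+1 f -> CkOn U k f.
Proof.
elim: k f => [|k IH] f; first by case.
by move=> [cf h]; split => // i; have [h1 h2] := h i; split => //; exact: IH.
Qed.

Lemma CkOnU U W k f : CkOn U k f -> CkOn W k f -> CkOn (U `|` W) k f.
Proof.
elim: k f => [|k IH] f /=; first by move=> h1 h2 x [/h1|/h2].
move=> [cU hU] [cW hW]; split; first by move=> x [/cU|/cW].
move=> i; have [h1 h2] := hU i; have [h3 h4] := hW i.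
by split; [move=> x [/h1|/h3]|exact: IH].
Qed.

Lemma CkOn_eq U k f g : open U -> (forall x, U x -> f x = g x) ->
  CkOn U k f -> CkOn U k g.
Proof.
move=> oU.
have near_fg (f' g' : V -> R) x : (forall x, U x -> f' x = g' x) -> U x ->
    \forall y \near x, f' y = g' y.
  by move=> fg Ux; near=> y; apply: fg; near: y; exact: open_nbhs_nbhs.
have cfg (f' g' : V -> R) x : (forall x, U x -> f' x = g' x) -> U x ->
    {for x, continuous f'} -> {for x, continuous g'}.
  move=> fg Ux cf A; rewrite -(fg _ Ux) => /cf fA.
  have fA' : \forall y \near x, A (f' y) by exact: fA.
  suff : \forall y \near x, A (g' y) by [].
  near=> y; have <- : f' y = g' y by near: y; exact: (near_fg _ _ _ fg Ux).
  by near: y.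
elim: k f g => [|k IH] f g fg /=.
  by move=> cf x Ux; exact: cfg (cf x Ux).
move=> [cf h]; split; first by move=> x Ux; exact: cfg (cf x Ux).
move=> i; have [h1 h2] := h i; split.
  move=> x Ux; apply: (near_eq_derivable (f := f)); last exact: h1.
  exact: (near_fg _ _ _ fg Ux).
by apply: IH h2 => x Ux; apply: near_eq_derive; exact: (near_fg _ _ _ fg Ux).
Unshelve. all: by end_near. Qed.

Lemma CkOn_intro U k f : open U -> (forall x, U x -> {for x, continuous f}) ->
  (forall i, exists2 g, (forall x, U x -> is_derive x (e i) f (g x)) & CkOn U k g) ->
  CkOn U k.+1 f.
Proof.
move=> oU cf h; split=> // i; have [g fg kg] := h i; split.
  by move=> x Ux; have [] := fg x Ux.
apply: CkOn_eq kg => // x Ux; have [_ gE] := fg x Ux; exact/esym/gE.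
Qed.

Lemma CkOn_is_derive U k f : CkOn U k.+1 f ->
  forall i x, U x -> is_derive x (e i) f ('D_(e i) f x).
Proof. by move=> [_ h] i x Ux; have [h1 _] := h i; split => //; exact: h1. Qed.

Lemma CkOn_cst U k (c : R) : open U -> CkOn U k (fun=> c).
Proof.
move=> oU; elim: k c => [|k IH] c; first by move=> x _; exact: cst_continuous.
apply: CkOn_intro => // [x _|i]; first exact: cst_continuous.
by exists (fun=> 0) => // x _; exact: is_derive_cst.
Qed.

Lemma CkOnD U k f g : open U -> CkOn U k f -> CkOn U k g ->
  CkOn U k (fun x => f x + g x).
Proof.
move=> oU; elim: k f g => [|k IH] f g hf hg.
  by move: hf hg => /= hf hg x Ux; exact: (continuousD (hf x Ux) (hg x Ux)).
apply: CkOn_intro => // [x Ux|i].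
  exact: (continuousD (CkOn_continuous hf Ux) (CkOn_continuous hg Ux)).
exists (fun x => 'D_(e i) f x + 'D_(e i) g x).
  move=> x Ux; have -> : (fun x => f x + g x) = f + g by apply/funext.
  by apply: is_deriveD; [exact: (CkOn_is_derive hf)|exact: (CkOn_is_derive hg)].
by apply: IH; [case: hf => _ /(_ i)[]|case: hg => _ /(_ i)[]].
Qed.

Lemma CkOnM U k f g : open U -> CkOn U k f -> CkOn U k g ->
  CkOn U k (fun x => f x * g x).
Proof.
move=> oU; elim: k f g => [|k IH] f g hf hg.
  by move: hf hg => /= hf hg x Ux; exact: (continuousM (hf x Ux) (hg x Ux)).
apply: CkOn_intro => // [x Ux|i].
  exact: (continuousM (CkOn_continuous hf Ux) (CkOn_continuous hg Ux)).
exists (fun x => f x * 'D_(e i) g x + g x * 'D_(e i) f x).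
  move=> x Ux; have -> : (fun x => f x * g x) = f * g by apply/funext.
  by apply: is_deriveM; [exact: (CkOn_is_derive hf)|exact: (CkOn_is_derive hg)].
apply: CkOnD => //; apply: IH; try exact: CkOnW.
  by case: hg => _ /(_ i)[].
by case: hf => _ /(_ i)[].
Qed.

Lemma CkOn_comp U (W : set R) k (f : R -> R) g : open U -> (forall x, U x -> W (g x)) ->
  C1On W k f -> CkOn U k g -> CkOn U k (fun x => f (g x)).
Proof.
move=> oU UW; elim: k f g UW => [|k IH] f g UW hf hg.
  by move: hf hg => /= hf hg x Ux; apply: continuous_comp; [exact: hg|exact: hf (UW _ Ux)].
have cf := C1On_continuous hf; have cg := CkOn_continuous hg.
apply: CkOn_intro => // [x Ux|i].
  by apply: continuous_comp; [exact: cg|exact: cf (UW _ Ux)].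
case: (hf) => f' ff' kf'.
exists (fun x => f' (g x) * 'D_(e i) g x).
  move=> x Ux; apply: is_derive_comp_rV; first exact: ff' (UW _ Ux).
  exact: (CkOn_is_derive hg).
apply: CkOnM => //; last by case: hg => _ /(_ i)[].
by apply: IH => //; exact: CkOnW.
Qed.

Lemma CkOn_coor U k (j : 'I_d) : open U -> CkOn U k (fun x : V => x ord0 j).
Proof.
move=> oU; case: k => [|k]; first by move=> x _; exact: coord_continuous.
apply: CkOn_intro => // [x _|i]; first exact: coord_continuous.
exists (fun=> e i ord0 j); last exact: CkOn_cst.
move=> x _; apply/is_derive_lineP.
have -> : (fun t : R => (t *: e i + x) ord0 j) = (fun t => t * e i ord0 j + x ord0 j).
  by apply/funext => t; rewrite !mxE.
have h1 : is_derive (0 : R) 1 (fun t : R => t) (1 : R) by exact: is_derive_id.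
have h2 := is_deriveD (is_deriveM h1 (is_derive_cst (e i ord0 j) (0 : R) 1))
  (is_derive_cst (x ord0 j) (0 : R) 1).
apply: (is_derive_eq h2).
by rewrite /GRing.scale/= mul0r add0r mulr1 addr0.
Qed.

Lemma CkOn_sqr_enorm U k : open U -> CkOn U k (fun x : V => enorm x ^+ 2).
Proof.
move=> oU; have -> : (fun x : V => enorm x ^+ 2) = (fun x => \sum_i x ord0 i ^+ 2).
  by apply/funext => x; rewrite sqr_enorm.
elim: (index_enum _) => [|i r IH].
  have -> : (fun x : V => \sum_(i <- [::]) x ord0 i ^+ 2) = (fun=> 0).
    by apply/funext => x; rewrite big_nil.
  exact: CkOn_cst.
have -> : (fun x : V => \sum_(j <- i :: r) x ord0 j ^+ 2) =
    (fun x => x ord0 i * x ord0 i + \sum_(j <- r) x ord0 j ^+ 2).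
  by apply/funext => x; rewrite big_cons.
by apply: CkOnD => //; apply: CkOnM => //; exact: CkOn_coor.
Qed.

End smooth_functions_of_several_variables.

(** * Logarithmic cutoffs *)

Section cutoff_functions.
Context (R : realType) (d : nat).

Lemma test_function_of_annulus (f : 'rV[R]_d -> R) (a b : R) : 0 < a ->
  smooth f -> (forall x, f x != 0 -> a <= enorm x <= b) -> test_functions_off0 f.
Proof.
move=> a0 sf supp.
have cq : continuous (fun x : 'rV[R]_d => enorm x).
  have -> : (fun x : 'rV[R]_d => enorm x) = Num.sqrt \o (fun x => enorm x ^+ 2).
    by apply/funext => x /=; rewrite sqrtr_sqr ger0_norm// enorm_ge0.
  move=> x; apply: continuous_comp; last by apply: sqrt_continuous.
  exact: (@CkOn_sqr_enorm R d setT 0 openT x I).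
have cA : closed [set x : 'rV[R]_d | a <= enorm x <= b].
  have -> : [set x : 'rV[R]_d | a <= enorm x <= b] = (@enorm R d) @^-1` `[a, b]%classic.
    by apply/seteqP; split => x /=; rewrite in_itv.
  by apply: closed_comp; [move=> x _; exact: cq|exact: itv_closed].
have clA : closure [set x | f x != 0] `<=` [set x : 'rV[R]_d | a <= enorm x <= b].
  rewrite [X in _ `<=` X](closure_id _).1//; apply: closure_subset => x.
  exact: supp.
split=> //; last first.
  by move=> /clA /=; rewrite enorm0 leNgt a0.
apply: bounded_closed_compact; last exact: closed_closure.
exists b; split; first exact: num_real.
move=> M bM x /clA /= /andP[_ xb].
exact: le_trans (sup_norm_le_enorm x) (le_trans xb (ltW bM)).
Qed.

Let c : R := (flat_exp 0 1 ^+ 2)^-1.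

Let c_gt0 : 0 < c.
Proof. by rewrite invr_gt0 exprn_gt0// /flat_exp ltr01 expr0 mul1r expR_gt0. Qed.

(** Normalized to be 1 at 0. It has no plateau; its Lipschitz bound makes the cutoffs converge to
    1. *)
Definition bump (t : R) : R := c * (flat_exp 0 (1 + t) * flat_exp 0 (1 - t)).

Lemma bump0 : bump 0 = 1.
Proof.
rewrite /bump addr0 subr0 -expr2 /c mulVf// expf_neq0//.
by rewrite /flat_exp ltr01 expr0 mul1r gt_eqF// expR_gt0.
Qed.

Lemma bump_eq0 t : 1 <= `|t| -> bump t = 0.
Proof.
move=> t1; rewrite /bump; have [t0|t0] := leP 0 t.
  rewrite [flat_exp 0 (1 - t)]/flat_exp ltNge subr_le0 (_ : 1 <= t) ?mulr0//.
  by rewrite ger0_norm in t1.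
rewrite [flat_exp 0 (1 + t)]/flat_exp ltNge (_ : 1 + t <= 0) ?mul0r ?mulr0//.
by rewrite ltr0_norm// in t1; lra.
Qed.

Lemma bump_lipschitz : exists2 L : R, 0 < L &
  forall s t, `|bump s - bump t| <= L * `|s - t|.
Proof.
exists (c * 4); first by rewrite mulr_gt0.
move=> s t; rewrite /bump -mulrBr normrM (gtr0_norm c_gt0) -mulrA ler_wpM2l ?(ltW c_gt0)//.
set A := flat_exp 0 (1 + s); set B := flat_exp 0 (1 - s).
set A' := flat_exp 0 (1 + t); set B' := flat_exp 0 (1 - t).
have -> : A * B - A' * B' = (A - A') * B + A' * (B - B') by ring.
have hA : `|A - A'| <= 2 * `|s - t|.
  apply: (le_trans (flat_exp0_lipschitz _ _)); rewrite (_ : 1 + s - _ = s - t)//; ring.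
have hB : `|B - B'| <= 2 * `|s - t|.
  apply: (le_trans (flat_exp0_lipschitz _ _)); rewrite (_ : 1 - s - _ = t - s) 1?distrC//; ring.
have -> : 4 * `|s - t| = 2 * `|s - t| * 1 + 1 * (2 * `|s - t|) by ring.
apply: (le_trans (ler_normD _ _)); rewrite !normrM lerD//.
  by apply: ler_pM => //; rewrite ger0_norm ?flat_exp_ge0 ?flat_exp0_le1.
by apply: ler_pM => //; rewrite ger0_norm ?flat_exp_ge0 ?flat_exp0_le1.
Qed.

(** This is the bump at ln |x| / ((k + 1) ln 2), written with |x|^2 because that is a polynomial; k
    + 1 keeps the denominator nonzero. *)
Definition cutoff (k : nat) (x : 'rV[R]_d) : R :=
  if 0 < enorm x then bump ((2 * k.+1%:R * ln 2)^-1 * ln (enorm x ^+ 2)) else 0.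

Let ln2 : 0 < ln 2 :> R. Proof. by rewrite ln_gt0// ltr1n. Qed.

Lemma cutoff_argE k (x : 'rV[R]_d) : 0 < enorm x ->
  (2 * k.+1%:R * ln 2)^-1 * ln (enorm x ^+ 2) = ln (enorm x) / (k.+1%:R * ln 2).
Proof.
have aux (K L l : R) : K != 0 -> L != 0 -> (2 * K * L)^-1 * (2 * l) = l / (K * L).
  by move=> K0 L0; field; rewrite K0 L0.
by move=> x0; rewrite lnXn// -[ln (enorm x) *+ 2]mulr_natl aux// ?pnatr_eq0// gt_eqF.
Qed.

Lemma cutoff_support k (x : 'rV[R]_d) :
  cutoff k x != 0 -> 2 ^- k.+1 <= enorm x <= 2 ^+ k.+1.
Proof.
rewrite /cutoff; case: ifPn => [x0|_]; last by rewrite eqxx.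
rewrite cutoff_argE//; set t := _ / _ => bt.
have t1 : `|t| < 1 by rewrite ltNge; apply/negP => /bump_eq0 t0; rewrite t0 eqxx in bt.
have K0 : 0 < k.+1%:R * ln 2 :> R by rewrite mulr_gt0.
have lnK : ln (2 ^+ k.+1 : R) = k.+1%:R * ln 2 by rewrite lnXn// mulr_natl.
move: t1; rewrite ltr_norml /t ltr_pdivlMr// ltr_pdivrMr// mulN1r mul1r -lnK.
move=> /andP[l1 l2]; apply/andP; split.
  by rewrite -ler_ln ?posrE ?invr_gt0 ?exprn_gt0// lnV ?posrE ?exprn_gt0// ltW.
by rewrite -ler_ln ?posrE ?exprn_gt0// ltW.
Qed.

(** Off the origin ([U]) the cutoff is a composition of smooth functions; on the ball of radius
    2^-(k+1) ([W]) it vanishes. *)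
Lemma cutoff_smooth k : smooth (cutoff k).
Proof.
move=> j; apply: CkOn_setT.
pose U := [set x : 'rV[R]_d | 0 < enorm x ^+ 2].
pose W := [set x : 'rV[R]_d | enorm x ^+ 2 < 4 ^- k.+1].
have cq : continuous (fun x : 'rV[R]_d => enorm x ^+ 2).
  by move=> x; exact: (@CkOn_sqr_enorm R d setT 0 openT x I).
have oU : open U.
  apply: (@open_comp _ _ (fun x : 'rV[R]_d => enorm x ^+ 2) [set t | 0 < t]).
    by move=> x _; exact: cq.
  exact: open_gt.
have oW : open W.
  apply: (@open_comp _ _ (fun x : 'rV[R]_d => enorm x ^+ 2) [set t | t < 4 ^- k.+1]).
    by move=> x _; exact: cq.
  exact: open_lt.
have -> : [set: 'rV[R]_d] = U `|` W.
  apply/esym/seteqP; split => // x _; rewrite /U /W /=.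
  have [x0|x0] := ltP 0 (enorm x ^+ 2); [by left|right].
  by apply: le_lt_trans x0 _; rewrite invr_gt0 exprn_gt0.
apply: CkOnU; last first.
  apply: (@CkOn_eq _ _ _ _ (fun=> 0)) => //; last exact: CkOn_cst.
  move=> x Wx; apply/esym/eqP/negPn/negP => /cutoff_support/andP[x1 _].
  move: Wx; rewrite /W/= ltNge => /negP; apply.
  have -> : 4 ^- k.+1 = (2 ^- k.+1) ^+ 2 :> R.
    by rewrite exprVn -exprM mulnC exprM (_ : 2 ^+ 2 = 4)//; ring.
  by rewrite lerXn2r// nnegrE ?invr_ge0 ?exprn_ge0// enorm_ge0.
pose a : R := (2 * k.+1%:R * ln 2)^-1.
have smooth_ln : CkOn U j (fun x : 'rV[R]_d => ln (enorm x ^+ 2)).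
  apply: (@CkOn_comp _ _ _ [set t | 0 < t]) => //; [exact: C1On_ln|exact: CkOn_sqr_enorm].
have smooth_arg (b : R) : CkOn U j (fun x : 'rV[R]_d => flat_exp 0 (1 + b * ln (enorm x ^+ 2))).
  apply: (@CkOn_comp _ _ _ setT) => //; first exact: C1On_flat_exp.
  by apply: CkOnD => //; [exact: CkOn_cst|apply: CkOnM => //; exact: CkOn_cst].
apply: (@CkOn_eq _ _ _ _ (fun x => c * (flat_exp 0 (1 + a * ln (enorm x ^+ 2)) *
   flat_exp 0 (1 + - a * ln (enorm x ^+ 2))))) => //.
  move=> x Ux; rewrite /cutoff ifT ?/bump ?mulNr//.
  by rewrite lt_neqAle enorm_ge0 andbT eq_sym -sqrf_eq0 gt_eqF.
apply: CkOnM => //; first exact: CkOn_cst.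
by apply: CkOnM.
Qed.

Lemma cutoff_test_function k : test_functions_off0 (cutoff k).
Proof.
apply: (@test_function_of_annulus _ (2 ^- k.+1) (2 ^+ k.+1)).
- by rewrite invr_gt0 exprn_gt0.
- exact: cutoff_smooth.
- exact: cutoff_support.
Qed.

Lemma cutoffB_test_function k l : test_functions_off0 (cutoff k \- cutoff l).
Proof.
apply: (@test_function_of_annulus _ (2 ^- (maxn k l).+1) (2 ^+ (maxn k l).+1)).
- by rewrite invr_gt0 exprn_gt0.
- move=> j; apply: CkOn_setT.
  have -> : cutoff k \- cutoff l = (fun x => cutoff k x + (-1) * cutoff l x).
    by apply/funext => x; rewrite mulN1r.
  have sm m : CkOn setT j (cutoff m) by exact: Ck_setT (cutoff_smooth m j).
  apply: CkOnD => //; first exact: openT.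
  by apply: CkOnM => //; [exact: openT|apply: CkOn_cst; exact: openT].
move=> x /=.
have grow m : (m <= maxn k l)%N -> cutoff m x != 0 ->
    2 ^- (maxn k l).+1 <= enorm x <= 2 ^+ (maxn k l).+1.
  move=> ml /cutoff_support/andP[x1 x2]; apply/andP; split.
    apply: le_trans x1; rewrite lef_pV2 ?posrE ?exprn_gt0//.
    by rewrite ler_eXn2l ?ltr1n.
  by apply: (le_trans x2); rewrite ler_eXn2l ?ltr1n.
have [->|] := eqVneq (cutoff k x) 0; last by move=> /(grow _ (leq_maxl _ _)).
by rewrite sub0r oppr_eq0 => /(grow _ (leq_maxr _ _)).
Qed.

Lemma cutoff_log_lipschitz : exists2 L : R, 0 < L &
  forall k (x y : 'rV[R]_d), 0 < enorm x -> 0 < enorm y ->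
  `|cutoff k x - cutoff k y| <= L / k.+1%:R * `|ln (enorm x) - ln (enorm y)|.
Proof.
have [L L0 bL] := bump_lipschitz; exists (L / ln 2); first by rewrite divr_gt0.
move=> k x y x0 y0; rewrite /cutoff x0 y0 !cutoff_argE//.
apply: (le_trans (bL _ _)); rewrite -mulrBl normrM normfV.
rewrite [`|_ * ln 2|]gtr0_norm ?mulr_gt0// le_eqVlt; apply/orP; left; apply/eqP.
by rewrite invfM; ring.
Qed.

Lemma cutoff_cvg (x : 'rV[R]_d) : 0 < enorm x -> cutoff k x @[k --> \oo] --> (1 : R).
Proof.
move=> x0; have [L L0 bL] := bump_lipschitz.
pose B := L * `|ln (enorm x) / ln 2|.
have bound k : `|1 - cutoff k x| <= B * k.+1%:R^-1.
  rewrite /cutoff x0 cutoff_argE// -[X in `|X - _|]bump0; apply: (le_trans (bL _ _)).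
  rewrite sub0r normrN /B -mulrA ler_wpM2l ?(ltW L0)//.
  rewrite -[X in _ <= _ * X](@ger0_norm _ k.+1%:R^-1)// -normrM.
  by rewrite (_ : _ / (_ * _) = ln (enorm x) / ln 2 / k.+1%:R)// -mulrA -invfM [ln 2 * _]mulrC.
apply/cvgrPdist_le => e e0; near=> k; apply: (le_trans (bound k)).
have B0 : 0 <= B by rewrite mulr_ge0 ?(ltW L0).
rewrite ler_pdivrMr// -ler_pdivrMl// mulrC.
apply: (@le_trans _ _ k%:R); last by rewrite ler_nat.
near: k; exact: nbhs_infty_ger.
Unshelve. all: by end_near. Qed.

End cutoff_functions.

(** * The closed form and its recurrence *)

Section L2_subsequence.
Context (disp : measure_display) (T : measurableType disp) (R : realType).
Variable mu : {measure set T -> \bar R}.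

(** The sum of the squares has a finite integral, so it is finite almost everywhere and its terms
    tend to 0. *)
Lemma ae_cvg0_of_summable (f : nat -> T -> R) :
  (forall i, measurable_fun setT (f i)) ->
  (forall i, (\int[mu]_x (f i x ^+ 2)%:E <= (2^-1 ^+ i)%:E)%E) ->
  {ae mu, forall x, f i x @[i --> \oo] --> (0 : R)}.
Proof.
move=> mf If; pose g i x := (f i x ^+ 2)%:E.
have mg i : measurable_fun setT (g i) by apply/measurable_EFinP; exact: measurable_funX.
have g0 i x : (0 <= g i x)%E by rewrite lee_fin sqr_ge0.
pose S x := (\sum_(0 <= i <oo) g i x)%E.
have mS : measurable_fun setT S by exact: (@ge0_emeasurable_sum _ _ _ _ g xpredT).
have S0 x : (0 <= S x)%E by exact: nneseries_ge0.
have IS : (\int[mu]_x S x <= 2%:E)%E.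
  rewrite integral_nneseries//; apply: lime_le.
    by apply: is_cvg_nneseries => i _ _; exact: integral_ge0.
  apply: nearW => n; apply: (@le_trans _ _ (\sum_(0 <= i < n) (2^-1 ^+ i)%:E)%E).
    by apply: lee_sum => i _; exact: If.
  rewrite sumEFin lee_fin; apply: (le_trans (sum_geometric_le n _)).
    by rewrite invr_ge0 ler0n/= invf_lt1// ltr1n.
  by rewrite le_eqVlt; apply/orP; left; apply/eqP; field.
have iS : mu.-integrable setT S.
  apply/integrableP; split => //; under eq_integral do rewrite gee0_abs//.
  by apply: le_lt_trans IS _; rewrite ltry.
apply: filterS (integrable_ae measurableT iS) => x /(_ I) Sfin.
have cvgS : cvgn (series (fun i => f i x ^+ 2)).
  apply: nnseries_is_cvg => [i|]; first exact: sqr_ge0.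
  by have := Sfin; rewrite ge0_fin_numE//; exact: S0.
have /cvgrPdist_lt h := cvg_series_cvg_0 cvgS.
apply/cvgrPdist_lt => e e0.
have := h (e ^+ 2) (exprn_gt0 2 e0); apply: filterS => i.
rewrite !sub0r !normrN (ger0_norm (sqr_ge0 _)) -real_normK ?num_real// => hi.
by rewrite -(@ltr_pXn2r _ 2) ?nnegrE ?(ltW e0)//.
Qed.

(** The condition i <= sigma i carries bounds valid from some index on over to the subsequence. *)
Lemma L2_cvg_ae_subsequence (v : nat -> T -> R) (u : T -> R) :
  (forall k, measurable_fun setT (v k)) -> measurable_fun setT u ->
  'N[mu]_2%:E[EFin \o (v k \- u)%R]%E @[k --> \oo] --> 0%E ->
  exists2 sigma : nat -> nat, (forall i, (i <= sigma i)%N) &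
    {ae mu, forall x, v (sigma i) x @[i --> \oo] --> u x}.
Proof.
move=> mv mu0 vu.
have ex i : exists k, (i <= k)%N /\
    (\int[mu]_x ((v k \- u) x ^+ 2)%:E <= (2^-1 ^+ i)%:E)%E.
  have c0 : 0 < Num.sqrt (2^-1 ^+ i : R) by rewrite sqrtr_gt0 exprn_gt0// invr_gt0.
  have [N HN] := cvge_eventually_lt vu c0.
  exists (maxn i N); split; first exact: leq_maxl.
  have := HN (maxn i N) (leq_maxr _ _); rewrite Lnorm2E => h.
  have I0 : (0 <= \int[mu]_x ((v (maxn i N) \- u) x ^+ 2)%:E)%E.
    by apply: integral_ge0 => x _; rewrite lee_fin sqr_ge0.
  have p0 : (0 <= (2^-1 ^+ i : R)%:E)%E by rewrite lee_fin exprn_ge0// invr_ge0.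
  by rewrite -(lee_sqrt _ p0); exact: ltW h.
have [sigma Hs] := choice ex.
exists sigma => [i|]; first by case: (Hs i).
have mvu i : measurable_fun setT (v (sigma i) \- u) by exact: measurable_funB.
apply: filterS (ae_cvg0_of_summable mvu (fun i => (Hs i).2)) => x h.
have -> : (fun i => v (sigma i) x) = (fun i => (v (sigma i) \- u) x + u x).
  by apply/funext => i /=; rewrite subrK.
rewrite -[X in _ --> X]add0r; apply: cvgD => //; exact: cvg_cst.
Qed.

End L2_subsequence.

(** * Energies on the closure and of sequences approximating 1 *)

Section closed_form.
Context (R : realType) (d : nat) (alpha delta : R).
Hypothesis d0 : (0 < d)%N.
Hypothesis const0 : 0 < stable_const d alpha.
Local Notation V := 'rV[R]_d.
Let mu := leb R d.
Let n := weighted_leb d delta.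
Let E := pre_form d alpha delta.
Let Q := @jump_energy R d alpha delta.
Let c : R := 2^-1 * stable_const d alpha.

Let c0 : 0 < c. Proof. by rewrite mulr_gt0// invr_gt0. Qed.

Let Q0 u : (0 <= Q u)%E.
Proof. by apply: integral_ge0 => p _; rewrite lee_fin jump_density_ge0. Qed.

(** The weight is positive off the origin, which is itself Lebesgue negligible. *)
Lemma ae_weighted_leb (P : V -> Prop) :
  {ae n, forall x, P x} -> {ae mu, forall x, P x}.
Proof.
move=> [A [mA nA PA]].
have w0 x : (0 <= weight delta x)%E by exact: weight_ge0.
have mw := @measurable_weight R d delta.
have wA : ae_eq mu A (weight delta) (cst 0%E).
  apply/(ae_eq_integral_abs mu mA); first exact: measurable_funTS.
  apply: (etrans _ nA); rewrite /n /weighted_leb /density_measure/= /density_measure_fun.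
  by apply: eq_integral => x _; rewrite /= ger0_norm ?powR_ge0.
have z : {ae mu, forall x : V, x != 0}.
  exists [set 0]; split; [exact: measurable_rV_set1|exact: leb_origin|].
  by move=> x /= /negP/negPn/eqP.
apply: filterS2 z wA => x x0 wx; apply: contrapT => nP.
have Ax : A x by apply: PA.
have := wx Ax; rewrite /weight/= => -[]/eqP.
by rewrite gt_eqF// powR_gt0// enorm_gt0.
Qed.

Lemma ae_product_leb (P : V -> Prop) : {ae mu, forall x, P x} ->
  {ae (mu \x mu)%E, forall p : V * V, P p.1 /\ P p.2}.
Proof.
move=> [A [mA A0 PA]].
have h1 : {ae (mu \x mu)%E, forall p : V * V, P p.1}.
  exists (A `*` setT); split; first exact: measurableX.
    rewrite product_measure1E//; apply/eqP; rewrite mule_eq0.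
    by apply/orP; left; apply/eqP; exact: A0.
  by move=> p /= np; split => //; exact: PA.
have h2 : {ae (mu \x mu)%E, forall p : V * V, P p.2}.
  exists (setT `*` A); split; first exact: measurableX.
    rewrite product_measure1E//; apply/eqP; rewrite mule_eq0.
    by apply/orP; right; apply/eqP; exact: A0.
  by move=> p /= np; split => //; exact: PA.
by apply: filterS2 h1 h2.
Qed.

Lemma jump_energy_fatou (v : nat -> V -> R) (u : V -> R) (e : \bar R) (N : nat) :
  (forall k, measurable_fun setT (v k)) -> measurable_fun setT u ->
  {ae n, forall x, v k x @[k --> \oo] --> u x} ->
  (forall k, (N <= k)%N -> (Q (v k) <= e)%E) -> (Q u <= e)%E.
Proof.
move=> mv mu0 vu Qv.
apply: (@fatou_le R _ _ (mu \x mu)%E (fun k => jump_density alpha delta (v k)) _ _ N) => //.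
- by move=> k; exact: measurable_jump_density.
- by move=> k p; exact: jump_density_ge0.
- exact: measurable_jump_density.
- by move=> p; exact: jump_density_ge0.
apply: filterS (ae_product_leb (ae_weighted_leb vu)) => -[x y] /= [vx vy].
rewrite /jump_density/=; apply: cvgM; last exact: cvg_cst.
have h : v k x - v k y @[k --> \oo] --> u x - u y by exact: cvgB.
by rewrite expr2; under eq_fun do rewrite expr2; exact: cvgM.
Qed.

Lemma jump_energy_lincomb (f g h : V -> R) (s : R) : 0 < s ->
  measurable_fun setT g -> measurable_fun setT h -> (forall x, f x = g x + h x) ->
  (Q f <= (1 + s)%:E * Q g + (1 + s^-1)%:E * Q h)%E.
Proof.
move=> s0 mg mh fE.
have mf : measurable_fun setT f.
  by rewrite (_ : f = g \+ h); [exact: measurable_funD|apply/funext].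
have s1 : 0 <= 1 + s by rewrite addr_ge0// ltW.
have s2 : 0 <= 1 + s^-1 by rewrite addr_ge0// invr_ge0 ltW.
have md w : measurable_fun setT w -> measurable_fun setT (jump_density alpha delta w).
  exact: measurable_jump_density.
have jd0 w p := jump_density_ge0 alpha delta w p.
rewrite /Q /jump_energy -!ge0_integralM_EFin//; try exact: md.
rewrite -ge0_integralD_EFin; last 4 first.
- by apply: measurable_funM => //; exact: md.
- by apply: measurable_funM => //; exact: md.
- by move=> p; rewrite mulr_ge0.
- by move=> p; rewrite mulr_ge0.
apply: ge0_le_integral_EFin => //.
- exact: md.
- by apply: measurable_funD; apply: measurable_funM => //; exact: md.
move=> [x y]; rewrite /jump_density/= !mulrA -mulrDl ler_wpM2r//.
  by rewrite invr_ge0 !mulr_ge0 ?powR_ge0.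
rewrite !fE; set a := g x - g y; set b := h x - h y.
have -> : g x + h x - (g y + h y) = a + b by rewrite /a /b; ring.
rewrite -subr_ge0 (_ : _ - _ = (s * a - b) ^+ 2 / s); last by field; rewrite gt_eqF.
by rewrite divr_ge0 ?sqr_ge0// ltW.
Qed.

Lemma pre_form_energyZ w : energy E w = (c%:E * Q w)%E.
Proof. exact: pre_form_energyE. Qed.

Lemma scaled_lt_le (q : \bar R) (e : R) : (c%:E * q < (c * e)%:E)%E -> (q <= e%:E)%E.
Proof.
rewrite (EFinM c e) => h; rewrite leNgt; apply/negP => /ltW eq; move: h.
by apply/negP; rewrite -leNgt; apply: lee_wpmul2l => //; rewrite lee_fin; exact: ltW.
Qed.

Lemma pre_form_energy_lt w (e : R) : (energy E w < (c * e)%:E)%E -> (Q w <= e%:E)%E.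
Proof. by rewrite pre_form_energyZ; exact: scaled_lt_le. Qed.

(** Along an almost everywhere convergent subsequence, Fatou's lemma bounds Q (t j - u) by the
    energies of t j - t (sigma i), small by the Cauchy property. *)
Lemma closure_approx_energy_small (u : V -> R) (t : nat -> V -> R) :
  measurable_fun setT u -> closure_approx n E u t ->
  forall e : R, 0 < e -> exists N, forall j, (N <= j)%N -> (Q (t j \- u)%R <= e%:E)%E.
Proof.
move=> mu0 [tE tC tu] e e0.
have mt k : measurable_fun setT (t k) by exact: (test_function_measurable (tE k)).
have [sigma si su] := L2_cvg_ae_subsequence mt mu0 tu.
have [N HN] := tC (c * e) (mulr_gt0 c0 e0); exists N => j Nj.
apply: (@jump_energy_fatou (fun i => t j \- t (sigma i)) _ _ N).
- by move=> i; exact: measurable_funB.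
- exact: measurable_funB.
- by apply: filterS su => x h; apply: cvgB => //; exact: cvg_cst.
by move=> i Ni; apply: pre_form_energy_lt; apply: HN => //; exact: leq_trans (si i).
Qed.

Lemma closure_approx_energy_cvg (u : V -> R) (t : nat -> V -> R) :
  measurable_fun setT u -> closure_approx n E u t ->
  energy E (t k) @[k --> \oo] --> (c%:E * Q u)%E.
Proof.
move=> mu0 tu; have small := closure_approx_energy_small mu0 tu.
have mt k : measurable_fun setT (t k) by case: tu => tE _ _; exact: (test_function_measurable (tE k)).
have mtu k : measurable_fun setT (t k \- u) by exact: measurable_funB.
have mut k : measurable_fun setT (u \- t k) by exact: measurable_funB.
have Qsym k : Q (u \- t k) = Q (t k \- u).
  apply: eq_integral => p _; congr EFin; rewrite /jump_density/=; congr (_ / _).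
  by rewrite -[LHS]sqrrN; congr (_ ^+ 2); ring.
have up s k : 0 < s -> (Q (t k) <= (1 + s)%:E * Q u + (1 + s^-1)%:E * Q (t k \- u)%R)%E.
  by move=> s0; apply: jump_energy_lincomb => // x /=; ring.
have low s k : 0 < s -> (Q u <= (1 + s)%:E * Q (t k) + (1 + s^-1)%:E * Q (t k \- u)%R)%E.
  by move=> s0; rewrite -Qsym; apply: jump_energy_lincomb => // x /=; ring.
have -> : (fun k => energy E (t k)) = (fun k => c%:E * Q (t k))%E.
  by apply/funext => k; exact: pre_form_energyZ.
apply: cvgeZl => //.
have [N1 HN1] := small 1 ltr01.
(* If Q u is infinite, so is Q (t k) for large k, because Q (t k - u) is then finite. *)
have [Qy|Qfin] := eqVneq (Q u) +oo%E.
  rewrite Qy; apply/cvgeyPge => M; exists N1 => // k /= N1k.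
  have := low 1 k ltr01; rewrite Qy leye_eq => /eqP h.
  have b : ((1 + 1^-1)%:E * Q (t k \- u)%R < +oo)%E.
    by rewrite lte_mul_pinfty ?lee_fin//; apply: le_lt_trans (HN1 k N1k) _; rewrite ltry.
  have [->|tk] := eqVneq (Q (t k)) +oo%E; first by rewrite leey.
  have a : ((1 + 1)%:E * Q (t k) < +oo)%E by rewrite lte_mul_pinfty ?lee_fin// ltey.
  by have := lte_add_pinfty a b; rewrite h.
have Qf : Q u \is a fin_num by rewrite ge0_fin_numE// ltey.
have tfin k : (N1 <= k)%N -> Q (t k) \is a fin_num.
  move=> Nk; rewrite ge0_fin_numE//; apply: le_lt_trans (up 1 k ltr01) _.
  rewrite lte_add_pinfty// lte_mul_pinfty ?lee_fin//; first by rewrite ltey.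
  by apply: le_lt_trans (HN1 k Nk) _; rewrite ltry.
rewrite -(fineK Qf); apply/fine_cvgP; split; first by exists N1.
apply/cvgrPdist_le => e e0; set q := fine (Q u).
have q0 : 0 <= q by rewrite fine_ge0.
(* Both energies will be at most q + e, and s (q + e) <= e / 2; the index N2 is such that the term
   in Q (t k - u) costs the other half. *)
pose s := e / (2 * (q + e + 1)).
have den0 : 0 < 2 * (q + e + 1) by move: q0 e0; lra.
have s0 : 0 < s by rewrite divr_gt0.
have sE : s * (q + e) <= e / 2.
  rewrite /s mulrAC ler_pdivrMr//; move: e0 q0; nra.
have t0 : 0 < 1 + s^-1 by rewrite addr_gt0// invr_gt0.
pose e' := e / 2 / (1 + s^-1).
have e'0 : 0 < e' by rewrite !divr_gt0.
have e'E : (1 + s^-1) * e' = e / 2 by rewrite /e' mulrC divfK// gt_eqF.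
have [N2 HN2] := small e' e'0.
exists (maxn N1 N2) => // k /=; rewrite geq_max => /andP[h1 h2].
have fk := tfin k h1; have b := HN2 k h2.
have bf : Q (t k \- u) \is a fin_num.
  by rewrite ge0_fin_numE//; apply: le_lt_trans b _; rewrite ltry.
have := up s k s0; have := low s k s0; move: b.
rewrite -(fineK fk) -(fineK bf) -(fineK Qf) -/q /=.
set a := fine (Q (t k)); set b := fine (Q (t k \- u)).
rewrite -!EFinM -!EFinD !lee_fin => b1 l1 u1.
have b2 : (1 + s^-1) * b <= e / 2 by rewrite -e'E ler_wpM2l// ltW.
have a0 : 0 <= a by rewrite fine_ge0.
have u2 : a <= q + e.
  have : s * q <= s * (q + e) by rewrite ler_wpM2l ?(ltW s0)// lerDl ltW.
  by move: u1 b2 sE; lra.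
have sa : s * a <= s * (q + e) by rewrite ler_wpM2l// ltW.
by rewrite ler_norml; apply/andP; split; move: u2 sa sE l1 b2; lra.
Qed.

Lemma closure_energyE (u : V -> R) : measurable_fun setT u ->
  (exists t, closure_approx n E u t) ->
  energy (dirichlet_form d alpha delta) u = (c%:E * Q u)%E.
Proof.
move=> mu0 [t tu]; rewrite /dirichlet_form /form_closure/=.
set S := [set r | _].
have eS : exists r, S r.
  by exists (c%:E * Q u)%E; exists t => //; exact: closure_approx_energy_cvg.
have [v vu Er] := xgetPex +oo%E eS.
exact: (cvg_unique _ Er (closure_approx_energy_cvg mu0 vu)).
Qed.

(** A finite energy is not the default value, so an approximating sequence exists. This serves for
    differences [v k \- v l], of which only a Cauchy bound is given. *)
Lemma closure_energy_lty (u : V -> R) : measurable_fun setT u ->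
  (energy (dirichlet_form d alpha delta) u < +oo)%E ->
  energy (dirichlet_form d alpha delta) u = (c%:E * Q u)%E.
Proof.
move=> mu0 fin; apply: closure_energyE => //; apply: contrapT => nt.
move: fin; rewrite /dirichlet_form /form_closure/= xgetPN ?ltxx//.
by move=> r [v vu _]; apply: nt; exists v.
Qed.

Lemma test_function_dom (f : V -> R) : test_functions_off0 f ->
  dom (dirichlet_form d alpha delta) f /\
  energy (dirichlet_form d alpha delta) f = (c%:E * Q f)%E.
Proof.
move=> tf; have mf := test_function_measurable tf.
have ff : closure_approx n E f (fun=> f).
  have z : f \- f = (fun=> 0) by apply/funext => x /=; rewrite subrr.
  split=> [//|e e0|].
    exists 0%N => k l _ _; rewrite z pre_form_energyZ /Q /jump_energy.
    rewrite integral0_eq ?mule0 ?lte_fin// => p _.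
    by rewrite /jump_density subrr expr0n/= mul0r.
  rewrite z (_ : (fun _ : nat => _) = (fun=> 0%E)); first exact: cvg_cst.
  by apply/funext => _; exact: Lnorm0.
split; last by apply: closure_energyE => //; exists (fun=> f).
by split; [exact: test_function_Lfun|exists (fun=> f)].
Qed.

(** Constants do not change [Q], so Q (v k) = Q (v k - 1), which Fatou's lemma bounds by the
    energies of v k - v l. The Cauchy property thus forces the limit 0. *)
Lemma extended_energy_one (v : nat -> V -> R) :
  extended_approx n (dirichlet_form d alpha delta) (cst 1%E) v ->
  energy (dirichlet_form d alpha delta) (v k) @[k --> \oo] --> 0%E.
Proof.
move=> [vD vC v1].
have mv k : measurable_fun setT (v k) by case: (vD k) => /Lfun_measurable.
have vE k : energy (dirichlet_form d alpha delta) (v k) = (c%:E * Q (v k))%E.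
  by apply: closure_energyE => //; case: (vD k).
have Qsmall e : 0 < e -> exists N, forall k, (N <= k)%N -> (Q (v k) <= e%:E)%E.
  move=> e0; have [N HN] := vC (c * e) (mulr_gt0 c0 e0); exists N => k Nk.
  have -> : Q (v k) = Q (fun x => v k x - 1).
    apply: eq_integral => p _; congr EFin; rewrite /jump_density/=; congr (_ / _).
    by congr (_ ^+ 2); ring.
  apply: (@jump_energy_fatou (fun l => v k \- v l) _ _ N).
  - by move=> l; exact: measurable_funB.
  - exact: measurable_funB.
  - apply: filterS v1 => x h; apply: cvgB; first exact: cvg_cst.
    exact: (cvg_EFin_real h).
  move=> l Nl; have h := HN k l Nk Nl.
  have hE := closure_energy_lty (measurable_funB (mv k) (mv l)) (lt_trans h (ltry _)).
  by move: h; rewrite hE; exact: scaled_lt_le.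
have -> : (fun k => energy (dirichlet_form d alpha delta) (v k)) = (fun k => c%:E * Q (v k))%E.
  by apply/funext.
rewrite -[X in _ --> X](mule0 c%:E); apply: cvgeZl => //.
have [N1 HN1] := Qsmall 1 ltr01.
have fin k : (N1 <= k)%N -> Q (v k) \is a fin_num.
  by move=> Nk; rewrite ge0_fin_numE//; apply: le_lt_trans (HN1 k Nk) _; rewrite ltry.
apply/fine_cvgP; split; first by exists N1.
apply/cvgrPdist_le => e e0; have [N2 HN2] := Qsmall e e0.
exists (maxn N1 N2) => // k /=; rewrite geq_max => /andP[h1 h2].
rewrite sub0r normrN ger0_norm ?fine_ge0//.
by have := HN2 k h2; rewrite -(fineK (fin k h1)) lee_fin.
Qed.

(** Whichever sequence [xget] selects, its energies tend to 0; recurrence reduces to exhibiting one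
    sequence. *)
Lemma recurrent_of_approx (v : nat -> V -> R) :
  extended_approx n (dirichlet_form d alpha delta) (cst 1%E) v ->
  recurrent n (dirichlet_form d alpha delta).
Proof.
move=> v1; split.
  split; [exact: measurable_cst|by apply: nearW|by exists v].
rewrite /extended_energy; set S := [set r | _].
have eS : exists r, S r by exists 0%E; exists v => //; exact: extended_energy_one.
have [w w1 Er] := xgetPex +oo%E eS.
exact: (cvg_unique _ Er (extended_energy_one w1)).
Qed.

End closed_form.

(** * Recurrence when 2 delta + alpha = d *)

Section critical_case.
Context (R : realType) (d : nat) (alpha delta : R).
Hypotheses (d0 : (0 < d)%N) (alpha0 : 0 < alpha) (alpha2 : alpha < 2).
Hypotheses (alphad : alpha < d%:R) (critical : 2 * delta + alpha = d%:R).
Let c : R := 2^-1 * stable_const d alpha.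

Let const0 : 0 < stable_const d alpha.
Proof. by apply: stable_const_gt0; rewrite alpha0. Qed.

Let c_gt0 : 0 < c.
Proof. by rewrite mulr_gt0// invr_gt0. Qed.

Lemma jump_energy_cutoff : exists2 K : R, 0 <= K & forall k,
  (jump_energy alpha delta (@cutoff R d k) <= (K / k.+1%:R)%:E)%E.
Proof.
have [C C0 energy_le] := jump_energy_log_lipschitz alpha0 alpha2 alphad critical.
have [L L0 lip] := cutoff_log_lipschitz R d.
(* The Lipschitz constant L / (k + 1), squared, meets 2 (k + 1) + 1 <= 3 (k + 1) shells. *)
exists (C * L ^+ 2 * 3) => [|k].
  exact: mulr_ge0 (mulr_ge0 C0 (sqr_ge0 L)) (ler0n _ _).
have k0 : 0 < k.+1%:R :> R by [].
have mc : measurable_fun setT (@cutoff R d k).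
  exact: test_function_measurable (cutoff_test_function R d k).
apply: (le_trans (energy_le k.+1 (L / k.+1%:R) _ _ mc (lip k) (@cutoff_support R d k))).
  exact: divr_ge0 (ltW L0) (ltW k0).
rewrite lee_fin -[X in _ * X <= _]/((k.+1).*2.+1%:R).
have h : (k.+1).*2.+1%:R <= 3 * k.+1%:R :> R by rewrite -natrM ler_nat; lia.
apply: (@le_trans _ _ (C * (L / k.+1%:R) ^+ 2 * (3 * k.+1%:R))).
  exact: ler_wpM2l (mulr_ge0 C0 (sqr_ge0 _)) _ _ h.
rewrite le_eqVlt; apply/orP; left; apply/eqP.
by field; rewrite nat1r gt_eqF.
Qed.

Lemma recurrent_dirichlet_form :
  recurrent (weighted_leb d delta) (dirichlet_form d alpha delta).
Proof.
apply: (@recurrent_of_approx _ _ _ _ d0 const0 (@cutoff R d)).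
have mc k : measurable_fun setT (@cutoff R d k).
  exact: test_function_measurable (cutoff_test_function R d k).
split.
- move=> k; exact: (test_function_dom delta d0 const0 (cutoff_test_function R d k)).1.
- have [K K0 cutoffE] := jump_energy_cutoff.
  (* The energy of the difference is at most twice the sum of the two energies, so each 2 c K / (m +
     1) has to be below e / 2. *)
  move=> e e0; pose N := Num.truncn (4 * c * K / e); exists N => k l Nk Nl.
  rewrite (test_function_dom delta d0 const0 (cutoffB_test_function R d k l)).2 -/c.
  have small m : (N <= m)%N -> (c * 4 * (K / m.+1%:R)) < e.
    move=> Nm; have m0 : 0 < m.+1%:R :> R by [].
    rewrite mulrA ltr_pdivrMr// -ltr_pdivrMl// mulrC.
    have -> : c * 4 * K / e = 4 * c * K / e by ring.
    apply: lt_le_trans (Num.Theory.truncnS_gt _) _.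
    by rewrite ler_nat.
  have Qle : (jump_energy alpha delta (@cutoff R d k \- @cutoff R d l)%R <=
      (2 * (K / k.+1%:R) + 2 * (K / l.+1%:R))%:E)%E.
    apply: (le_trans (@jump_energy_lincomb _ _ alpha delta _ (@cutoff R d k)
      (fun x => - @cutoff R d l x) 1 ltr01 (mc k) _ _)) => //.
      by apply: measurableT_comp.
    have -> : jump_energy alpha delta (fun x => - @cutoff R d l x) =
        jump_energy alpha delta (@cutoff R d l).
      apply: eq_integral => p _; congr EFin; rewrite /jump_density/=; congr (_ / _).
      by rewrite -[LHS]sqrrN; congr (_ ^+ 2); ring.
    rewrite invr1 [leRHS]EFinD (EFinM 2 (K / k.+1%:R)) (EFinM 2 (K / l.+1%:R)).
    by apply: leeD; apply: lee_wpmul2l; rewrite ?lee_fin//; exact: cutoffE.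
  apply: (le_lt_trans (lee_wpmul2l _ Qle)); first by rewrite lee_fin ltW.
  rewrite -EFinM lte_fin; have := small k Nk; have := small l Nl.
  by move: (K / l.+1%:R) (K / k.+1%:R) => x y; lra.
apply: filterS (ae_weighted_leb_neq0 delta d0) => x x0.
apply: cvg_EFin; first by apply: nearW.
by apply: cutoff_cvg; rewrite enorm_gt0.
Qed.

End critical_case.

Theorem mainTheorem7 (R : realType) (d : nat) (alpha delta : R)
    (hd : (1 <= d)%N) (halpha0 : 0 < alpha) (halpha2 : alpha < 2)
    (halphad : alpha < d%:R)
    (hdelta0 : 0 <= delta) (hdelta : delta <= d%:R - alpha) :
  (recurrent (weighted_leb d delta) (dirichlet_form d alpha delta) <->
     delta = (d%:R - alpha) / 2) /\
  (delta <> (d%:R - alpha) / 2 ->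
     transient (weighted_leb d delta) (dirichlet_form d alpha delta)).
Proof.
have const0 : 0 < stable_const d alpha by apply: stable_const_gt0; rewrite halpha0.
have noncritical : delta <> (d%:R - alpha) / 2 -> 2 * delta + alpha != d%:R.
  by move=> ne; apply/eqP => eq; apply: ne; lra.
split; last by move=> /noncritical ne;
  exact: (transient_dirichlet_form hd halpha0 hdelta0 ne const0).
split=> [rec|deltaE].
  apply: contrapT => /noncritical ne.
  exact: (not_recurrent_dirichlet_form hd halpha0 hdelta0 ne const0 rec).
by apply: recurrent_dirichlet_form => //; rewrite deltaE; field.
Qed.
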